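(* Let $d\ge2$ be an integer, $1<b<\frac{d+1}{d-1}$ and $\lambda\in\operatorname{Arc}[\lambda_0,\lambda_1)$. Then for every $z\in\mathbb S^1\setminus I$ there exists $\omega\in\Omega$ such that $z\in J_\omega$.
   Context: $\mathbb S^1$ is the unit circle. For $\alpha,\beta\in\mathbb S^1$, $\operatorname{Arc}[\alpha,\beta]$ is the closed circular arc from $\alpha$ to $\beta$ traversed counterclockwise, with analogous notation for open and half-open arcs. For $1\le k\le d$ let $f_k(z)=f_{k,\lambda}(z)=\lambda\left(\frac{z+b}{bz+1}\right)^k$. Put $\widehat f_d=f_d$ and $\widehat f_k=f_1\circ f_k$ for $1\le k\le d-1$. $\Omega=\{1,\dots,d\}^{\mathbb N}$, and for $\omega=(\omega_1,\omega_2,\dots)\in\Omega$, $\widehat f^{\,n}_{\omega}=\widehat f_{\omega_n}\circ\cdots\circ\widehat f_{\omega_1}$. $J_\omega$ is the Julia set of the sequence $\{\widehat f^{\,n}_\omega\}_n$, i.e. the set of points of $\widehat{\mathbb C}$ having no neighborhood on which this family is normal. $\lambda_0=e^{i\theta_0}\in\mathbb S^1$ is the parameter with the smallest positive angle $\theta_0$ for which $f_{d,\lambda_0}(\lambda_0)=1$; $\lambda_1\in\mathbb S^1$ is the unique parameter with $0<\arg\lambda_1<\pi$ for which $f_{d,\lambda_1}$ has a parabolic fixed point; one has $0<\arg\lambda_0<\arg\lambda_1<\pi$. For $\lambda\in\operatorname{Arc}(\overline{\lambda_1},\lambda_1)$ the map $f_{d,\lambda}$ has a unique attracting fixed point, which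 lies on $\mathbb S^1$; $I=I_\lambda$ denotes the connected component of (Fatou set of $f_{d,\lambda}$)$\,\cap\,\mathbb S^1$ containing it. *)

(* Defs.v *)
From HB Require Import structures.
From mathcomp Require Import all_boot all_order all_algebra.
From mathcomp Require Import complex.
From mathcomp Require Import all_classical all_reals all_analysis.
Import Order.TTheory GRing.Theory Num.Theory.
Import numFieldNormedType.Exports.

Set Implicit Arguments.
Unset Strict Implicit.
Unset Printing Implicit Defensive.

Local Open Scope classical_set_scope.
Local Open Scope ring_scope.
Local Open Scope complex_scope.

(* The Riemann sphere; [None] is the point at infinity. The topology of the
   complex plane is carried by the alias R[i]^o. *)
Notation sphere R := (one_point_compactification (R[i]^o)).

Definition cis (R : realType) (t : R) : R[i] := cos t +i* sin t.

Definition unit_circle (R : realType) : set (sphere R) :=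
  [set (Some z : sphere R) | z in [set z : R[i] | `|z| = 1]].

(* Arc[u, v), counterclockwise from u to v; empty if u = v. *)
Definition arc_co (R : realType) (u v : R[i]) : set R[i] :=
  [set z | exists r s t : R,
    [/\ u = cis r, v = cis s, z = cis t, s < r + 2 * pi & r <= t < s]].

Definition chordal (R : realType) (x y : sphere R) : R :=
  let nm := @ComplexField.Normc.normc R in
  match x, y with
  | Some z, Some w =>
      2 * nm (z - w) / (Num.sqrt (1 + nm z ^+ 2) * Num.sqrt (1 + nm w ^+ 2))
  | Some z, None | None, Some z => 2 / Num.sqrt (1 + nm z ^+ 2)
  | None, None => 0
  end.

Definition converges_loc_unif (R : realType) (U : set (sphere R))
    (F : nat -> sphere R -> sphere R) (g : sphere R -> sphere R) : Prop :=
  forall K : set (sphere R), compact K -> K `<=` U ->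
  forall e : R, 0 < e ->
    \forall n \near \oo, forall x, K x -> chordal (F n x) (g x) < e.

Definition normal_on (R : realType) (U : set (sphere R))
    (fam : set (sphere R -> sphere R)) : Prop :=
  forall F : nat -> sphere R -> sphere R, (forall n, fam (F n)) ->
  exists (phi : nat -> nat) (g : sphere R -> sphere R),
    {homo phi : m n / (m < n)%N} /\ converges_loc_unif U (F \o phi) g.

Definition fatou_set (R : realType) (F : nat -> sphere R -> sphere R) :
    set (sphere R) :=
  [set x | exists2 U : set (sphere R), open_nbhs x U & normal_on U (range F)].

Definition julia_set (R : realType) (F : nat -> sphere R -> sphere R) :
    set (sphere R) := ~` fatou_set F.

Definition iterates (R : realType) (f : sphere R -> sphere R) (n : nat) :
    sphere R -> sphere R := iter n.+1 f.

Definition sphere_inv (R : realType) (x : sphere R) : sphere R :=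
  match x with
  | Some z => if z == 0 then None else Some z^-1
  | None => Some 0
  end.

(* The default 0 is irrelevant: only germs at points with finite image are used. *)
Definition affine_coord (R : realType) (f : sphere R -> sphere R)
    (z : R[i]^o) : R[i]^o := if f (Some z) is Some w then w else 0.

(* m is the multiplier of f at its fixed point p; at infinity, the derivative
   is taken in the coordinate 1/z. *)
Definition has_multiplier (R : realType) (f : sphere R -> sphere R)
    (p : sphere R) (m : R[i]) : Prop :=
  match p with
  | Some z => is_derive (z : R[i]^o) (1 : R[i]^o) (affine_coord f) (m : R[i]^o)
  | None => is_derive (0 : R[i]^o) (1 : R[i]^o)
              (affine_coord (@sphere_inv R \o f \o @sphere_inv R)) (m : R[i]^o)
  end.

Definition attracting_fixed_point (R : realType) (f : sphere R -> sphere R)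
    (p : sphere R) : Prop :=
  f p = p /\ exists2 m : R[i], has_multiplier f p m & `|m| < 1.

Definition parabolic_fixed_point (R : realType) (f : sphere R -> sphere R)
    (p : sphere R) : Prop :=
  f p = p /\
  exists2 m : R[i], has_multiplier f p m & exists2 n, (0 < n)%N & m ^+ n = 1.

(* z |-> l ((z + b) / (b z + 1))^k, extended to the pole and to infinity
   (for k >= 1 and b <> -1, 0, 1). *)
Definition fk (R : realType) (b : R) (l : R[i]) (k : nat) (x : sphere R) :
    sphere R :=
  match x with
  | Some z => if b%:C * z + 1 == 0 then None
              else Some (l * ((z + b%:C) / (b%:C * z + 1)) ^+ k)
  | None => Some (l * (b%:C)^-1 ^+ k)
  end.

Definition fhat (R : realType) (d : nat) (b : R) (l : R[i]) (k : nat) :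
    sphere R -> sphere R :=
  if k == d then fk b l d else fk b l 1 \o fk b l k.

Definition Omega (d : nat) : set (nat -> nat) :=
  [set w | forall n, (1 <= w n <= d)%N].

(* [w n] is the entry of index n + 1 of the word w, and [fhat_seq d b l w n] is
   the composition of the first n + 1 maps. *)
Fixpoint fhat_seq (R : realType) (d : nat) (b : R) (l : R[i])
    (w : nat -> nat) (n : nat) : sphere R -> sphere R :=
  if n is n'.+1 then fhat d b l (w n) \o fhat_seq d b l w n'
  else fhat d b l (w 0%N).

Definition is_lambda0 (R : realType) (d : nat) (b : R) (l0 : R[i]) : Prop :=
  let good t := 0 < t /\ fk b (cis t) d (Some (cis t)) = Some 1 in
  exists t0 : R,
    [/\ l0 = cis t0, good t0 & forall t : R, good t -> t0 <= t].

Definition is_lambda1 (R : realType) (d : nat) (b : R) (l1 : R[i]) : Prop :=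
  (exists2 t : R, 0 < t < pi & l1 = cis t) /\
  exists p, parabolic_fixed_point (fk b l1 d) p.

(* I_lambda, where p is the attracting fixed point of f_{d,lambda}. *)
Definition attracting_arc (R : realType) (d : nat) (b : R) (l : R[i])
    (p : sphere R) : set (sphere R) :=
  connected_component (fatou_set (iterates (fk b l d)) `&` @unit_circle R) p.

(* Main.v *)
Require Import Defs.
From mathcomp Require Import all_boot all_order all_algebra.
From mathcomp Require Import complex.
From mathcomp Require Import all_classical all_reals all_analysis.
From mathcomp Require Import ring lra.
Import Order.TTheory GRing.Theory Num.Theory.
Import numFieldNormedType.Exports.
Set Implicit Arguments.
Unset Strict Implicit.
Unset Printing Implicit Defensive.
Local Open Scope classical_set_scope.
Local Open Scope ring_scope.
Local Open Scope complex_scope.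

(* On the circle, with z = exp(i t), the map f_k is t |-> th - k h(t) for an
   increasing lift h of a Blaschke factor, and the fixed points of f_d have
   multiplier of modulus d h'. For lambda in [lambda_0, lambda_1) the map f_d has a
   repelling 2-cycle a- < a+ around its attracting fixed point, and the arc (a-, a+)
   lies in its basin, hence in I; so z = exp(i t) with t outside (a-, a+).

   Let W be the reciprocal of the Hilbert metric density of that arc, which is
   nonnegative outside it. A word is chosen letter by letter so that the orbit of t
   never enters (a-, a+). If f_d keeps the point outside, take the letter d: by the
   Chebyshev inequality [cheb_defect_ge0], |f_d'| W does not fall below W o f_d, and
   it exceeds it by a fixed factor where W is bounded away from 0. Otherwise some
   k < d moves the point by f_1 o f_k outside the arc, with |(f_1 o f_k)'| W at least
   kappa > 1 times the new value of W. Hence the derivatives along the word are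
   unbounded: either W is infinitely often bounded away from 0, or the orbit
   eventually stays near the repelling 2-cycle. Unbounded derivatives exclude
   normality, since by the reversed inequality inside short arcs (Schwarz's lemma)
   an equicontinuous sequence has bounded derivatives. *)

(** Only the inclusion of (a-, a+) in I is used: a point outside I is then outside that arc, and the
    endpoints of I need not be known. As f_d exchanges a- and a+, the functions W and W o f_d are
    Hilbert densities of the same arc. Moebius maps of the circle preserve such densities, so f_d is
    reduced to z |-> z^d; there the density is affine in the cosine of the angle from the midpoint
    of the arc, and the comparison is that of T_d with a tangent.

    The hypotheses enter as follows, with lambda = exp(i th). From lambda_0 on, th <= d h(th): the
    second iterate does not move the angle 0 to the right, which yields a 2-cycle with 0 <= a-.
    Before lambda_1, th < pi. Finally b < (d+1)/(d-1) says d tau < 1, where tau = (b-1)/(b+1) is the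
    least value of h'.

    The obstacle is a point thrown by f_d into (a-, a+): there W o f_d < 0 and the Chebyshev bound
    is void. The remedy is a k < d for which f_k brings the point close behind -1, at angle pi + 2 q
    with q controlled by the position of the point; what remains is a trigonometric inequality in
    half-angles with a uniform margin. *)

Lemma is_derive_inv (K : numFieldType) (V : normedModType K) (f : V -> K) (x v : V) (df : K) :
  f x != 0 -> is_derive x v f df -> is_derive x v (fun y => (f y)^-1) (- (f x) ^- 2 * df).
Proof.
move=> fx0 [fd <-]; apply: DeriveDef; first exact: derivableV.
by rewrite deriveV.
Qed.

(** * Mean value estimates; monotonicity and concavity of sine and cosine *)

Section RealLemmas.
Variable R : realType.
Implicit Types x y z t s p q e v : R.

Lemma is_derive_continuous (f : R -> R) x (l : R) : is_derive x 1 f l -> {for x, continuous f}.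
Proof. by move=> [df _]; apply/differentiable_continuous/derivable1_diffP. Qed.

Lemma mvt (f df : R -> R) x y :
  (forall z, is_derive z 1 f (df z)) -> x <= y ->
  exists2 z, x <= z <= y & f y - f x = df z * (y - x).
Proof.
move=> fdf xy.
have [] := @MVT_segment R f df x y xy _ _.
  by apply: continuous_subspaceT => z; exact: is_derive_continuous (fdf z).
by move=> z; rewrite in_itv /= => zxy ->; exists z.
Qed.

Lemma derive_le_homo (f df : R -> R) a c :
  (forall z, is_derive z 1 f (df z)) -> (forall z, a <= z <= c -> 0 <= df z) ->
  forall x y, a <= x -> x <= y -> y <= c -> f x <= f y.
Proof.
move=> fdf df0 x y ax xy yc.
have [z /andP[xz zy] fxy] := mvt fdf xy.
rewrite -subr_ge0 fxy mulr_ge0 ?subr_ge0// df0//.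
by rewrite (le_trans ax xz) (le_trans zy yc).
Qed.

(** A convex function vanishing at 0 has nondecreasing f x / x, because its mean slope over [0, x]
    is at most that over [x, y]. The quotients are cross-multiplied so that x = 0 is allowed. *)
Lemma star_convex (f df : R -> R) c :
  (forall z, is_derive z 1 f (df z)) -> f 0 = 0 ->
  (forall x y, 0 <= x -> x <= y -> y <= c -> df x <= df y) ->
  forall x y, 0 <= x -> x <= y -> y <= c -> y * f x <= x * f y.
Proof.
move=> fdf f0 dfle x y x0 xy yc.
have [z1 /andP[z1x xz1]] := mvt fdf x0; rewrite f0 !subr0 => e1.
have [z2 /andP[xz2 z2y] e2] := mvt fdf xy.
have d12 : df z1 <= df z2.
  by apply: dfle => //; [exact: le_trans xz1 xz2|exact: le_trans z2y yc].
have -> : f y = f x + df z2 * (y - x) by rewrite -e2; ring.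
have yx0 : 0 <= y - x by rewrite subr_ge0.
rewrite e1.
have : 0 <= (df z2 - df z1) * (x * (y - x)).
  by apply: mulr_ge0; [rewrite subr_ge0|exact: mulr_ge0].
nra.
Qed.

Lemma sin_concave x y : 0 <= x -> x <= y -> y <= pi -> x * sin y <= y * sin x.
Proof.
move=> x0 xy ypi.
have := @star_convex (fun z => - sin z) (fun z => - cos z) pi _ _ _ x y x0 xy ypi.
rewrite !mulrN lerN2; apply.
- by rewrite sin0 oppr0.
- move=> u w u0 uw wpi; rewrite lerN2.
  have [->//|nuw] := eqVneq u w.
  by rewrite ltW// ltr_cos ?in_itv/= ?u0 ?wpi ?(le_trans u0 uw) ?(le_trans uw wpi)// lt_neqAle nuw.
Qed.

Lemma cos_le x y : 0 <= x -> x <= y -> y <= pi -> cos y <= cos x.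
Proof.
move=> u0 uw wpi; have [->//|nuw] := eqVneq x y.
by rewrite ltW// ltr_cos ?in_itv/= ?u0 ?wpi ?(le_trans u0 uw) ?(le_trans uw wpi)// lt_neqAle nuw.
Qed.

Lemma sin_le x y : - (pi / 2) <= x -> x <= y -> y <= pi / 2 -> sin x <= sin y.
Proof.
move=> u0 uw wpi; have [->//|nuw] := eqVneq x y.
by rewrite ltW// ltr_sin ?in_itv/= ?u0 ?wpi ?(le_trans u0 uw) ?(le_trans uw wpi)// lt_neqAle nuw.
Qed.

Lemma sin_ge0 x : 0 <= x -> x <= pi -> 0 <= sin x.
Proof. by move=> x0 xpi; apply: sin_ge0_pi; rewrite x0. Qed.

Lemma sin_gt0 x : 0 < x -> x < pi -> 0 < sin x.
Proof. by move=> x0 xpi; apply: sin_gt0_pi; rewrite x0. Qed.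

Lemma half_double x : x = x / 2 + x / 2.
Proof. by lra. Qed.

Lemma sin_half x : sin x = 2 * sin (x / 2) * cos (x / 2).
Proof. by rewrite {1}[x]half_double sinD; ring. Qed.

Lemma cos_half x : cos x = 1 - 2 * sin (x / 2) ^+ 2.
Proof. by rewrite {1}[x]half_double cosD -!expr2 cos2sin2; ring. Qed.

Lemma cos_half2 x : cos x = 2 * cos (x / 2) ^+ 2 - 1.
Proof. by rewrite {1}[x]half_double cosD -!expr2 sin2cos2; ring. Qed.

Lemma sinsin x y : sin x * sin y = (cos (x - y) - cos (x + y)) / 2.
Proof. by rewrite cosB cosD; field. Qed.

End RealLemmas.

(** * The lift of a Blaschke factor to the real line *)

Section Lift.
Variables (R : realType) (b : R).
Hypothesis b1 : 1 < b.
Implicit Types x y z t s p q : R.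

(** The squared modulus of b + exp(i t). *)
Definition nrm2 t : R := b ^+ 2 + 2 * b * cos t + 1.
Definition nrm t : R := Num.sqrt (nrm2 t).

Lemma nrm2E t : nrm2 t = (b + cos t) ^+ 2 + sin t ^+ 2.
Proof. by rewrite sin2cos2 /nrm2; ring. Qed.

Lemma nrm2_ge t : (b - 1) ^+ 2 <= nrm2 t.
Proof. by rewrite /nrm2; have hb := b1; have := cos_geN1 t; nra. Qed.

Lemma nrm2_le t : nrm2 t <= (b + 1) ^+ 2.
Proof. by rewrite /nrm2; have hb := b1; have := cos_le1 t; nra. Qed.

Lemma nrm2_gt0 t : 0 < nrm2 t.
Proof. by apply: lt_le_trans (nrm2_ge t); rewrite exprn_gt0// subr_gt0. Qed.

Lemma nrm_gt0 t : 0 < nrm t.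
Proof. by rewrite sqrtr_gt0 nrm2_gt0. Qed.

Lemma nrm_sq t : nrm t ^+ 2 = nrm2 t.
Proof. by rewrite sqr_sqrtr// ltW// nrm2_gt0. Qed.

Lemma bcos_gt0 t : 0 < b + cos t.
Proof. by have := b1; have := cos_geN1 t; lra. Qed.

(* [hlift] lifts z |-> (b z + 1) / (z + b) to the universal cover of the circle:
   on |z| = 1 this map is z times the square of (b + conj z) / |b + z|. *)
Definition barg t : R := atan (sin t / (b + cos t)).
Definition hlift t : R := t - 2 * barg t.
Definition dhlift t : R := (b ^+ 2 - 1) / nrm2 t.

Lemma cos_barg t : cos (barg t) = (b + cos t) / nrm t.
Proof.
rewrite /barg cos_atan.
have -> : 1 + (sin t / (b + cos t)) ^+ 2 = nrm2 t / (b + cos t) ^+ 2.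
  by rewrite nrm2E; field; rewrite gt_eqF// bcos_gt0.
rewrite sqrtrM ?ltW ?nrm2_gt0// -/(nrm t) -exprVn sqrtr_sqr ger0_norm ?invr_ge0 ?ltW ?bcos_gt0//.
by rewrite invfM invrK mulrC.
Qed.

Lemma sin_barg t : sin (barg t) = sin t / nrm t.
Proof.
have c0 : cos (barg t) != 0.
  by rewrite cos_barg gt_eqF// divr_gt0 ?bcos_gt0 ?nrm_gt0.
have : tan (barg t) = sin t / (b + cos t) by rewrite atanK.
rewrite /tan => /(congr1 ( *%R^~ (cos (barg t)))); rewrite divfK// => ->.
by rewrite cos_barg; field; rewrite !gt_eqF ?bcos_gt0 ?nrm_gt0.
Qed.

Lemma dhlift_gt0 t : 0 < dhlift t.
Proof. by rewrite divr_gt0 ?nrm2_gt0// subr_gt0; have := b1; nra. Qed.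

(** [barg t] is the argument of b + exp(i t), with derivative (1 + b cos t) / |b + exp(i t)|^2; one
    minus twice this is the Poisson kernel [dhlift]. *)
Lemma is_derive_hlift t : is_derive t 1 hlift (dhlift t).
Proof.
have N0 := nrm2_gt0 t; have B0 := bcos_gt0 t.
have dB : is_derive t (1 : R) (fun x => b + cos x) (0 - sin t).
  rewrite sub0r; apply: is_derive_eq (is_deriveD _ _) _; exact: add0r.
have dV := @is_derive_inv _ _ (fun x => b + cos x) t 1 _ (lt0r_neq0 B0) dB.
have dQ : is_derive t (1 : R) (fun x => sin x / (b + cos x)) ((1 + b * cos t) / (b + cos t) ^+ 2).
  have H := is_deriveM (is_derive_sin t) dV; apply: is_derive_eq H _.
  rewrite /GRing.scale /=.
  have -> : 1 = cos t ^+ 2 + sin t ^+ 2 :> R by rewrite cos2Dsin2.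
  by field; rewrite gt_eqF.
have dA : is_derive t (1 : R) barg ((1 + b * cos t) / nrm2 t).
  have H := is_derive1_comp (is_derive1_atan _) dQ; apply: is_derive_eq H _.
  rewrite nrm2E.
  have sc : 0 < (b + cos t) ^+ 2 + sin t ^+ 2 by rewrite -nrm2E.
  by field; rewrite !gt_eqF.
have H := is_deriveB (is_derive_id t 1) (is_deriveZ 2 dA); apply: is_derive_eq H _.
rewrite /dhlift /GRing.scale /=; have -> : nrm2 t = b ^+ 2 + 2 * b * cos t + 1 by [].
by field; rewrite gt_eqF.
Qed.

Lemma continuous_hlift : continuous hlift.
Proof. by move=> t; exact: is_derive_continuous (is_derive_hlift t). Qed.

Lemma continuous_sub_hlift c (k : nat) : continuous (fun x => c - k%:R * hlift x).
Proof.
move=> x; apply: cvgB; first exact: cvg_cst.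
by apply: cvgM; [exact: cvg_cst|exact: continuous_hlift].
Qed.

Lemma continuous_dhlift : continuous (dhlift).
Proof.
move=> x; apply: cvgM; first exact: cvg_cst.
apply: cvgV; first by rewrite gt_eqF// nrm2_gt0// b1.
apply: cvgD; last exact: cvg_cst.
apply: cvgD; first exact: cvg_cst.
by apply: cvgM; [exact: cvg_cst|exact: continuous_cos].
Qed.

Lemma hlift0 : hlift 0 = 0.
Proof. by rewrite /hlift /barg sin0 mul0r atan0; ring. Qed.

Lemma hliftpi : hlift pi = pi.
Proof. by rewrite /hlift /barg sinpi mul0r atan0; ring. Qed.

Lemma hliftD2pi t : hlift (t + 2 * pi) = hlift t + 2 * pi.
Proof.
have -> : t + 2 * pi = t + pi *+ 2 by rewrite mulr2n; ring.
rewrite /hlift /barg sinD2pi cosD2pi mulr2n; ring.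
Qed.

Lemma hliftN t : hlift (- t) = - hlift t.
Proof. by rewrite /hlift /barg sinN cosN mulNr atanN; ring. Qed.

Lemma dhliftN t : dhlift (- t) = dhlift t.
Proof. by rewrite /dhlift /nrm2 cosN. Qed.

Lemma dhliftD2pi t : dhlift (t + 2 * pi) = dhlift t.
Proof.
have -> : t + 2 * pi = t + pi *+ 2 by rewrite mulr2n; ring.
by rewrite /dhlift /nrm2 cosD2pi.
Qed.

(** exp(i hlift t / 2) equals b exp(i t / 2) + exp(- i t / 2) divided by [nrm t]; its imaginary part
    is taken here and its real part in the next lemma. Together they give tan (hlift t / 2) = (b -
    1) / (b + 1) tan (t / 2). *)
Lemma sin_half_hlift t : sin (hlift t / 2) = (b - 1) * sin (t / 2) / nrm t.
Proof.
have -> : hlift t / 2 = t / 2 - barg t by rewrite /hlift; field.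
rewrite sinB cos_barg sin_barg (sin_half t) (cos_half t).
have := cos2sin2 (t / 2); have := nrm_gt0 t.
move: (nrm t) (sin (t / 2)) (cos (t / 2)) => m x y m0 h.
transitivity ((x * (b + 1 - 2 * x ^+ 2) - 2 * x * y ^+ 2) / m); first by field; rewrite gt_eqF.
by rewrite h; field; rewrite gt_eqF.
Qed.

Lemma cos_half_hlift t : cos (hlift t / 2) = (b + 1) * cos (t / 2) / nrm t.
Proof.
have -> : hlift t / 2 = t / 2 - barg t by rewrite /hlift; field.
rewrite cosB cos_barg sin_barg (sin_half t) (cos_half2 t).
have := sin2cos2 (t / 2); have := nrm_gt0 t.
move: (nrm t) (sin (t / 2)) (cos (t / 2)) => m x y m0 h.
transitivity ((y * (b - 1 + 2 * y ^+ 2) + 2 * y * x ^+ 2) / m); first by field; rewrite gt_eqF.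
by rewrite h; field; rewrite gt_eqF.
Qed.

(** The chord identity |m z - m w|^2 = |m' z| |m' w| |z - w|^2 of a Moebius map m. It is the source
    of the invariance of [hilb]. *)
Lemma sin_hlift_sub t s :
  sin ((hlift t - hlift s) / 2) = (b ^+ 2 - 1) * sin ((t - s) / 2) / (nrm t * nrm s).
Proof.
have -> : (hlift t - hlift s) / 2 = hlift t / 2 - hlift s / 2 by field.
have -> : (t - s) / 2 = t / 2 - s / 2 by field.
rewrite !sinB !sin_half_hlift !cos_half_hlift.
by field; rewrite !gt_eqF ?nrm_gt0.
Qed.

(** The vector field sin t d/dt generates the hyperbolic Moebius maps fixing 1 and -1; [hlift] lifts
    one of them, hence preserves the field. *)
Lemma dhlift_sin t : dhlift t * sin t = sin (hlift t).
Proof.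
rewrite (sin_half (hlift t)) sin_half_hlift cos_half_hlift (sin_half t) /dhlift -nrm_sq.
by field; rewrite gt_eqF ?nrm_gt0.
Qed.

Lemma dhlift_ge t : (b - 1) / (b + 1) <= dhlift t.
Proof.
have hb := b1; have N0 := nrm2_gt0 t.
rewrite /dhlift ler_pdivrMr ?ltr_wpDl//; last by lra.
rewrite mulrAC ler_pdivlMr//.
have := nrm2_le t; nra.
Qed.

Lemma dhlift_le t : dhlift t <= (b + 1) / (b - 1).
Proof.
have hb := b1; have N0 := nrm2_gt0 t.
rewrite /dhlift ler_pdivrMr// mulrAC ler_pdivlMr; last by lra.
have := nrm2_ge t; nra.
Qed.

Lemma hlift_le x y : x <= y -> hlift x <= hlift y.
Proof.
move=> xy; apply: (derive_le_homo (a := x) (c := y) (df := dhlift) (@is_derive_hlift)) => // z _.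
exact/ltW/dhlift_gt0.
Qed.

Lemma hlift_lt x y : x < y -> hlift x < hlift y.
Proof.
move=> xy; have [z _ e] := mvt (@is_derive_hlift) (ltW xy).
by rewrite -subr_gt0 e mulr_gt0 ?dhlift_gt0 ?subr_gt0.
Qed.

Lemma dhlift_mono x y : 0 <= x -> x <= y -> y <= pi -> dhlift x <= dhlift y.
Proof.
move=> x0 xy ypi; have hb := b1; rewrite /dhlift ler_pM2l ?subr_gt0; last by nra.
rewrite lef_pV2 ?posrE ?nrm2_gt0// /nrm2.
have := cos_le x0 xy ypi; nra.
Qed.

Lemma dhlift_strict x y : 0 <= x -> x < y -> y <= pi -> dhlift x < dhlift y.
Proof.
move=> x0 xy ypi; have hb := b1; rewrite /dhlift ltr_pM2l ?subr_gt0; last by nra.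
rewrite ltf_pV2 ?posrE ?nrm2_gt0// /nrm2.
have : cos y < cos x by rewrite ltr_cos// in_itv/= ?x0 ?ypi ?(le_trans x0 (ltW xy)) ?(le_trans (ltW xy) ypi).
nra.
Qed.

Lemma hlift_star x y : 0 <= x -> x <= y -> y <= pi -> y * hlift x <= x * hlift y.
Proof.
move=> x0 xy ypi.
by apply: (star_convex (@is_derive_hlift) hlift0 _ x0 xy ypi) => u v; exact: dhlift_mono.
Qed.

Lemma hlift_ge0 x : 0 <= x -> 0 <= hlift x.
Proof. by move=> /hlift_le; rewrite hlift0. Qed.

End Lift.

(** * Chebyshev polynomials and their tangents *)

Section Chebyshev.
Variable R : realType.
Implicit Types (x y v e : R) (n d : nat).

(** cos (n x) is a polynomial in cos x; the induction carries two consecutive indices because of the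
    three-term recurrence. *)
Lemma cos_natmul_eq n x y : cos x = cos y -> cos (n%:R * x) = cos (n%:R * y).
Proof.
move=> xy.
suff : cos (n%:R * x) = cos (n%:R * y) /\ cos (n.+1%:R * x) = cos (n.+1%:R * y) by case.
elim: n => [|n [IH1 IH2]]; first by rewrite !mul0r !mul1r.
split=> //.
have rec z : cos (n.+2%:R * z) = 2 * cos z * cos (n.+1%:R * z) - cos (n%:R * z).
  have -> : n.+2%:R * z = n.+1%:R * z + z by rewrite -[n.+2]addn1 natrD; ring.
  have -> : n%:R * z = n.+1%:R * z - z by rewrite -[n.+1]addn1 natrD; ring.
  by rewrite cosD cosB; ring.
by rewrite !rec xy IH1 IH2.
Qed.

(** sin (n x) / sin x decreases on (0, pi / n]: the ratio for n + 1 is cos x times the ratio for n,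
    plus cos (n x), and both terms decrease. *)
Lemma sin_natmul_ratio n x y : (0 < n)%N -> 0 < x -> x <= y -> n%:R * y <= pi ->
  sin (n%:R * y) * sin x <= sin (n%:R * x) * sin y.
Proof.
elim: n => // n IH _ x0 xy ny.
have [->|n0] := posnP n; first by rewrite !mul1r mulrC.
have y0 : 0 < y by exact: lt_le_trans xy.
have n1 : 1 <= n%:R :> R by rewrite ler1n.
rewrite -natr1 mulrDl mul1r in ny.
have ny' : n%:R * y <= pi by apply: le_trans ny; rewrite lerDl ltW.
have ypi : y <= pi / 2.
  have : 1 * y <= n%:R * y by rewrite ler_pM2r.
  lra.
have {IH} IH := IH n0 x0 xy ny'.
have cy0 : 0 <= cos y by apply: cos_ge0_pihalf; have := pi_gt0 R; lra.
have cxy : cos y <= cos x by apply: cos_le; lra.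
have nxy : n%:R * x <= n%:R * y by rewrite ler_wpM2l.
have nx0 : 0 <= n%:R * x by rewrite mulr_ge0 // ltW.
have cnxy : cos (n%:R * y) <= cos (n%:R * x) by apply: cos_le.
have snx : 0 <= sin (n%:R * x) by apply: sin_ge0 => //; apply: le_trans ny'.
have sx : 0 <= sin x by apply: sin_ge0; lra.
have sy : 0 <= sin y by apply: sin_ge0; lra.
rewrite -natr1 !mulrDl !mul1r !sinD.
have h1 := mulr_ge0 cy0 (_ : 0 <= sin (n%:R * x) * sin y - sin (n%:R * y) * sin x).
have h2 := mulr_ge0 (_ : 0 <= cos x - cos y) (mulr_ge0 snx sy).
have h3 := mulr_ge0 (_ : 0 <= cos (n%:R * x) - cos (n%:R * y)) (mulr_ge0 sx sy).
move: h1 h2 h3; rewrite !subr_ge0 => /(_ IH) h1 /(_ cxy) h2 /(_ cnxy) h3.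
nra.
Qed.

Lemma sin_natmul_ratio_lt n x y : (1 < n)%N -> 0 < x -> x < y -> n%:R * y <= pi ->
  sin (n%:R * y) * sin x < sin (n%:R * x) * sin y.
Proof.
case: n => // n; rewrite ltnS => n0 x0 xy ny.
have y0 : 0 < y by exact: lt_trans xy.
have n1 : 1 <= n%:R :> R by rewrite ler1n.
rewrite -natr1 mulrDl mul1r in ny.
have ny' : n%:R * y <= pi by apply: le_trans ny; rewrite lerDl ltW.
have ypi : y <= pi / 2.
  have : 1 * y <= n%:R * y by rewrite ler_pM2r.
  lra.
have IH := sin_natmul_ratio n0 x0 (ltW xy) ny'.
have cy0 : 0 <= cos y by apply: cos_ge0_pihalf; have := pi_gt0 R; lra.
have cxy : cos y < cos x by rewrite ltr_cos // in_itv /=; lra.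
have nxy : n%:R * x < n%:R * y by rewrite ltr_pM2l// (lt_le_trans ltr01).
have nx0 : 0 < n%:R * x by rewrite mulr_gt0 // (lt_le_trans ltr01).
have cnxy : cos (n%:R * y) <= cos (n%:R * x) by apply: cos_le => //; exact: ltW.
have snx : 0 < sin (n%:R * x) by apply: sin_gt0 => //; apply: lt_le_trans ny'.
have sx : 0 < sin x by apply: sin_gt0; lra.
have sy : 0 < sin y by apply: sin_gt0; lra.
rewrite -natr1 !mulrDl !mul1r !sinD.
have h1 := mulr_ge0 cy0 (_ : 0 <= sin (n%:R * x) * sin y - sin (n%:R * y) * sin x).
have h2 := mulr_gt0 (_ : 0 < cos x - cos y) (mulr_gt0 snx sy).
have h3 := mulr_ge0 (_ : 0 <= cos (n%:R * x) - cos (n%:R * y)) (mulr_ge0 (ltW sx) (ltW sy)).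
move: h1 h2 h3; rewrite !subr_ge0 !subr_gt0 => /(_ IH) h1 /(_ cxy) h2 /(_ cnxy) h3.
nra.
Qed.

(* With T_d the d-th Chebyshev polynomial, x = cos v and c = cos e, this is
   sin e (T_d x - T_d c - T_d' c (x - c)): the defect of T_d from its tangent. *)
Definition cheb_defect d e v : R :=
  d%:R * sin (d%:R * e) * (cos e - cos v) - sin e * (cos (d%:R * e) - cos (d%:R * v)).

Lemma is_derive_cheb_defect d e v : is_derive v 1 (cheb_defect d e)
  (d%:R * (sin (d%:R * e) * sin v - sin (d%:R * v) * sin e)).
Proof.
have d1 : is_derive v (1 : R) (fun v => cos (d%:R * v)) (- sin (d%:R * v) * d%:R).
  have H : is_derive v (1 : R) (fun v => d%:R * v) d%:R.
    have H' := is_deriveZ d%:R (is_derive_id v (1 : R)).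
    by apply: is_derive_eq H' _; rewrite /GRing.scale /= mulr1.
  have H2 := @is_derive1_comp _ (@cos R) (fun v => d%:R * v) v _ _ (is_derive_cos _) H.
  exact: H2.
have d2 := is_deriveB (is_derive_cst (cos e) v (1 : R)) (is_derive_cos v).
have d3 := is_deriveZ (d%:R * sin (d%:R * e)) d2.
have d4 := is_deriveB (is_derive_cst (cos (d%:R * e)) v (1 : R)) d1.
have d5 := is_deriveZ (sin e) d4.
have d6 := is_deriveB d3 d5.
apply: is_derive_eq d6 _; rewrite /GRing.scale /=; ring.
Qed.

Lemma cheb_defect_id d e : cheb_defect d e e = 0.
Proof. by rewrite /cheb_defect; ring. Qed.

Lemma cheb_defect_acos d e v : cheb_defect d e v = cheb_defect d e (acos (cos v)).
Proof.
have cv : cos (acos (cos v)) = cos v.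
  by rewrite acosK// in_itv/= cos_geN1 cos_le1.
by rewrite /cheb_defect cv (cos_natmul_eq d cv).
Qed.

(** The sign of the derivative of the defect is the monotonicity of sin (d v) / sin v. *)
Lemma cheb_defect_incr d e x y : (0 < d)%N -> 0 < e -> e <= x -> x <= y ->
  d%:R * y <= pi -> cheb_defect d e x <= cheb_defect d e y.
Proof.
move=> d0 e0 ex xy dy.
apply: (derive_le_homo (is_derive_cheb_defect d e) _ ex xy (lexx _)) => z /andP[ez zy].
rewrite mulr_ge0// subr_ge0; apply: sin_natmul_ratio => //.
by apply: le_trans dy; rewrite ler_wpM2l.
Qed.

(** Only cos v matters, so v may be taken in [0, pi]. Up to pi / d the defect increases. At pi / d
    the term cos (d v) takes its least value -1, while cos e - cos v keeps growing afterwards, so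
    the defect never falls below its value there. *)
Lemma cheb_defect_far d e x v : (0 < d)%N -> 0 < e -> e <= x -> d%:R * x <= pi ->
  cos v <= cos x -> cheb_defect d e x <= cheb_defect d e v.
Proof.
move=> d0 e0 ex dx vx; rewrite (cheb_defect_acos d e v).
have cv1 : -1 <= cos v <= 1 by rewrite cos_geN1 cos_le1.
have cv : cos (acos (cos v)) = cos v by rewrite acosK// in_itv.
have d1 : 1 <= d%:R :> R by rewrite ler1n.
have xpi : x <= pi by apply: le_trans dx; rewrite -{1}[x]mul1r ler_wpM2r//; lra.
have xw : x <= acos (cos v).
  rewrite leNgt; apply/negP => wx.
  have : cos x < cos (acos (cos v)) by rewrite ltr_cos ?in_itv/= ?acos_ge0 ?acos_lepi//; lra.
  by rewrite cv ltNge vx.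
have [dw|dw] := leP (d%:R * acos (cos v)) pi; first exact: cheb_defect_incr.
have dn0 : d%:R != 0 :> R by rewrite pnatr_eq0 -lt0n.
have dpi : d%:R * (pi / d%:R) = pi :> R by field.
have xp : x <= pi / d%:R by rewrite ler_pdivlMr ?ltr0n// mulrC.
apply: (@le_trans _ _ (cheb_defect d e (pi / d%:R))).
  by apply: cheb_defect_incr => //; rewrite dpi.
rewrite /cheb_defect dpi cospi cv.
have pw : pi / d%:R <= acos (cos v) by rewrite ler_pdivrMr ?ltr0n// mulrC ltW.
have c1 : cos v <= cos (pi / d%:R).
  rewrite -[X in X <= _]cv cos_le// ?acos_lepi//.
  by rewrite divr_ge0 // pi_ge0.
have c2 := cos_geN1 (d%:R * acos (cos v)).
have se : 0 <= sin e by apply: sin_ge0; lra.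
have sde : 0 <= d%:R * sin (d%:R * e).
  apply: mulr_ge0 => //; apply: sin_ge0; first by rewrite mulr_ge0// ltW.
  by apply: le_trans dx; rewrite ler_wpM2l.
have h1 := mulr_ge0 sde (_ : 0 <= cos (pi / d%:R) - cos v).
have h2 := mulr_ge0 se (_ : 0 <= cos (d%:R * acos (cos v)) + 1).
have {}h1 := h1 _; move: h1 h2; rewrite subr_ge0 => /(_ c1) h1 h2.
have {}h2 : 0 <= sin e * (cos (d%:R * acos (cos v)) + 1) by apply: h2; lra.
nra.
Qed.

(** The tangent to T_d at cos e, where cos e >= cos (pi / d), stays below T_d on [-1, 1]. To the
    left of e the defect decreases to 0, and to the right [cheb_defect_far] applies. *)
Lemma cheb_defect_ge0 d e v : (0 < d)%N -> 0 < e -> d%:R * e <= pi -> 0 <= cheb_defect d e v.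
Proof.
move=> d0 e0 de.
have [ve|ev] := leP (cos v) (cos e).
  by rewrite -(cheb_defect_id d e) cheb_defect_far.
rewrite cheb_defect_acos.
have cv1 : -1 <= cos v <= 1 by rewrite cos_geN1 cos_le1.
have cv : cos (acos (cos v)) = cos v by rewrite acosK// in_itv.
have d1 : 1 <= d%:R :> R by rewrite ler1n.
have epi : e <= pi by apply: le_trans de; rewrite -{1}[e]mul1r ler_wpM2r//; lra.
have we : acos (cos v) <= e.
  rewrite leNgt; apply/negP => ew.
  by move: ev; rewrite -cv ltNge cos_le// ?acos_lepi// ltW.
have w0 := acos_ge0 cv1.
have H x : is_derive x 1 (- cheb_defect d e) _ := is_deriveN (is_derive_cheb_defect d e x).
have /= := derive_le_homo H _ w0 we (lexx e).
rewrite !fctE cheb_defect_id oppr0 oppr_le0; apply => z /andP[z0 ze].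
rewrite -mulrN opprB mulr_ge0// subr_ge0.
move: z0; rewrite le_eqVlt => /predU1P[<-|z0]; first by rewrite mulr0 sin0 mulr0 mul0r.
exact: sin_natmul_ratio.
Qed.

Lemma cheb_defect_gt0 d e x : (1 < d)%N -> 0 < e -> e < x -> d%:R * x <= pi ->
  0 < cheb_defect d e x.
Proof.
move=> d1 e0 ex dx; have d0 : (0 < d)%N by exact: ltnW.
(* The derivative vanishes at e; it is strictly positive only on [m, x]. *)
pose m := (e + x) / 2.
have em : e < m by rewrite /m; lra.
have mx : m < x by rewrite /m; lra.
have m0 : 0 <= cheb_defect d e m.
  apply: cheb_defect_ge0 => //; apply: le_trans dx; rewrite ler_wpM2l//; lra.
apply: (le_lt_trans m0); rewrite -subr_gt0.
have [z /andP[mz zx] ->] := mvt (is_derive_cheb_defect d e) (ltW mx).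
rewrite mulr_gt0 ?subr_gt0// mulr_gt0 ?ltr0n// subr_gt0 sin_natmul_ratio_lt//.
  exact: lt_le_trans mz.
by apply: le_trans dx; rewrite ler_wpM2l.
Qed.

Lemma cos_lipschitz x y : x <= y -> cos x - cos y <= y - x.
Proof.
move=> xy; have [z _ e] := mvt (@is_derive_cos R) xy.
rewrite -opprB e -{2}[y - x]mul1r -mulNr opprK ler_wpM2r ?subr_ge0//; exact: sin_le1.
Qed.

Lemma cheb_defect_unif d e w : (1 < d)%N -> 0 < e -> d%:R * e < pi -> 0 < w ->
  exists2 c, 0 < c & forall v, w <= cos e - cos v -> c <= cheb_defect d e v.
Proof.
move=> d1 e0 de w0; have d0 : (0 < d)%N by exact: ltnW.
have dR : 0 < d%:R :> R by rewrite ltr0n.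
(* As cos is 1-Lipschitz and x - e <= w, every v with cos e - cos v >= w satisfies cos v <= cos x;
   the other bound keeps d x <= pi. *)
pose x := e + Num.min w (pi / d%:R - e).
have epd : 0 < pi / d%:R - e by rewrite subr_gt0 ltr_pdivlMr// mulrC.
have ex : e < x by rewrite /x ltrDl lt_min w0 epd.
have dx : d%:R * x <= pi.
  have : x <= pi / d%:R by rewrite /x -lerBrDl ge_min lexx orbT.
  by rewrite ler_pdivlMr// mulrC.
exists (cheb_defect d e x); first exact: cheb_defect_gt0.
move=> v wv; apply: cheb_defect_far => //; first exact: ltW.
have := cos_lipschitz (ltW ex).
have : x - e <= w by rewrite /x addrAC subrr add0r ge_min lexx.
lra.
Qed.

End Chebyshev.

(** * Lower bounds for sines of small fractions of pi *)

Lemma sin_pi6 (R : realType) : sin (pi / 6) = 1 / 2 :> R.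
Proof.
set s : R := sin (pi / 6).
have s0 : 0 <= s by apply: sin_ge0; have := @pi_gt0 R; lra.
have e3 : pi / 2 = pi / 6 + (pi / 6 + pi / 6) :> R by field.
have : sin (pi / 2) = 1 :> R by exact: sin_pihalf.
rewrite e3 !sinD cosD -/s.
have -> : s * (cos (pi / 6) * cos (pi / 6) - s * s) + cos (pi / 6) * (s * cos (pi / 6) + cos (pi / 6) * s)
  = 3 * s * cos (pi / 6) ^+ 2 - s ^+ 3 by ring.
rewrite cos2sin2 -/s => h.
(* The triple angle formula makes s a root of this cubic, whose roots are -1 and 1/2. *)
have /eqP : (s + 1) * (2 * s - 1) ^+ 2 = 0.
  have -> : (s + 1) * (2 * s - 1) ^+ 2 = 1 - (3 * s * (1 - s ^+ 2) - s ^+ 3) by ring.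
  by rewrite h subrr.
rewrite mulf_eq0 expf_eq0 /= => /orP[] /eqP; lra.
Qed.

Lemma sin2_pi4 (R : realType) : sin (pi / 4) ^+ 2 = 1 / 2 :> R.
Proof.
have := cos_pihalf R; rewrite cos_half.
have -> : pi / 2 / 2 = pi / 4 :> R by field.
lra.
Qed.

(** Concavity compares pi / (2 d) with pi / 4, the case of equality d = 2. Together with d tau < 1
    this yields 2 tau^2 < sin^2 (pi / (2 d)). *)
Lemma sin_pi_double_ge (R : realType) (d : nat) : (2 <= d)%N ->
  2 <= d%:R ^+ 2 * sin (pi / (2 * d%:R)) ^+ 2 :> R.
Proof.
move=> d2; have dR : 2 <= d%:R :> R by rewrite ler_nat.
have p0 := pi_gt0 R.
have e1 : pi / (2 * d%:R) = pi / 4 * (2 / d%:R) :> R by field; lra.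
have i0 : 0 <= 2 / d%:R :> R by rewrite divr_ge0//; lra.
have i1 : 2 / d%:R <= 1 :> R by rewrite ler_pdivrMr; lra.
have h : 0 <= pi / 4 * (2 / d%:R) :> R by apply: mulr_ge0; lra.
have h' : pi / 4 * (2 / d%:R) <= pi / 4 :> R by rewrite ler_piMr//; lra.
have h2 : pi / 4 <= pi :> R by lra.
have := sin_concave h h' h2.
rewrite -mulrA ler_pM2l; last by lra.
rewrite -e1 => H.
have s4 := sin2_pi4 R; have s40 : 0 <= sin (pi / 4) :> R by apply: sin_ge0; lra.
have H2 : 2 * sin (pi / 4) <= d%:R * sin (pi / (2 * d%:R)) :> R.
  have -> : 2 * sin (pi / 4) = d%:R * (2 / d%:R * sin (pi / 4)) :> R by field; lra.
  by rewrite ler_wpM2l//; lra.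
by rewrite -exprMn; nra.
Qed.

(** Concavity compares the angle with pi / 6, the case of equality k = 2. *)
Lemma natmul_sin_ge1 (R : realType) (k : nat) : (2 <= k)%N ->
  1 <= k%:R * sin (pi / (2 * (k%:R + 1))) :> R.
Proof.
move=> k2; have kR : 2 <= k%:R :> R by rewrite ler_nat.
have p0 := pi_gt0 R.
have e1 : pi / (2 * (k%:R + 1)) = pi / 6 * (3 / (k%:R + 1)) :> R by field; lra.
have i0 : 0 <= 3 / (k%:R + 1) :> R by rewrite divr_ge0//; lra.
have i1 : 3 / (k%:R + 1) <= 1 :> R by rewrite ler_pdivrMr; lra.
have h : 0 <= pi / 6 * (3 / (k%:R + 1)) :> R by apply: mulr_ge0; lra.
have h' : pi / 6 * (3 / (k%:R + 1)) <= pi / 6 :> R by rewrite ler_piMr//; lra.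
have h2 : pi / 6 <= pi :> R by lra.
have := sin_concave h h' h2.
rewrite -mulrA ler_pM2l; last by lra.
rewrite sin_pi6 -e1 => H.
have k0 : 0 <= k%:R :> R by lra.
apply: le_trans (ler_wpM2l k0 H).
have -> : k%:R * (3 / (k%:R + 1) * (1 / 2)) = (3 * k%:R) / (2 * (k%:R + 1)) :> R by field; lra.
by rewrite ler_pdivlMr; lra.
Qed.

(* Half-angles attached to the repelling 2-cycle a- < a+ of t |-> theta - d hlift t:
   a1 = a- / 2, a2 = a+ / 2, y_i = hlift (2 a_i) / 2, x_i = d y_i, Th = theta / 2. *)
Record half_angles (R : realType) (d : nat) (tau a1 a2 x1 x2 y1 y2 Th : R) : Prop := HalfAngles {
  ha_d : (2 <= d)%N;
  ha_tau : 0 < tau;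
  ha_dtau : d%:R * tau < 1;
  ha_y1 : 0 <= y1;
  ha_y12 : y1 < y2;
  ha_x1 : x1 = d%:R * y1;
  ha_x2 : x2 = d%:R * y2;
  ha_a1 : 0 <= a1;
  ha_a12 : a1 < a2;
  ha_Th1 : x1 + a2 = Th;
  ha_Th2 : x2 + a1 = Th;
  ha_Th : Th < pi / 2;
  ha_xa : x1 <= a1;
  ha_tan1 : sin y1 * cos a1 = tau * sin a1 * cos y1;
  ha_tan2 : sin y2 * cos a2 = tau * sin a2 * cos y2 }.

(** * Half-angle inequalities: the comparison of [ha_G] with [ha_K] *)

Section HalfAngles.
Variables (R : realType) (d : nat) (tau a1 a2 x1 x2 y1 y2 Th : R).
Hypothesis H : half_angles d tau a1 a2 x1 x2 y1 y2 Th.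

Local Notation c := (y1 + y2).
Local Notation p0 := (@pi R / (2 * d%:R)).

(* Up to one positive factor, [ha_G] and [ha_K] are the values of [hilb _ a- a+]
   at a point of the arc complementary to [a-, a+] and at its image under
   f_1 o f_k; the expansion estimate reduces to k G > K. *)
Definition ha_nu := cos a1 * cos a2 / (cos y1 * cos y2).
Definition ha_G (p : R) := ha_nu * (sin (p + y1) * sin (p + y2)).
Definition ha_K (q : R) :=
  (tau * cos q * cos x1 + sin q * sin x1) * (tau * cos q * cos x2 + sin q * sin x2).

Lemma ha_basic : [/\ 2 <= d%:R :> R, tau < 1 / 2 , 0 < c & d%:R * c <= Th].
Proof.
have [h1 h2 h3 h4 h5 h6 h7 h8 h9 h10 h11 h12 h13 h14 h15] := H.
have dR : 2 <= d%:R :> R by rewrite ler_nat.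
split => //; first by nra.
  by lra.
by rewrite mulrDr -h6 -h7; lra.
Qed.

Lemma ha_c_lt : d%:R * c < pi / 2 /\ c < pi / 4.
Proof.
have [dR ht c0 dc] := ha_basic; have hT := ha_Th H; have hp := pi_gt0 R.
by split; [lra|have := ler_wpM2r (ltW c0) dR; lra].
Qed.

(** As c < pi / 4, both bounds are rational approximations of 1 / sqrt 2. *)
Lemma ha_c_trig : [/\ 7 / 10 <= cos c, cos c <= cos (y2 - y1), 0 <= sin c & sin c <= 71 / 100].
Proof.
have [dR ht c0 dc] := ha_basic; have [dc' c4] := ha_c_lt; have hp := pi_gt0 R.
have hy1 := ha_y1 H; have hy12 := ha_y12 H.
have s4 := sin2_pi4 R.
have s40 : 0 <= sin (pi / 4) :> R by apply: sin_ge0; lra.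
have s1 : sin c <= sin (pi / 4) by apply: sin_le; lra.
have s0 : 0 <= sin c by apply: sin_ge0; lra.
have c0' : 0 <= cos c by apply: cos_ge0_pihalf; lra.
have cs := cos2Dsin2 c.
split => //; [nra| |nra].
by apply: cos_le; lra.
Qed.

Lemma ha_cos_gt0 : [/\ 0 < cos a1, 0 < cos a2, 0 < cos y1, 0 < cos y2 & 0 < cos Th].
Proof.
have [h1 h2 h3 h4 h5 h6 h7 h8 h9 h10 h11 h12 h13 h14 h15] := H.
have [dR ht c0 dc] := ha_basic; have [dc' c4] := ha_c_lt; have hp := pi_gt0 R.
have x10 : 0 <= x1 by rewrite h6; nra.

by split; apply: cos_gt0_pihalf; lra.
Qed.

Lemma ha_nu_gt0 : 0 < ha_nu.
Proof.
have [? ? ? ? _] := ha_cos_gt0.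
by rewrite /ha_nu divr_gt0// mulr_gt0.
Qed.

Lemma ha_nu_sin : ha_nu * sin (y2 - y1) = tau * sin (a2 - a1).
Proof.
have [? ? ? ? _] := ha_cos_gt0.
have t1 := ha_tan1 H; have t2 := ha_tan2 H.
rewrite /ha_nu !sinB.
have -> : cos a1 * cos a2 / (cos y1 * cos y2) * (sin y2 * cos y1 - cos y2 * sin y1)
 = (sin y2 * cos a2 * cos a1 * cos y1 - sin y1 * cos a1 * cos a2 * cos y2) / (cos y1 * cos y2) by ring.
by rewrite t1 t2; field; rewrite !gt_eqF.
Qed.

(** The tangent relations turn sin (p + y_i) cos a_i / cos y_i into sin p cos a_i + tau cos p sin
    a_i. *)
Lemma ha_GE p : ha_G p = (sin p * cos a1 + tau * cos p * sin a1) * (sin p * cos a2 + tau * cos p * sin a2).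
Proof.
have [? ? ? ? _] := ha_cos_gt0.
have t1 := ha_tan1 H; have t2 := ha_tan2 H.
have e1 : sin y1 = tau * sin a1 * cos y1 / cos a1 by rewrite -t1 mulfK// gt_eqF.
have e2 : sin y2 = tau * sin a2 * cos y2 / cos a2 by rewrite -t2 mulfK// gt_eqF.
rewrite /ha_G /ha_nu !sinD e1 e2.
by field; rewrite !gt_eqF.
Qed.

(** Since x1 = Th - a2 and x2 = Th - a1, both products are in the same angles and their difference
    has the factor cos Th. *)
Lemma ha_diag q : ha_G q - ha_K q = cos Th *
  (cos (a1 - x1) * (sin q ^+ 2 - tau ^+ 2 * cos q ^+ 2) + 2 * tau * sin (a1 - x1) * sin q * cos q).
Proof.
have h10 := ha_Th1 H; have h11 := ha_Th2 H.
have -> : ha_K q = (tau * cos q * cos x1 + sin q * sin x1) *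
   (tau * cos q * cos (Th - a1) + sin q * sin (Th - a1)).
  by rewrite /ha_K; congr (_ * (_ * cos _ + _ * sin _)); lra.
rewrite ha_GE.
have -> : a2 = Th - x1 by lra.
rewrite !sinB !cosB; ring.
Qed.

Lemma ha_G_sub p q : ha_G p - ha_G q = ha_nu * (sin (p + q + c) * sin (p - q)).
Proof.
rewrite /ha_G !sinsin.
have -> : p + y1 - (p + y2) = q + y1 - (q + y2) by ring.
have -> : p + q + (y1 + y2) - (p - q) = q + y1 + (q + y2) by ring.
have -> : p + q + (y1 + y2) + (p - q) = p + y1 + (p + y2) by ring.
ring.
Qed.

Lemma ha_delta : 0 <= a1 - x1 /\ a1 - x1 <= a1.
Proof.
have [h1 h2 h3 h4 h5 h6 h7 h8 h9 h10 h11 h12 h13 h14 h15] := H.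
have [dR ht c0 dc] := ha_basic.
by split; first lra; rewrite h6; nra.
Qed.

Lemma ha_a1_lt : a1 < pi / 2.
Proof.
have [h1 h2 h3 h4 h5 h6 h7 h8 h9 h10 h11 h12 h13 h14 h15] := H.
have [dR ht c0 dc] := ha_basic.
have : 0 <= x1 by rewrite h6; nra.
lra.
Qed.

Lemma ha_cos_prod : cos a1 * cos a2 <= cos (a1 - x1) * cos c.
Proof.
have [h1 h2 h3 h4 h5 h6 h7 h8 h9 h10 h11 h12 h13 h14 h15] := H.
have [dR ht c0 dc] := ha_basic; have [dc' c4] := ha_c_lt; have hp := pi_gt0 R.
have [k1 k2] := ha_delta; have k3 := ha_a1_lt.
have [? ? ? ? _] := ha_cos_gt0.
have cx2 : c <= x2 by rewrite h7; nra.
have e1 : cos a1 <= cos (a1 - x1) by apply: cos_le; lra.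
have x10 : 0 <= x1 by rewrite h6; nra.
have e2 : cos a2 <= cos c by apply: cos_le; lra.
nra.
Qed.

Lemma ha_cosd_gt0 : 0 < cos (a1 - x1).
Proof.
have [k1 k2] := ha_delta; have k3 := ha_a1_lt; have hp := pi_gt0 R.
by apply: cos_gt0_pihalf; lra.
Qed.

Lemma ha_sind_ge0 : 0 <= sin (a1 - x1).
Proof.
have [k1 k2] := ha_delta; have k3 := ha_a1_lt; have hp := pi_gt0 R.
by apply: sin_ge0; lra.
Qed.

Lemma ha_nu_le : ha_nu * cos c <= cos a1 * cos a2.
Proof.
have [? ? ? ? _] := ha_cos_gt0.
have [c1 c2 c3 c4] := ha_c_trig.
have : cos c <= cos y1 * cos y2.
  have : 2 * (cos y1 * cos y2) = cos c + cos (y2 - y1) by rewrite (cosD y1) (cosB y2); ring.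
  lra.
move=> h; rewrite /ha_nu mulrAC ler_pdivrMr ?mulr_gt0//.
by rewrite ler_wpM2l// ltW// mulr_gt0.
Qed.

Lemma ha_p0 : [/\ 0 < p0, p0 <= pi / 4, 2 * tau ^+ 2 < sin p0 ^+ 2,
  2 <= d%:R ^+ 2 * sin p0 ^+ 2 & c < p0].
Proof.
have [dR ht c0 dc] := ha_basic; have [dc' c4] := ha_c_lt; have hp := pi_gt0 R.
have h := sin_pi_double_ge R (ha_d H); have hdt := ha_dtau H; have t0 := ha_tau H.
have p00 : 0 < p0 by rewrite divr_gt0//; lra.
have dp0 : d%:R * p0 = pi / 2 by field; lra.
split => //; [nra| | nra].
have sq : (d%:R * tau) ^+ 2 < 1 by rewrite expr_lt1 ?mulr_ge0//; lra.
have d0 : 0 < d%:R ^+ 2 :> R by rewrite exprn_gt0//; lra.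
rewrite -(ltr_pM2l d0); apply: lt_le_trans h; rewrite exprMn in sq; lra.
Qed.

Lemma ha_sin2_lower q : p0 <= q -> q <= pi / 2 -> sin p0 ^+ 2 <= sin q ^+ 2.
Proof.
move=> pq qpi; have [h1 h2 h3 h4 h5] := ha_p0.
have s1 : sin p0 <= sin q by apply: sin_le; lra.
have s0 : 0 <= sin p0 by apply: sin_ge0; lra.
nra.
Qed.

Lemma ha_diag_ge q : 0 <= q -> q <= pi / 2 ->
  cos Th * cos (a1 - x1) * (sin q ^+ 2 * (1 + tau ^+ 2) - tau ^+ 2) <= ha_G q - ha_K q.
Proof.
move=> q0 qpi; have hp := pi_gt0 R.
have [_ _ _ _ cT] := ha_cos_gt0; have sd := ha_sind_ge0; have t0 := ha_tau H.
have sq : 0 <= sin q by apply: sin_ge0; lra.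
have cq : 0 <= cos q by apply: cos_ge0_pihalf; lra.
rewrite ha_diag cos2sin2.
have : 0 <= cos Th * (2 * tau * sin (a1 - x1) * sin q * cos q).
  by rewrite !mulr_ge0// ltW.
lra.
Qed.

(** A uniform margin between the two sides. The first two terms are the values, at sin q = 0 and at
    q = p0, of a lower bound for G p - K q that is affine in sin^2 q. The third is a part of the
    diagonal difference G q - K q that survives when G decreases from q to the point of
    comparison. *)
Definition ha_gap : R :=
  let m := cos Th * cos (a1 - x1) in
  let k := cos a1 * cos a2 - tau ^+ 2 * (sin a1 * sin a2) in
  Num.min (Num.min (k * sin p0 ^+ 2 - m * tau ^+ 2) (m * (sin p0 ^+ 2 * (1 + tau ^+ 2) - tau ^+ 2)))
    (cos Th * (cos a1 * cos a2) * (1 / 100)).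

(** By the tangent relations the claim is tan y1 tan y2 <= 1 / 4, which holds because y1 + y2 < pi /
    4. *)
Lemma ha_tau2S : tau ^+ 2 * (sin a1 * sin a2) <= 1 / 4 * (cos a1 * cos a2).
Proof.
have [k1 k2 k3 k4 _] := ha_cos_gt0.
have t1 := ha_tan1 H; have t2 := ha_tan2 H.
have [c1 c2 c3 c4] := ha_c_trig.
have y0 : 0 < cos y1 * cos y2 by rewrite mulr_gt0.
rewrite -(ler_pM2r y0).
have -> : tau ^+ 2 * (sin a1 * sin a2) * (cos y1 * cos y2) =
  (tau * sin a1 * cos y1) * (tau * sin a2 * cos y2) by ring.
rewrite -t1 -t2.
have -> : sin y1 * cos a1 * (sin y2 * cos a2) = sin y1 * sin y2 * (cos a1 * cos a2) by ring.
have -> : 1 / 4 * (cos a1 * cos a2) * (cos y1 * cos y2) = 1 / 4 * (cos y1 * cos y2) * (cos a1 * cos a2) by ring.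
rewrite ler_pM2r ?mulr_gt0//.
have e1 : 2 * (cos y1 * cos y2) = cos c + cos (y2 - y1) by rewrite (cosD y1) (cosB y2); ring.
have e2 : 2 * (sin y1 * sin y2) = cos (y2 - y1) - cos c by rewrite (cosD y1) (cosB y2); ring.
have := cos_le1 (y2 - y1); lra.
Qed.

Lemma ha_gap_gt0 : 0 < ha_gap.
Proof.
have [k1 k2 k3 k4 cT] := ha_cos_gt0; have cd := ha_cosd_gt0.
have [h1 h2 h3 h4 h5] := ha_p0; have hS := ha_tau2S.
have cp := ha_cos_prod; have [c1 c2 c3 c4] := ha_c_trig.
have CC : 0 < cos a1 * cos a2 by rewrite mulr_gt0.
have m0 : 0 < cos Th * cos (a1 - x1) by rewrite mulr_gt0.
have t2 := sqr_ge0 tau.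
have mC : cos Th * cos (a1 - x1) <= cos a1 * cos a2.
  have [q1 q2 q3 q4 q5 q6 q7 q8 q9 q10 q11 q12 q13 q14 q15] := H.
  have [dR ht c0 dc] := ha_basic; have hp := pi_gt0 R.
  have x10 : 0 <= x1 by rewrite q6; nra.
  have x20 : 0 <= x2 by rewrite q7; nra.
  have s1 : 0 <= sin x1 by apply: sin_ge0; lra.
  have s2 : 0 <= sin x2 by apply: sin_ge0; lra.
  have : cos Th * cos (a1 - x1) = cos a1 * cos a2 - sin x1 * sin x2.
    have -> : a2 = Th - x1 by lra.
    have -> : x2 = Th - a1 by lra.
    by rewrite sinB !cosB; ring.
  by have := mulr_ge0 s1 s2; lra.
rewrite /ha_gap !lt_min; apply/andP; split; first (apply/andP; split).
- have hA := mulr_gt0 CC (_ : 0 < sin p0 ^+ 2 - 2 * tau ^+ 2).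
  have hB : 0 <= (1 / 4 * (cos a1 * cos a2) - tau ^+ 2 * (sin a1 * sin a2)) * sin p0 ^+ 2.
    by rewrite mulr_ge0 ?sqr_ge0// subr_ge0.
  have hC : 0 <= (cos a1 * cos a2 - cos Th * cos (a1 - x1)) * tau ^+ 2.
    by rewrite mulr_ge0 // subr_ge0.
  have {}hA := hA _; move: hA; rewrite subr_gt0 => /(_ h3) hA; nra.
- rewrite mulr_gt0//; nra.
- by rewrite !mulr_gt0.
Qed.

(** G p >= G p0 since p + p0 + c < pi; it remains to compare p0 with q, by adding G p0 - G q to the
    diagonal difference G q - K q. *)
Lemma ha_K_gap_le_G p q : p0 <= p -> p <= pi / 2 -> 0 <= q -> q <= p0 -> ha_K q + ha_gap <= ha_G p.
Proof.
move=> pp ppi q0 qp; have hp := pi_gt0 R.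
have [h1 h2 h3 h4 h5] := ha_p0; have nu0 := ha_nu_gt0; have [dR ht c0 dc] := ha_basic.
have [k1 k2 k3 k4 cT] := ha_cos_gt0; have cd := ha_cosd_gt0.
have a10 := ha_a1 H; have a12 := ha_a12 H; have t0 := ha_tau H.
have Gp : ha_G p0 <= ha_G p.
  rewrite -subr_ge0 ha_G_sub; apply: mulr_ge0 (ltW nu0) _.
  by apply: mulr_ge0; apply: sin_ge0; lra.
have dq := ha_diag_ge q0 _; have {}dq := dq _.
have {}dq : cos Th * cos (a1 - x1) * (sin q ^+ 2 * (1 + tau ^+ 2) - tau ^+ 2) <= ha_G q - ha_K q.
  by apply: dq; lra.
pose k := cos a1 * cos a2 - tau ^+ 2 * (sin a1 * sin a2).
have Gpq : k * (sin p0 ^+ 2 - sin q ^+ 2) <= ha_G p0 - ha_G q.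
  rewrite !ha_GE.
  have e z : (sin z * cos a1 + tau * cos z * sin a1) * (sin z * cos a2 + tau * cos z * sin a2) =
    cos a1 * cos a2 * sin z ^+ 2 + tau * sin (a1 + a2) * (sin z * cos z) + tau ^+ 2 * (sin a1 * sin a2) * cos z ^+ 2.
    by rewrite sinD; ring.
  rewrite !e !cos2sin2 /k.
  have s12 : 0 <= sin (a1 + a2) by apply: sin_ge0; have := ha_a1_lt; have := ha_Th1 H; have := ha_Th H; have := ha_y1 H; rewrite (ha_x1 H); nra.
  have s2pq : sin q * cos q <= sin p0 * cos p0.
    have s2 z : sin z * cos z = sin (z + z) / 2 by rewrite sinD; field.
    by rewrite !s2 ler_pM2r// sin_le//; lra.
  have := mulr_ge0 (mulr_ge0 (ltW t0) s12) (_ : 0 <= sin p0 * cos p0 - sin q * cos q).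
  rewrite subr_ge0 => /(_ s2pq); nra.
set m := cos Th * cos (a1 - x1) in dq *.
have u0 : 0 < sin p0 ^+ 2 by have := sqr_ge0 tau; lra.
have uq : sin q ^+ 2 <= sin p0 ^+ 2.
  have s1 : sin q <= sin p0 by apply: sin_le; lra.
  have s0 : 0 <= sin q by apply: sin_ge0; lra.
  nra.
have uq0 := sqr_ge0 (sin q).
have g1 : ha_gap <= k * sin p0 ^+ 2 - m * tau ^+ 2 by rewrite /ha_gap !ge_min lexx.
have g2 : ha_gap <= m * (sin p0 ^+ 2 * (1 + tau ^+ 2) - tau ^+ 2) by rewrite /ha_gap !ge_min lexx orbT.
(* The right side is affine in sin^2 q on [0, sin^2 p0]; multiplication by sin^2 p0 writes it as a
   combination of its two endpoint values, each at least [ha_gap]. *)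
suff : ha_gap <= k * (sin p0 ^+ 2 - sin q ^+ 2) + m * (sin q ^+ 2 * (1 + tau ^+ 2) - tau ^+ 2) by lra.
rewrite -(ler_pM2l u0).
have hA := mulr_ge0 (_ : 0 <= sin p0 ^+ 2 - sin q ^+ 2) (_ : 0 <= k * sin p0 ^+ 2 - m * tau ^+ 2 - ha_gap).
have hB := mulr_ge0 uq0 (_ : 0 <= m * (sin p0 ^+ 2 * (1 + tau ^+ 2) - tau ^+ 2) - ha_gap).
move: hA hB; rewrite !subr_ge0 => /(_ uq g1) hA /(_ g2) hB.
move: (sin p0 ^+ 2) (sin q ^+ 2) (tau ^+ 2) (ha_gap) hA hB => u v t g; lra.
Qed.

Lemma ha_K_gap_le_G_diag q : p0 <= q -> q <= pi / 2 -> ha_K q + ha_gap <= ha_G q.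
Proof.
move=> pq qpi; have [h1 h2 h3 h4 h5] := ha_p0.
have q0 : 0 <= q by lra.
have := ha_diag_ge q0 qpi; have := ha_sin2_lower pq qpi => us.
have g2 : ha_gap <= cos Th * cos (a1 - x1) * (sin p0 ^+ 2 * (1 + tau ^+ 2) - tau ^+ 2).
  by rewrite /ha_gap !ge_min lexx orbT.
have [_ _ _ _ cT] := ha_cos_gt0; have cd := ha_cosd_gt0.
have m0 : 0 < cos Th * cos (a1 - x1) by rewrite mulr_gt0.
have : cos Th * cos (a1 - x1) * (sin p0 ^+ 2 * (1 + tau ^+ 2) - tau ^+ 2) <=
  cos Th * cos (a1 - x1) * (sin q ^+ 2 * (1 + tau ^+ 2) - tau ^+ 2).
  rewrite ler_pM2l// lerD2r ler_wpM2r//; have := sqr_ge0 tau; lra.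
lra.
Qed.

End HalfAngles.

(** * The expansion inequality k G > K with a uniform margin *)

Section Expansion.
Variables (R : realType) (d : nat) (tau a1 a2 x1 x2 y1 y2 Th : R).
Hypothesis H : half_angles d tau a1 a2 x1 x2 y1 y2 Th.

Local Notation c := (y1 + y2).
Local Notation p0 := (@pi R / (2 * d%:R)).
Local Notation nu := (ha_nu a1 a2 y1 y2).
Local Notation G := (ha_G a1 a2 y1 y2).
Local Notation K := (ha_K tau x1 x2).
Local Notation gap := (ha_gap d tau a1 a2 x1 Th).

Lemma ha_gap_le : gap <= cos Th * (cos a1 * cos a2) * (1 / 100).
Proof. by rewrite /ha_gap ge_min lexx orbT. Qed.

Lemma ha_G_ge0 p : 0 <= p -> p <= pi / 2 -> 0 <= G p.
Proof.
move=> pge ppi; have [dc' c4] := ha_c_lt H; have hp := pi_gt0 R.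
have hy1 := ha_y1 H; have hy12 := ha_y12 H.
apply: mulr_ge0; first exact/ltW/ha_nu_gt0/H.
by apply: mulr_ge0; apply: sin_ge0; lra.
Qed.

(** G p - G q has the sign of sin (p + q + c), so only p + q + c > pi is delicate; then p and q are
    within c of pi / 2. For k >= 2 the factor 2 makes up for the loss. For k = 1 the relation p - q
    = pi / 2 - Th gives the loss the factor cos Th, which the diagonal difference G q - K q also
    has, and the latter wins. *)
Lemma ha_neg k p q : (0 < k)%N -> p0 <= p -> p <= pi / 2 -> 0 <= q -> q <= p ->
  (1 < k)%N \/ p - q = pi / 2 - Th -> K q + gap <= k%:R * G p.
Proof.
move=> k0 pp ppi q0 qp kq; have hp := pi_gt0 R.
have [h1 h2 h3 h4 h5] := ha_p0 H; have [dc' c4] := ha_c_lt H.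
have [dR ht cpos dc] := ha_basic H.
have Gp0 : 0 <= G p by apply: ha_G_ge0 => //; lra.
have Gk : G p <= k%:R * G p by rewrite ler_peMl// ler1n.
have [qp0|/ltW qp0] := leP q p0.
  by apply: le_trans Gk; apply: (ha_K_gap_le_G H).
have qpi : q <= pi / 2 by lra.
have KG := ha_K_gap_le_G_diag H qp0 qpi.
have spq : 0 <= sin (p - q) by apply: sin_ge0; lra.
have nu0 := ha_nu_gt0 H.
have [spqc|spqc] := leP 0 (sin (p + q + c)).
  apply: le_trans Gk; apply: le_trans KG _.
  by rewrite -subr_ge0 ha_G_sub; apply: mulr_ge0 (ltW nu0) _; exact: mulr_ge0.
have pqc : pi < p + q + c.
  by rewrite ltNge; apply/negP => hh; move: spqc; rewrite ltNge sin_ge0//; lra.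
have [c1 c2 c3 c5] := ha_c_trig H.
case: kq => [k1|pq].
  have k2 : 2 <= k%:R :> R by rewrite ler_nat.
  apply: (@le_trans _ _ (2 * G p)); last by rewrite ler_wpM2r.
  apply: le_trans KG _; rewrite /ha_G [leRHS]mulrCA ler_pM2l// !sinsin.
  have cp : cos (p + y1 + (p + y2)) <= - cos c.
    have -> : p + y1 + (p + y2) = 2 * p + c - pi + pi by ring.
    rewrite cosDpi lerN2; apply: cos_le; lra.
  have -> : p + y1 - (p + y2) = - (y2 - y1) by ring.
  have -> : q + y1 - (q + y2) = - (y2 - y1) by ring.
  rewrite cosN.
  have := cos_geN1 (q + y1 + (q + y2)); lra.
apply: le_trans Gk.
have := ha_G_sub a1 a2 y1 y2 p q; rewrite pq.
have -> : sin (pi / 2 - Th) = cos Th.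
  by rewrite sinB sin_pihalf cos_pihalf; ring.
move=> Gpq.
have [k1 k2' k3 k4 cT] := ha_cos_gt0 H; have cd := ha_cosd_gt0 H.
have cp := ha_cos_prod H; have nule := ha_nu_le H.
have diag := ha_diag_ge H q0 qpi.
have t0 := ha_tau H.
have cc0 : 0 < cos c by lra.
set X := sin q ^+ 2 * (1 + tau ^+ 2) - tau ^+ 2 in diag.
pose Y := - sin (p + q + c).
have Y0 : 0 <= Y by rewrite /Y oppr_ge0 ltW.
(* With x = pi / 2 - q one has 0 <= x < c, Y <= sin (c - x) and X >= 1 - 5/4 sin^2 x. *)
have XY : 1 / 10 <= X - Y.
  pose x := pi / 2 - q.
  have x0 : 0 <= x by rewrite /x; lra.
  have xc : x < c by rewrite /x; lra.
  have sx : sin q = cos x by rewrite /x cosB cos_pihalf sin_pihalf; ring.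
  have YE : Y = sin (p + q + c - pi).
    by rewrite /Y -[in LHS](subrK pi (p + q + c)) sinDpi opprK.
  have Yle : Y <= sin c * cos x - cos c * sin x.
    by rewrite YE -sinB; apply: sin_le; rewrite /x; lra.
  have sx0 : 0 <= sin x by apply: sin_ge0; lra.
  have sxc : sin x <= sin c by apply: sin_le; lra.
  have cx1 := cos_le1 x.
  have tau4 : tau ^+ 2 <= 1 / 4 by nra.
  have XE : X = 1 - sin x ^+ 2 * (1 + tau ^+ 2) by rewrite /X sx cos2sin2; ring.
  have X1 : 1 - 5 / 4 * sin x ^+ 2 <= X.
    by rewrite XE; have := sqr_ge0 (sin x); nra.
  have e1 : sin c * cos x <= 71 / 100 by have := mulr_ge0 c3 (_ : 0 <= 1 - cos x); rewrite subr_ge0 => /(_ cx1); lra.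
  have e2 : 7 / 10 * sin x <= cos c * sin x by rewrite ler_wpM2r.
  have e3 : sin x ^+ 2 <= 71 / 100 * sin x.
    by rewrite expr2 ler_wpM2r//; lra.
  nra.
have gle := ha_gap_le.
(* nu <= C / cos c and cos delta >= C / cos c *)
have CC : 0 < cos a1 * cos a2 by rewrite mulr_gt0.
have e1 : nu * Y * cos c <= cos a1 * cos a2 * Y.
  by rewrite mulrAC ler_wpM2r.
have X0 : 0 <= X by lra.
have e2 : cos a1 * cos a2 * X <= cos (a1 - x1) * X * cos c.
  by rewrite [leRHS]mulrAC ler_wpM2r.
have e3 : cos a1 * cos a2 * (1 / 10) <= cos a1 * cos a2 * (X - Y) by rewrite ler_wpM2l// ltW.
have cc1 := cos_le1 c.
have e4 : cos a1 * cos a2 * (1 / 10) <= cos (a1 - x1) * X - nu * Y.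
  have e5 : cos a1 * cos a2 * (1 / 10) <= (cos (a1 - x1) * X - nu * Y) * cos c by lra.
  have e6 : 0 <= cos (a1 - x1) * X - nu * Y.
    by rewrite -(pmulr_lge0 _ cc0); apply: le_trans e5; rewrite mulr_ge0// ltW.
  by apply: le_trans e5 _; rewrite ler_piMr.
have e7 := ler_wpM2l (ltW cT) e4.
have e8 : G p - G q = - (cos Th * (nu * Y)) by rewrite Gpq /Y; ring.
have e9 : 0 < cos Th * (cos a1 * cos a2) by rewrite mulr_gt0.
lra.
Qed.

(** The sum p + q stays small enough for K q + gap <= G p. The signs of y1 and y2 are then changed
    at the cost of the factor k: k sin (p - c) >= sin (p + c) suffices, and p >= c + pi / (2 (k +
    1)) because (k + 1) p >= pi / 2 + Th and (k + 1) c <= Th. *)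
Lemma ha_pos2 k p q : (1 < k)%N -> (k < d)%N -> p <= pi / 2 -> 0 <= q -> q <= p ->
  q = pi / 2 + Th - k%:R * p -> K q + gap <= k%:R * (nu * (sin (p - y1) * sin (p - y2))).
Proof.
move=> k1 kd ppi q0 qp qE; have hp := pi_gt0 R.
have [h1 h2 h3 h4 h5] := ha_p0 H; have [dc' c4] := ha_c_lt H.
have [dR ht cpos dc] := ha_basic H; have hT := ha_Th H.
have [c1 c2 c3 c5] := ha_c_trig H.
have k2 : 2 <= k%:R :> R by rewrite ler_nat.
have kd' : k%:R + 1 <= d%:R :> R by rewrite natr1 ler_nat.
have kc : (k%:R + 1) * c <= Th.
  by apply: le_trans dc; rewrite ler_pM2r.
have kp : pi / 2 + Th <= (k%:R + 1) * p by lra.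
pose phi : R := pi / (2 * (k%:R + 1)).
have kphi : (k%:R + 1) * phi = pi / 2 by rewrite /phi; field; lra.
have psi : phi + c <= p.
  rewrite -(ler_pM2l (_ : 0 < k%:R + 1)) ?mulrDr; lra.
have phi0 : 0 < phi by rewrite /phi divr_gt0//; lra.
have p0phi : p0 <= phi.
  rewrite -(ler_pM2l (_ : 0 < k%:R + 1)) ?kphi; last by lra.
  rewrite mulrA ler_pdivrMr; last by lra.
  nra.
have c6 : c <= pi / 6 by nra.
have kp3 : p + q <= 2 / 3 * (pi / 2 + Th).
  have hk1 := ler_wpM2l (_ : 0 <= k%:R - 1) kp.
  have {}hk1 : (k%:R - 1) * (pi / 2 + Th) <= (k%:R - 1) * ((k%:R + 1) * p) by apply: hk1; lra.
  have hX : (k%:R + 1) * (p + q) <= 2 * (pi / 2 + Th) by rewrite qE; lra.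
  have : 0 <= (k%:R - 2) * (p + q) by apply: mulr_ge0; lra.
  lra.
have nu0 := ha_nu_gt0 H.
have pge0 : 0 <= p by lra.
have base : K q + gap <= G p.
  have [qp0|/ltW qp0] := leP q p0; first by apply: (ha_K_gap_le_G H) => //; lra.
  apply: le_trans (ha_K_gap_le_G_diag H qp0 _) _; first by lra.
  rewrite -subr_ge0 ha_G_sub; apply: mulr_ge0 (ltW nu0) _.
  by apply: mulr_ge0; apply: sin_ge0; lra.
apply: le_trans base _; rewrite /ha_G [leRHS]mulrCA ler_pM2l//.
(* sin (p + c) <= 1 <= k sin phi <= k sin (p - c) *)
have ks : 1 <= k%:R * sin (p - c).
  apply: le_trans (natmul_sin_ge1 R k1) _; rewrite ler_wpM2l//.
  by apply: sin_le; rewrite -/phi; lra.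
have key : 0 <= (k%:R - 1) * (sin p * cos c) - (k%:R + 1) * (cos p * sin c).
  by have := sin_le1 (p + c); move: ks; rewrite sinB (sinD p); lra.
have sp : 0 <= sin p by apply: sin_ge0; lra.
have := mulr_ge0 sp key.
rewrite !sinsin.
have -> : p - y1 - (p - y2) = y2 - y1 by ring.
have -> : p + y1 - (p + y2) = - (y2 - y1) by ring.
have -> : p - y1 + (p - y2) = p + p - c by ring.
have -> : p + y1 + (p + y2) = p + p + c by ring.
rewrite cosN (cosB _ c) (cosD _ c) (cosD p p) (sinD p p) -!expr2 cos2sin2.
have := mulr_ge0 (_ : 0 <= k%:R - 1) (_ : 0 <= cos (y2 - y1) - cos c).
rewrite !subr_ge0 => /(_ _ c2) hk.
have {}hk : 0 <= (k%:R - 1) * (cos (y2 - y1) - cos c) by apply: hk; lra.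
nra.
Qed.

(** The right side is G (p - c), and p + q = pi / 2 + Th makes G (p - c) - G q equal to nu cos Th
    sin (p - c - q). When this is negative, its size is at most nu cos Th sin c, and the diagonal
    difference absorbs it. *)
Lemma ha_pos1 p q : (2 < d)%N -> pi / d%:R + y1 <= p -> p <= pi / 2 -> 0 <= q -> q <= p ->
  q = pi / 2 + Th - p -> K q + gap <= nu * (sin (p - y1) * sin (p - y2)).
Proof.
move=> d3 pd ppi q0 qp qE; have hp := pi_gt0 R.
have [h1 h2 h3 h4 h5] := ha_p0 H; have [dc' c4] := ha_c_lt H.
have [dR ht cpos dc] := ha_basic H; have hT := ha_Th H.
have [c1 c2 c3 c5] := ha_c_trig H.
have d3' : 3 <= d%:R :> R by rewrite ler_nat.
have hy1 := ha_y1 H; have hy12 := ha_y12 H; have hx1 := ha_x1 H; have hx2 := ha_x2 H.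
have ha1 := ha_a1 H; have hT2 := ha_Th2 H.
have pd2 : pi / d%:R = p0 + p0 by field; lra.
have dp0 : d%:R * p0 = pi / 2 by field; lra.
have y2p : y2 <= p0.
  rewrite -(ler_pM2l (_ : 0 < d%:R)) ?dp0; last by lra.
  by rewrite -hx2; lra.
have nu0 := ha_nu_gt0 H.
have -> : nu * (sin (p - y1) * sin (p - y2)) = G (p - c).
  by rewrite /ha_G [sin (p - y1) * _]mulrC; congr (_ * (sin _ * sin _)); ring.
have [qp0|/ltW qp0] := leP q p0; first by apply: (ha_K_gap_le_G H) => //; lra.
have qpi : q <= pi / 2 by lra.
have := ha_G_sub a1 a2 y1 y2 (p - c) q.
have -> : p - c + q + c = pi / 2 + Th by lra.
have -> : sin (pi / 2 + Th) = cos Th by rewrite sinD sin_pihalf cos_pihalf; ring.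
move=> Gpq.
have [k1 k2' k3 k4 cT] := ha_cos_gt0 H; have cd := ha_cosd_gt0 H.
have [qpc|qpc] := leP q (p - c).
  apply: le_trans (ha_K_gap_le_G_diag H qp0 qpi) _.
  rewrite -subr_ge0 Gpq; apply: mulr_ge0 (ltW nu0) _; apply: mulr_ge0 (ltW cT) _.
  by apply: sin_ge0; lra.
have diag := ha_diag_ge H q0 qpi.
have cp := ha_cos_prod H; have nule := ha_nu_le H.
have t0 := ha_tau H; have dt := ha_dtau H.
have cc0 : 0 < cos c by lra.
set X := sin q ^+ 2 * (1 + tau ^+ 2) - tau ^+ 2 in diag.
(* From q > p - c and Th >= 3 c one gets q >= pi / 4 + c / 2, whose sine squared is (1 + sin c) / 2;
   d >= 3 gives tau < 1 / 3. *)
have XY : 1 / 100 <= X - sin c.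
  have q4 : pi / 4 + c / 2 <= q by nra.
  have s1 : sin (pi / 4 + c / 2) <= sin q by apply: sin_le; lra.
  have s0 : 0 <= sin (pi / 4 + c / 2) by apply: sin_ge0; lra.
  have e : sin (pi / 4 + c / 2) ^+ 2 = 1 / 2 + sin c / 2.
    have := cos_half (pi / 2 + c).
    have -> : (pi / 2 + c) / 2 = pi / 4 + c / 2 by field.
    rewrite cosD cos_pihalf sin_pihalf; lra.
  have t3 : tau < 1 / 3 by nra.
  have t9 : tau ^+ 2 <= 1 / 9 by nra.
  have s2 : 1 / 2 + sin c / 2 <= sin q ^+ 2 by rewrite -e; nra.
  rewrite /X; have := sqr_ge0 tau; nra.
have spc : - sin c <= sin (p - c - q).
  by rewrite -sinN; apply: sin_le; lra.
have CC : 0 < cos a1 * cos a2 by rewrite mulr_gt0.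
have e1 : nu * sin c * cos c <= cos a1 * cos a2 * sin c by rewrite mulrAC ler_wpM2r.
have X0 : 0 <= X by lra.
have e2 : cos a1 * cos a2 * X <= cos (a1 - x1) * X * cos c by rewrite [leRHS]mulrAC ler_wpM2r.
have e3 : cos a1 * cos a2 * (1 / 100) <= cos a1 * cos a2 * (X - sin c) by rewrite ler_wpM2l// ltW.
have cc1 := cos_le1 c.
have e4 : cos a1 * cos a2 * (1 / 100) <= cos (a1 - x1) * X - nu * sin c.
  have e5 : cos a1 * cos a2 * (1 / 100) <= (cos (a1 - x1) * X - nu * sin c) * cos c by lra.
  have e6 : 0 <= cos (a1 - x1) * X - nu * sin c.
    by rewrite -(pmulr_lge0 _ cc0); apply: le_trans e5; rewrite mulr_ge0// ltW.
  by apply: le_trans e5 _; rewrite ler_piMr.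
have e7 := ler_wpM2l (ltW cT) e4.
have gle := ha_gap_le.
have e8 : - (cos Th * (nu * sin c)) <= G (p - c) - G q.
  rewrite Gpq.
  have : 0 <= cos Th * nu * (sin (p - c - q) + sin c).
    by apply: mulr_ge0; [rewrite mulr_ge0// ltW|lra].
  lra.
lra.
Qed.

End Expansion.

(** * Reduction modulo 2 pi and Hilbert densities of arcs *)

Section Periodic.
Variable R : realType.
Implicit Types (x y p q a th e : R).

Lemma periodic_int (f : R -> R) : (forall x, f (x + 2 * pi) = f x) ->
  forall (n : int) x, f (x + 2 * pi * n%:~R) = f x.
Proof.
move=> fp.
have pos (n : nat) x : f (x + 2 * pi * n%:R) = f x.
  elim: n x => [|n IH] x; first by rewrite mulr0 addr0.
  by rewrite -[n.+1]addn1 natrD mulrDr mulr1 addrA fp IH.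
case=> n x; first exact: pos.
rewrite NegzE mulrNz mulrN -[in RHS](subrK (2 * pi * n.+1%:R) x) pos.
by [].
Qed.

Lemma reduce_mod2pi x a : exists n : int, a <= x + 2 * pi * n%:~R < a + 2 * pi.
Proof.
have p0 := @pi_gt0 R.
exists (- Num.floor ((x - a) / (2 * pi))).
have /andP[h1 h2] := Num.Theory.floor_itv ((x - a) / (2 * pi)).
rewrite mulrNz mulrN.
move: h1 h2; rewrite intrD; set n := (Num.floor _)%:~R.
rewrite ler_pdivlMr ?mulr_gt0// ltr_pdivrMr ?mulr_gt0// => h1 h2.
apply/andP; split; lra.
Qed.

Lemma cosD2pi_int x (n : int) : cos (x + 2 * pi * n%:~R) = cos x.
Proof.
apply: (periodic_int (f := @cos R)) => y.
have -> : y + 2 * pi = y + pi *+ 2 by rewrite mulr2n; ring.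
exact: cosD2pi.
Qed.

Lemma sinD2pi_int x (n : int) : sin (x + 2 * pi * n%:~R) = sin x.
Proof.
apply: (periodic_int (f := @sin R)) => y.
have -> : y + 2 * pi = y + pi *+ 2 by rewrite mulr2n; ring.
exact: sinD2pi.
Qed.

(* Up to a factor 1/2, the reciprocal of the Hilbert metric density of either
   arc of the circle with endpoints p and q (positive off [p, q]). *)
Definition hilb x p q : R := sin ((x - p) / 2) * sin ((x - q) / 2) / sin ((q - p) / 2).

Lemma hilbE x p q : hilb x p q =
  (cos ((q - p) / 2) - cos (x - (p + q) / 2)) / (2 * sin ((q - p) / 2)).
Proof.
rewrite /hilb sinsin.
have -> : (x - p) / 2 - (x - q) / 2 = (q - p) / 2 by field.
have -> : (x - p) / 2 + (x - q) / 2 = x - (p + q) / 2 by field.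
by rewrite invfM mulrA.
Qed.

Lemma hilb_int x p q (n : int) : hilb (x + 2 * pi * n%:~R) p q = hilb x p q.
Proof. by rewrite !hilbE addrAC cosD2pi_int. Qed.

Lemma hilb_refl th x p q : hilb (th - x) (th - q) (th - p) = hilb x p q.
Proof.
rewrite /hilb.
have -> : (th - x - (th - q)) / 2 = - ((x - q) / 2) by field.
have -> : (th - x - (th - p)) / 2 = - ((x - p) / 2) by field.
have -> : (th - p - (th - q)) / 2 = (q - p) / 2 by field.
by rewrite !sinN mulrNN [sin ((x - q) / 2) * _]mulrC.
Qed.

Lemma hilb_swap x p q : hilb x q p = - hilb x p q.
Proof.
rewrite /hilb.
have -> : (p - q) / 2 = - ((q - p) / 2) by field.
by rewrite sinN invrN mulrN [sin ((x - q) / 2) * _]mulrC.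
Qed.

(** By [hilbE] the density is affine in the cosine of the angle from the midpoint, on which
    multiplication by d acts as T_d. *)
Lemma hilb_natmul (d : nat) x p q :
  sin ((q - p) / 2) != 0 -> sin (d%:R * ((q - p) / 2)) != 0 ->
  d%:R * hilb x p q - hilb (d%:R * x) (d%:R * p) (d%:R * q) =
  cheb_defect d ((q - p) / 2) (x - (p + q) / 2) /
    (2 * sin ((q - p) / 2) * sin (d%:R * ((q - p) / 2))).
Proof.
move=> s1 s2; rewrite !hilbE.
have -> : (d%:R * q - d%:R * p) / 2 = d%:R * ((q - p) / 2) by field.
have -> : d%:R * x - (d%:R * p + d%:R * q) / 2 = d%:R * (x - (p + q) / 2) by field.
rewrite /cheb_defect; field; exact/andP.
Qed.

(** No sign is imposed on [hilb]: where it is nonnegative, outside the arc, this is expansion by z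
    |-> z^d; inside, where it is negative, it is Schwarz's lemma. *)
Lemma hilb_natmul_le (d : nat) x p q : (0 < d)%N -> p < q -> d%:R * (q - p) < 2 * pi ->
  hilb (d%:R * x) (d%:R * p) (d%:R * q) <= d%:R * hilb x p q.
Proof.
move=> d0 pq dpq.
have d1 : 1 <= d%:R :> R by rewrite ler1n.
have e0 : 0 < (q - p) / 2 by lra.
have de : d%:R * ((q - p) / 2) < pi by lra.
have de0 : 0 < d%:R * ((q - p) / 2) by rewrite mulr_gt0//; lra.
have s1 : 0 < sin ((q - p) / 2).
  apply: sin_gt0 => //; apply: le_lt_trans de; rewrite ler_peMl//; lra.
have s2 : 0 < sin (d%:R * ((q - p) / 2)) by exact: sin_gt0.
rewrite -subr_ge0 hilb_natmul ?gt_eqF//.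
apply: divr_ge0; last by rewrite !mulr_ge0// ltW.
by apply: cheb_defect_ge0 => //; exact: ltW.
Qed.

End Periodic.

Section LiftPeriodic.
Variables (R : realType) (b : R).
Hypothesis b1 : 1 < b.

Lemma hlift_int x (n : int) : hlift b (x + 2 * pi * n%:~R) = hlift b x + 2 * pi * n%:~R.
Proof.
have := @periodic_int R (fun x => hlift b x - x) _ n x.
move=> /(_ _) H; have {}H : hlift b (x + 2 * pi * n%:~R) - (x + 2 * pi * n%:~R) = hlift b x - x.
  by apply: H => y; rewrite hliftD2pi; ring.
lra.
Qed.

Lemma dhlift_int x (n : int) : dhlift b (x + 2 * pi * n%:~R) = dhlift b x.
Proof. exact: (periodic_int (dhliftD2pi b)). Qed.

(** Moebius maps of the circle are isometries for the Hilbert metrics of arcs. *)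
Lemma hilb_hlift x p q : sin ((q - p) / 2) != 0 ->
  hilb (hlift b x) (hlift b p) (hlift b q) = dhlift b x * hilb x p q.
Proof.
move=> s0; rewrite /hilb !sin_hlift_sub// /dhlift -nrm_sq//.
have b0 : b ^+ 2 - 1 != 0 by rewrite gt_eqF//; have := b1; nra.
by field; rewrite s0 b0 !gt_eqF ?nrm_gt0.
Qed.

Lemma hlift_lip x y : x <= y -> hlift b y - hlift b x <= (b + 1) / (b - 1) * (y - x).
Proof.
move=> xy; have [z _ ->] := mvt (is_derive_hlift b1) xy.
by rewrite ler_wpM2r ?subr_ge0// dhlift_le.
Qed.

End LiftPeriodic.

(* A 2-cycle am < ap of t |-> th - d hlift t, normalised by 0 <= am and th < pi. *)
Record two_cycle (R : realType) (d : nat) (b th am ap : R) : Prop := TwoCycle {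
  tc_b : 1 < b;
  tc_d : (2 <= d)%N;
  tc_db : d%:R * (b - 1) < b + 1;
  tc_am : 0 <= am;
  tc_lt : am < ap;
  tc_th : th < pi;
  tc_1 : th - d%:R * hlift b am = ap;
  tc_2 : th - d%:R * hlift b ap = am }.

(** * Lifts of the maps and of their compositions *)

Section LiftedMaps.
Variables (R : realType) (d : nat) (b th : R).

Definition flift (k : nat) (x : R) : R :=
  if k == d then th - d%:R * hlift b x else th - hlift b (th - k%:R * hlift b x).

(** The absolute value of the derivative of [flift]: the letter d reverses orientation, the others
    preserve it. *)
Definition dflift (k : nat) (x : R) : R :=
  if k == d then d%:R * dhlift b x else k%:R * dhlift b x * dhlift b (th - k%:R * hlift b x).

(** The index counts the maps composed, starting from the identity at 0; [fhat_seq] at n is thus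
    lifted by [flift_seq] at n + 1. *)
Fixpoint flift_seq (w : nat -> nat) (n : nat) (x : R) : R :=
  if n is n'.+1 then flift (w n') (flift_seq w n' x) else x.

Fixpoint dflift_seq (w : nat -> nat) (n : nat) (x : R) : R :=
  if n is n'.+1 then dflift (w n') (flift_seq w n' x) * dflift_seq w n' x else 1.

End LiftedMaps.

(** * Expansion of W by the letter d, and repulsion of the 2-cycle *)

Section TwoCycle.
Variables (R : realType) (d : nat) (b th am ap : R).
Hypothesis T : two_cycle d b th am ap.

Local Notation h := (hlift b).
Local Notation tau := ((b - 1) / (b + 1)).
Local Notation W x := (hilb x am ap).
Local Notation phi x := (th - d%:R * h x).

Lemma tc_tau : 0 < tau /\ d%:R * tau < 1.
Proof.
have [b1 d2 db a0 a12 tpi e1 e2] := T.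
split; first by rewrite divr_gt0//; lra.
by rewrite mulrA ltr_pdivrMr; lra.
Qed.

(** For d h(am) <= am: convexity of h gives (ap - am) h(am) <= am (h(ap) - h(am)), and ap - am is d
    times the last factor. *)
Lemma tc_hlift : [/\ 0 <= h am, h am < h ap, ap - am = d%:R * (h ap - h am),
   d%:R * h am <= am & ap <= th].
Proof.
have [b1 d2 db a0 a12 tpi e1 e2] := T.
have h0 := hlift_ge0 b1 a0; have h12 := hlift_lt b1 a12.
have dR : 2 <= d%:R :> R by rewrite ler_nat.
have ah : ap - am = d%:R * (h ap - h am) by lra.
have apth : ap <= th by have : 0 <= d%:R * h am by [apply: mulr_ge0; lra|]; lra.
split => //.
have := @hlift_star _ _ b1 am ap a0 (ltW a12) _.
have -> : ap = am + d%:R * (h ap - h am) by lra.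
move=> /(_ _); rewrite -ah addrC subrK => st.
have {}st : ap * h am <= am * h ap by apply: st; lra.
have : (h ap - h am) * (d%:R * h am) <= (h ap - h am) * am.
  have -> : (h ap - h am) * (d%:R * h am) = (ap - am) * h am by rewrite ah; ring.
  lra.
by rewrite ler_pM2l// subr_gt0.
Qed.

Lemma tc_half_angles : half_angles d tau (am / 2) (ap / 2)
  (d%:R * (h am / 2)) (d%:R * (h ap / 2)) (h am / 2) (h ap / 2) (th / 2).
Proof.
have [b1 d2 db a0 a12 tpi e1 e2] := T.
have [h0 h12 ah dh apth] := tc_hlift; have [t0 dt] := tc_tau.
have tan x : sin (h x / 2) * cos (x / 2) = tau * sin (x / 2) * cos (h x / 2).
  rewrite sin_half_hlift// cos_half_hlift//; field.
  by rewrite gt_eqF ?nrm_gt0//= gt_eqF//; lra.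
split => //; lra.
Qed.

Lemma tc_sin_gt0 : 0 < sin ((ap - am) / 2) /\ 0 < sin ((h ap - h am) / 2).
Proof.
have [b1 d2 db a0 a12 tpi e1 e2] := T.
have [h0 h12 ah dh apth] := tc_hlift.
have dR : 2 <= d%:R :> R by rewrite ler_nat.
split; apply: sin_gt0; [lra|lra|lra|].
have : 2 * (h ap - h am) <= ap - am by rewrite ah ler_wpM2r// subr_ge0 ltW.
lra.
Qed.

Lemma tc_W_phi x : W (phi x) = hilb (d%:R * h x) (d%:R * h am) (d%:R * h ap).
Proof. by rewrite -[RHS](hilb_refl th) (tc_1 T) (tc_2 T). Qed.

Lemma tc_W_th X : W (th - X) = hilb X (d%:R * h am) (d%:R * h ap).
Proof. by rewrite -[RHS](hilb_refl th) (tc_1 T) (tc_2 T). Qed.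

Lemma tc_hilb_h x : hilb (h x) (h am) (h ap) = dhlift b x * W x.
Proof. by rewrite hilb_hlift ?(tc_b T)// gt_eqF//; have [] := tc_sin_gt0. Qed.

Lemma tc_half_d : d%:R * ((h ap - h am) / 2) = (ap - am) / 2.
Proof. by have [h0 h12 ah dh apth] := tc_hlift; rewrite ah mulrA. Qed.

Lemma tc_expand_eq x : d%:R * dhlift b x * W x - W (phi x) =
  cheb_defect d ((h ap - h am) / 2) (h x - (h am + h ap) / 2) /
    (2 * sin ((h ap - h am) / 2) * sin ((ap - am) / 2)).
Proof.
have [s1 s2] := tc_sin_gt0.
rewrite tc_W_phi -mulrA -tc_hilb_h hilb_natmul ?tc_half_d//; exact: lt0r_neq0.
Qed.

Lemma tc_expand_weak x : W (phi x) <= d%:R * dhlift b x * W x.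
Proof.
have [s1 s2] := tc_sin_gt0; have [h0 h12 ah dh apth] := tc_hlift.
have [b1 d2 db a0 a12 tpi e1 e2] := T.
rewrite -subr_ge0 tc_expand_eq; apply: divr_ge0; last by rewrite !mulr_ge0// ltW.
apply: cheb_defect_ge0; [exact: ltnW|lra|rewrite tc_half_d; lra].
Qed.

Lemma tc_W_le x : W x <= (sin ((ap - am) / 2))^-1.
Proof.
have [s1 s2] := tc_sin_gt0.
rewrite /hilb; apply: ler_piMl; first by rewrite invr_ge0 ltW.
have := sin_max ((x - am) / 2); have := sin_max ((x - ap) / 2).
move=> u v; apply: le_trans (ler_norm _) _; rewrite normrM.
by rewrite -[leRHS]mul1r; apply: ler_pM.
Qed.

(** [cheb_defect_unif] gives an additive excess, since h' >= tau turns w <= W x into a lower bound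
    for a difference of cosines. As W is at most 1 / sin ((ap - am) / 2), the excess is also a fixed
    factor. *)
Lemma tc_expand w : 0 < w -> exists2 kap, 1 < kap & forall x,
  w <= W x -> 0 <= W (phi x) -> kap * W (phi x) <= d%:R * dhlift b x * W x.
Proof.
move=> w0.
have [s1 s2] := tc_sin_gt0; have [h0 h12 ah dh apth] := tc_hlift.
have [b1 d2 db a0 a12 tpi e1 e2] := T; have [t0 dt] := tc_tau.
pose e := (h ap - h am) / 2; rewrite -/e in s2 *.
have e0 : 0 < e by rewrite /e; lra.
have de : d%:R * e < pi by rewrite tc_half_d; lra.
have w1 : 0 < 2 * sin e * (tau * w) by apply: mulr_gt0; exact: mulr_gt0.
have [c c0 hc] := cheb_defect_unif d2 e0 de w1.
pose c1 := c / (2 * sin e * sin ((ap - am) / 2)).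
have c10 : 0 < c1 by rewrite divr_gt0// !mulr_gt0.
exists (1 + c1 * sin ((ap - am) / 2)); first by rewrite ltrDl mulr_gt0.
move=> x wx Wphi.
have : c1 <= d%:R * dhlift b x * W x - W (phi x).
  rewrite tc_expand_eq ler_pM2r ?invr_gt0 ?mulr_gt0//; apply: hc.
  have H1 : tau * w <= hilb (h x) (h am) (h ap).
    rewrite tc_hilb_h; apply: ler_pM => //; [exact: ltW|exact: ltW|exact: dhlift_ge].
  move: H1; rewrite hilbE ler_pdivlMr ?mulr_gt0// => H1.
  by apply: le_trans H1; rewrite mulrC.
have := tc_W_le (phi x); rewrite -[(sin _)^-1]mul1r ler_pdivlMr// => Wle.
have := ler_wpM2l (ltW c10) Wle; lra.
Qed.

(** By the chord identity the product is the square of d sin e / sin (d e), where e = (h(ap) -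
    h(am)) / 2 and d e = (ap - am) / 2 < pi; and sin (d e) < d sin e. *)
Lemma tc_multiplier : 1 < d%:R * dhlift b am * (d%:R * dhlift b ap).
Proof.
have [s1 s2] := tc_sin_gt0; have [h0 h12 ah dh apth] := tc_hlift.
have [b1 d2 db a0 a12 tpi e1 e2] := T.
have dR : 2 <= d%:R :> R by rewrite ler_nat.
pose e := (h ap - h am) / 2; rewrite -/e in s2 *.
have de : (ap - am) / 2 = d%:R * e by rewrite tc_half_d.
have e0 : 0 < e by rewrite /e; lra.
have lt : sin ((ap - am) / 2) < d%:R * sin e.
  have e2d : 2 * e <= d%:R * e by rewrite ler_pM2r.
  have s2e : sin (2 * e) < 2 * sin e.
    have -> : 2 * e = e + e by ring.
    rewrite sinD; have : cos e < 1.
      by rewrite -cos0 ltr_cos ?in_itv/=; lra.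
    move=> ce; have := mulr_gt0 s2 (_ : 0 < 1 - cos e); rewrite subr_gt0 => /(_ ce).
    rewrite -/e; lra.
  have := @sin_concave R (2 * e) (d%:R * e) _ e2d _.
  move=> /(_ _ _) H; have {}H : 2 * e * sin (d%:R * e) <= d%:R * e * sin (2 * e).
    by apply: H; lra.
  rewrite de -(ltr_pM2l e0); nra.
have := sin_hlift_sub b1 ap am; rewrite -/e => se.
have N1 := nrm_gt0 b1 am; have N2 := nrm_gt0 b1 ap.
have k0 : 0 < b ^+ 2 - 1 by nra.
have {}se : sin e * (nrm b ap * nrm b am) = (b ^+ 2 - 1) * sin ((ap - am) / 2).
  by rewrite se divfK// gt_eqF// mulr_gt0.
have key : nrm b ap * nrm b am < d%:R * (b ^+ 2 - 1).
  rewrite -(ltr_pM2l s2) se.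
  have l2 : (b ^+ 2 - 1) * sin ((ap - am) / 2) < (b ^+ 2 - 1) * (d%:R * sin e) by rewrite ltr_pM2l.
  lra.
rewrite /dhlift -!nrm_sq//.
have -> : d%:R * ((b ^+ 2 - 1) / nrm b am ^+ 2) * (d%:R * ((b ^+ 2 - 1) / nrm b ap ^+ 2)) =
  (d%:R * (b ^+ 2 - 1) / (nrm b ap * nrm b am)) ^+ 2 by field; rewrite !gt_eqF.
apply: exprn_egt1 => //.
by rewrite ltr_pdivlMr ?mulr_gt0// mul1r.
Qed.

End TwoCycle.

(** * Points that f_d sends into (am, ap): the letters k < d *)

Section GapStep.
Variables (R : realType) (d : nat) (b th am ap : R).
Hypothesis T : two_cycle d b th am ap.

Local Notation h := (hlift b).
Local Notation tau := ((b - 1) / (b + 1)).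
Local Notation W x := (hilb x am ap).
Local Notation phi x := (th - d%:R * h x).
Local Notation HA := (tc_half_angles T).
Local Notation K := (ha_K tau (d%:R * (h am / 2)) (d%:R * (h ap / 2))).
Local Notation nu := (ha_nu (am / 2) (ap / 2) (h am / 2) (h ap / 2)).
Local Notation gap := (ha_gap d tau (am / 2) (ap / 2) (d%:R * (h am / 2)) (th / 2)).

(** h (pi + 2 q) / 2 has sine (b - 1) cos q / nrm and cosine - (b + 1) sin q / nrm, whence the two
    factors of K. *)
Lemma tc_hilb_K q : hilb (h (pi + 2 * q)) (d%:R * h am) (d%:R * h ap) =
  dhlift b (pi + 2 * q) * K q / (tau * sin ((ap - am) / 2)).
Proof.
have [s1 s2] := tc_sin_gt0 T; have b1 := tc_b T.
have N0 : nrm b (pi + 2 * q) != 0 by rewrite gt_eqF ?nrm_gt0.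
have B1 : b + 1 != 0 by rewrite gt_eqF//; lra.
have B2 : b - 1 != 0 by rewrite gt_eqF//; lra.
have s0 : sin ((ap - am) / 2) != 0 by rewrite gt_eqF.
have sE x : sin ((h (pi + 2 * q) - d%:R * x) / 2) = (b + 1) / nrm b (pi + 2 * q) *
    (tau * cos q * cos (d%:R * (x / 2)) + sin q * sin (d%:R * (x / 2))).
  have -> : (h (pi + 2 * q) - d%:R * x) / 2 = h (pi + 2 * q) / 2 - d%:R * (x / 2) by field.
  rewrite sinB sin_half_hlift// cos_half_hlift//.
  have -> : (pi + 2 * q) / 2 = q + pi / 2 by field.
  rewrite sinDpihalf cosDpihalf; field.
  by rewrite ?N0 ?B1.
rewrite /hilb !sE /ha_K.
have -> : (d%:R * h ap - d%:R * h am) / 2 = (ap - am) / 2.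
  by rewrite -(tc_half_d T); field.
rewrite /dhlift -nrm_sq//; field.
by rewrite ?N0 ?B1 ?B2 ?s0.
Qed.

Lemma tc_nu_sin : nu * sin ((h ap - h am) / 2) = tau * sin ((ap - am) / 2).
Proof.
have := ha_nu_sin HA.
by rewrite -mulrBl -[X in _ = _ * sin X -> _]mulrBl.
Qed.

(** The bound 4 turns the additive margin of K into a factor: (1 + gap / 4) K <= K + gap. *)
Lemma ha_K_bound q : 0 <= q -> q <= pi / 2 -> 0 <= K q /\ K q <= 4.
Proof.
move=> q0 qpi; have hp := @pi_gt0 R.
have [k1 k2 k3 k4 k5 k6 k7 k8 k9 k10 k11 k12 k13 k14 k15] := HA.
have [dR ht _ dc] := ha_basic HA.
have sq : 0 <= sin q by apply: sin_ge0; lra.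
have cq : 0 <= cos q by apply: cos_ge0_pihalf; lra.
have fac x : 0 <= x -> x <= pi / 2 -> 0 <= tau * cos q * cos x + sin q * sin x <= 2.
  move=> x0 xpi.
  have sx : 0 <= sin x by apply: sin_ge0; lra.
  have cx : 0 <= cos x by apply: cos_ge0_pihalf; lra.
  have a1 := sin_le1 q; have a2 := cos_le1 q; have a3 := sin_le1 x; have a4 := cos_le1 x.
  have m1 : 0 <= cos q * cos x <= 1 by rewrite mulr_ge0//= mulr_ile1.
  have m2 : 0 <= sin q * sin x <= 1 by rewrite mulr_ge0//= mulr_ile1.
  move: m1 m2; rewrite -mulrA; set u := cos q * cos x; set v := sin q * sin x => m1 m2.
  nra.
have x10 : 0 <= d%:R * (h am / 2) by apply: mulr_ge0; lra.
have x20 : 0 <= d%:R * (h ap / 2) by apply: mulr_ge0; lra.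
have x1p : d%:R * (h am / 2) <= pi / 2 by lra.
have x2p : d%:R * (h ap / 2) <= pi / 2 by lra.
have /andP[f1 f2] := fac _ x10 x1p; have /andP[g1 g2] := fac _ x20 x2p.
rewrite /ha_K; split; first exact: mulr_ge0.
have -> : 4 = 2 * 2 :> R by ring.
exact: ler_pM.
Qed.

(* The factor gained by the letter k when h x = s0 modulo 2 pi. *)
Lemma tc_gap_step k x p q (y1 y2 : R) : (0 < k)%N -> (k < d)%N ->
  0 <= q -> q <= pi / 2 ->
  (exists n : int, th - k%:R * h x = pi + 2 * q + 2 * pi * n%:~R) ->
  hilb (h x) (h am) (h ap) = sin (p - y1) * sin (p - y2) / sin ((h ap - h am) / 2) ->
  K q + gap <= k%:R * (nu * (sin (p - y1) * sin (p - y2))) ->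
  [/\ gap / (d%:R * sin ((ap - am) / 2)) <= W x, 0 <= W (flift d b th k x) &
    (1 + gap / 4) * W (flift d b th k x) <= dflift d b th k x * W x].
Proof.
move=> k0 kd q0 qpi [n tE] sE main.
have [s1 s2] := tc_sin_gt0 T; have b1 := tc_b T; have [t0 dt] := tc_tau T.
have [K0 K4] := ha_K_bound q0 qpi.
have g0 := ha_gap_gt0 HA.
have nu0 := ha_nu_gt0 HA.
have kR : 0 < k%:R :> R by rewrite ltr0n.
have dR : 0 < d%:R :> R by rewrite ltr0n (ltn_trans k0 kd).
set G := nu * (sin (p - y1) * sin (p - y2)) in main.
have WG : dhlift b x * W x = G / (tau * sin ((ap - am) / 2)).
  rewrite -(tc_hilb_h T) sE -tc_nu_sin /G; field.
  by rewrite !gt_eqF.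
have kdn : (k == d) = false by rewrite ltn_eqF.
have WF : W (flift d b th k x) = dhlift b (th - k%:R * h x) * K q / (tau * sin ((ap - am) / 2)).
  rewrite /flift kdn (tc_W_th T) tE hlift_int// hilb_int tc_hilb_K dhlift_int//.
have ts0 : 0 < tau * sin ((ap - am) / 2) by rewrite mulr_gt0.
have dh0 := dhlift_gt0 b1 (th - k%:R * h x).
split.
- have G1 : gap <= d%:R * G.
    have G0 : 0 <= G by rewrite -(pmulr_rge0 _ kR); lra.
    have : k%:R * G <= d%:R * G by rewrite ler_wpM2r// ler_nat ltnW.
    lra.
  have dhx := dhlift_gt0 b1 x.
  rewrite -(ler_pM2l dhx) WG ler_pdivlMr//.
  have -> : dhlift b x * (gap / (d%:R * sin ((ap - am) / 2))) * (tau * sin ((ap - am) / 2)) =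
    dhlift b x * tau * (gap / d%:R).
    have B1 : b + 1 != 0 by rewrite gt_eqF//; lra.
    have S0 : sin ((ap - am) / 2) != 0 by rewrite gt_eqF.
    have D0 : d%:R != 0 :> R by rewrite gt_eqF.
    by field; rewrite ?B1 ?S0 ?D0.
  have dt1 : dhlift b x * tau <= 1.
    have := dhlift_le b1 x; have bb : 0 < (b + 1) / (b - 1) by apply: divr_gt0; lra.
    have -> : tau = ((b + 1) / (b - 1))^-1 by rewrite invf_div.
    by move=> le1; rewrite ler_pdivrMr ?mul1r.
  have gd : gap / d%:R <= G by rewrite ler_pdivrMr// [G * _]mulrC.
  apply: le_trans gd; apply: ler_piMl => //; apply: divr_ge0; exact: ltW.
- by rewrite WF; apply: divr_ge0 (ltW ts0); apply: mulr_ge0 (ltW dh0) K0.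
- rewrite WF /dflift kdn.
  have -> : k%:R * dhlift b x * dhlift b (th - k%:R * h x) * W x =
    dhlift b (th - k%:R * h x) * (k%:R * (dhlift b x * W x)) by ring.
  rewrite WG.
  have -> : (1 + gap / 4) * (dhlift b (th - k%:R * h x) * K q / (tau * sin ((ap - am) / 2))) =
    dhlift b (th - k%:R * h x) * ((1 + gap / 4) * K q / (tau * sin ((ap - am) / 2))) by ring.
  rewrite ler_pM2l// [leRHS]mulrA ler_pM2r ?invr_gt0//.
  have : gap * K q <= gap * 4 by rewrite ler_wpM2l// ltW.
  lra.
Qed.

(** Let s0 be h x reduced to [h(am), h(am) + 2 pi). Then d s0 lies in the translate of (d h(am), d
    h(ap)) by 2 pi j for some 0 <= j < d, and W x >= 0 excludes j = 0; this keeps s0 away from 0 and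
    2 pi. Let 2 p be the distance from s0 to 0 or to 2 pi, according to the side of pi. Moving from
    th in steps of 2 p, the letter k is the last before - pi, respectively the first from pi on. In
    both cases the image under f_k is pi + 2 q modulo 2 pi with 0 <= q <= p. *)
Lemma tc_gap : exists w kap : R, [/\ 0 < w, 1 < kap &
  forall x, 0 <= W x -> W (phi x) < 0 -> w <= W x /\
    exists k : nat, [/\ (0 < k)%N, (k < d)%N, 0 <= W (flift d b th k x) &
      kap * W (flift d b th k x) <= dflift d b th k x * W x]].
Proof.
have [s1 s2] := tc_sin_gt0 T; have g0 := ha_gap_gt0 HA.
have [b1 d2 db a0 a12 tpi e1 e2] := T.
have [h0 h12 ah dh apth] := tc_hlift T; have hp := @pi_gt0 R.
have dR : 2 <= d%:R :> R by rewrite ler_nat.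
exists (gap / (d%:R * sin ((ap - am) / 2))), (1 + gap / 4); split.
- by rewrite divr_gt0// mulr_gt0//; lra.
- by lra.
move=> x Wx Wphi.
suff [k [k0 kd [w1 w2 w3]]] : exists k : nat, [/\ (0 < k)%N, (k < d)%N &
  [/\ gap / (d%:R * sin ((ap - am) / 2)) <= W x, 0 <= W (flift d b th k x) &
    (1 + gap / 4) * W (flift d b th k x) <= dflift d b th k x * W x]].
  by split => //; exists k.
have [n /andP[sn1 sn2]] := reduce_mod2pi (h x) (h am).
set s0 := h x + 2 * pi * n%:~R in sn1 sn2.
have Hs0 : 0 <= hilb s0 (h am) (h ap).
  by rewrite hilb_int (tc_hilb_h T) mulr_ge0// ltW// dhlift_gt0.
have Hds0 : hilb (d%:R * s0) (d%:R * h am) (d%:R * h ap) < 0.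
  have -> : d%:R * s0 = d%:R * h x + 2 * pi * (n *+ d)%:~R.
    by rewrite /s0 mulrDr rmorphMn /= -mulr_natl; ring.
  by rewrite hilb_int -(tc_W_phi T).
(* the component index j of the gap containing s0 *)
pose j := Num.floor (d%:R * (s0 - h am) / (2 * pi)).
have /andP[j1 j2] := Num.Theory.floor_itv (d%:R * (s0 - h am) / (2 * pi)).
rewrite -/j in j1 j2.
rewrite ler_pdivlMr ?mulr_gt0// in j1; rewrite intrD ltr_pdivrMr ?mulr_gt0// in j2.
pose v := d%:R * s0 + 2 * pi * (- j)%:~R.
have vE : v = d%:R * s0 - 2 * pi * j%:~R by rewrite /v mulrNz mulrN.
have Hv : hilb v (d%:R * h am) (d%:R * h ap) < 0 by rewrite /v hilb_int.
have v1 : 0 <= (v - d%:R * h am) / 2 < pi.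
  rewrite vE; apply/andP; split; lra.
have sde : (d%:R * h ap - d%:R * h am) / 2 = (ap - am) / 2 by rewrite ah; ring.
rewrite /hilb sde in Hv.
have vlt : v < d%:R * h ap.
  rewrite ltNge; apply/negP => vge; move: Hv; rewrite ltNge => /negP; apply.
  by apply: divr_ge0; [apply: mulr_ge0; apply: sin_ge0|exact: ltW]; lra.
have j0 : (0 < j)%R.
  rewrite ltNge; apply/negP => jle.
  have j00 : j%:~R <= 0 :> R by rewrite -(ler_int R) in jle.
  have jz : j%:~R = 0 :> R.
    apply/eqP; rewrite eq_le j00 /=.
    have : 0 <= d%:R * (s0 - h am) by apply: mulr_ge0; lra.
    have := j2 => j2' H.
    have jgt : (-1 : R) < j%:~R by nra.
    have : (- 1 < j)%R by rewrite -(ltr_int R) rmorphN1.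
    by rewrite -lezD1 addNr ler0z.
  rewrite vE jz mulr0 subr0 ltr_pM2l in vlt; last by lra.
  move: Hs0; rewrite /hilb leNgt => /negP; apply.
  have sneq : s0 != h am.
    apply/eqP => s0h; move: Hv; rewrite vE jz mulr0 subr0 s0h subrr mul0r sin0 !mul0r ltxx.
    by [].
  have sgt : h am < s0 by rewrite lt_neqAle eq_sym sneq.
  have d2h : 2 * (h ap - h am) <= ap - am by rewrite ah ler_wpM2r// subr_ge0 ltW.
  have A1 : 0 < sin ((s0 - h am) / 2) by apply: sin_gt0; lra.
  have A2 : sin ((s0 - h ap) / 2) < 0.
    have -> : (s0 - h ap) / 2 = - ((h ap - s0) / 2) by field.
    by rewrite sinN oppr_lt0; apply: sin_gt0; lra.
  by rewrite ltr_pdivrMr// mul0r pmulr_rlt0.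
have jR1 : 1 <= j%:~R :> R by rewrite ler1z -gtz0_ge1.
have jRd : j%:~R <= d%:R - 1 :> R.
  have jd : (j < d%:Z)%R.
    rewrite -(ltr_int R) -pmulrn; have : d%:R * (s0 - h am) < d%:R * (2 * pi) by rewrite ltr_pM2l; lra.
    nra.
  by rewrite -lezD1 -(ler_int R) intrD -pmulrn in jd; lra.
have vgt : d%:R * h am < v.
  rewrite lt_neqAle; apply/andP; split; last by lra.
  by apply/eqP => vh; move: Hv; rewrite -vh subrr mul0r sin0 !mul0r ltxx.
have lo : 2 * pi + d%:R * h am < d%:R * s0 by have := vgt; rewrite vE; nra.
have hi : d%:R * s0 < 2 * pi * (d%:R - 1) + d%:R * h ap by have := vlt; rewrite vE; nra.
have dam : 0 <= d%:R * h am by apply: mulr_ge0; lra.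
have s0h : hilb (h x) (h am) (h ap) = hilb s0 (h am) (h ap) by rewrite hilb_int.
have [s0pi|s0pi] := leP s0 pi.
- (* s0 <= pi: the last k with th - k s0 >= - pi *)
  pose P k := k%:R * s0 <= pi + th.
  have P1 : P 1%N by rewrite /P mul1r; lra.
  have Pd k : P k -> (k <= d)%N.
    rewrite /P => Pk; rewrite leqNgt; apply/negP => dk.
    have : d%:R * s0 <= k%:R * s0 by apply: ler_wpM2r; [nra|rewrite ler_nat ltnW].
    lra.
  have [k Pk kmax] := ex_maxnP (ex_intro P 1%N P1) Pd.
  have k0 : (0 < k)%N by exact: kmax.
  have kd : (k < d)%N.
    rewrite ltn_neqAle Pd// andbT; apply/eqP => kd; move: Pk; rewrite /P kd; lra.
  have Pk1 : pi + th < (k%:R + 1) * s0.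
    by rewrite natr1 ltNge; apply/negP => /kmax; rewrite ltnn.
  rewrite /P in Pk.
  exists k; split => //.
  pose p := s0 / 2; pose q := (pi + th - k%:R * s0) / 2.
  have q0 : 0 <= q by rewrite /q; lra.
  have qp : q <= p by rewrite /q /p; lra.
  have ppi : p <= pi / 2 by rewrite /p; lra.
  apply: (@tc_gap_step k x p q (h am / 2) (h ap / 2)) => //; first by lra.
  (* The -1 passes from - pi + 2 q to pi + 2 q. *)
  + exists (n *+ k - 1); rewrite /q /s0 rmorphB rmorphMn /= -mulr_natl; lra.
  + rewrite s0h /hilb /p; congr (sin _ * sin _ / _); lra.
  + have qE : q = pi / 2 + th / 2 - k%:R * p by rewrite /q /p; lra.
    have [k1|k1] := ltnP 1 k; first exact: (ha_pos2 HA).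
    have {}k1 : k = 1%N by apply/eqP; rewrite eqn_leq k1.
    rewrite k1 mul1r in qE; rewrite k1 mul1r.
    have pE : pi / d%:R + h am / 2 <= p.
      rewrite -(ler_pM2l (_ : 0 < d%:R)) ?mulrDr; last by lra.
      have -> : d%:R * (pi / d%:R) = pi :> R by field; lra.
      rewrite /p; lra.
    apply: (ha_pos1 HA) => //.
    (* For d = 2 the lower bound [lo] would give s0 > pi. *)
    rewrite ltn_neqAle d2 andbT; apply/eqP => d2E; rewrite -d2E in lo; lra.
- (* s0 > pi: the first k >= 1 with th + k (2 pi - s0) >= pi *)
  pose sg := 2 * pi - s0.
  have sgE : s0 = 2 * pi - sg by rewrite /sg; lra.
  have dhap : d%:R * h ap <= th by lra.
  have sgpi : sg < pi by rewrite /sg; lra.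
  have dsg : 2 * pi - th <= d%:R * sg by rewrite /sg; lra.
  have sg0 : 0 < sg by nra.
  pose P k := (0 < k)%N && (pi <= th + k%:R * sg).
  have Pd1 : P d.-1.
    rewrite /P -subn1 subn_gt0 d2 natrB ?(ltnW d2)//=; lra.
  have [k /andP[k0 Pk] kmin] := ex_minnP (ex_intro P d.-1 Pd1).
  have kd : (k < d)%N.
    have := kmin _ Pd1 => kd1; apply: leq_ltn_trans kd1 _; rewrite ltn_predL ltnW//.
  exists k; split => //.
  pose p := sg / 2; pose q := (th + k%:R * sg - pi) / 2.
  have q0 : 0 <= q by rewrite /q; lra.
  have ppi : p <= pi / 2 by rewrite /p; lra.
  have kq : q <= p /\ ((1 < k)%N \/ p - q = pi / 2 - th / 2).
    have [k1|k1] := ltnP 1 k.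
      split; last by left.
      have : ~~ P k.-1 by apply/negP => /kmin; rewrite leqNgt ltn_predL k0.
      rewrite /P -subn1 subn_gt0 k1 natrB//= -ltNge /q /p; lra.
    have {}k1 : k = 1%N by apply/eqP; rewrite eqn_leq k1.
    by rewrite /q /p k1 mul1r; split; [lra|right; lra].
  have [qp kq'] := kq.
  apply: (@tc_gap_step k x p q (- (h am / 2)) (- (h ap / 2))) => //; first by lra.
  + exists (n *+ k - k%:Z); rewrite /q /sg /s0 rmorphB rmorphMn /= -mulr_natl -pmulrn; lra.
  + rewrite s0h sgE -(hilb_int _ _ _ (-1)) rmorphN1 /hilb /p.
    have -> : (2 * pi - sg + 2 * pi * -1 - h am) / 2 = - (sg / 2 + h am / 2) by field.
    have -> : (2 * pi - sg + 2 * pi * -1 - h ap) / 2 = - (sg / 2 + h ap / 2) by field.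
    by rewrite !sinN mulrNN !opprK.
  + rewrite !opprK; apply: (ha_neg HA) => //.
    rewrite /p ler_pdivrMr ?mulr_gt0//; [nra|lra].
Qed.

End GapStep.

Lemma exprn_unbounded (R : realType) (k M : R) : 1 < k -> exists N, M < k ^+ N.
Proof.
move=> k1; have k0 : 0 < k - 1 by lra.
have bern N : 1 + N%:R * (k - 1) <= k ^+ N.
  elim: N => [|N IH]; first by rewrite mul0r addr0 expr0.
  rewrite exprS -natr1.
  have := ler_wpM2l (ltW (lt_trans ltr01 k1)) IH.
  have N0 : 0 <= N%:R * (k - 1) ^+ 2 :> R by rewrite mulr_ge0 ?sqr_ge0.
  lra.
have M0 : 0 <= `|M| / (k - 1) by rewrite divr_ge0// ltW.
exists (Num.bound (`|M| / (k - 1))); apply: lt_le_trans (bern _).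
have := Num.Theory.archi_boundP M0; rewrite ltr_pdivrMr// => H.
have := ler_norm M; lra.
Qed.

(** * Unbounded derivatives along a well chosen word *)

Section Growth.
Variables (R : realType) (d : nat) (b th am ap : R).
Hypothesis T : two_cycle d b th am ap.

Local Notation h := (hlift b).
Local Notation W x := (hilb x am ap).
Local Notation phi x := (th - d%:R * h x).
Local Notation fl := (flift d b th).
Local Notation dfl := (dflift d b th).

Local Notation P x := (d%:R * dhlift b x * (d%:R * dhlift b (phi x))).

Lemma continuous_P : continuous (fun x => P x).
Proof.
move=> x; apply: cvgM; first by apply: cvgM; [exact: cvg_cst|exact: (@continuous_dhlift _ _ (tc_b T))].
apply: cvgM; first exact: cvg_cst.
by apply: (@continuous_comp _ _ _ (fun x => phi x) (dhlift b)); [exact: (@continuous_sub_hlift _ _ (tc_b T) th d x)|exact: (@continuous_dhlift _ _ (tc_b T))].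
Qed.

Lemma P_int x (n : int) : P (x + 2 * pi * n%:~R) = P x.
Proof.
have b1 := tc_b T; rewrite dhlift_int// hlift_int//.
have -> : phi x = th - d%:R * (h x + 2 * pi * n%:~R) + 2 * pi * (n *+ d)%:~R.
  by rewrite rmorphMn /= -mulr_natl; ring.
by rewrite dhlift_int.
Qed.

(** A small nonnegative W forces x to be close to am or ap modulo 2 pi, where the derivative of the
    second iterate exceeds 1 by [tc_multiplier] and continuity. *)
Lemma tc_near_cycle : exists w kap : R, [/\ 0 < w, 1 < kap &
  forall x, 0 <= W x -> W x < w -> kap <= P x].
Proof.
have hp := @pi_gt0 R.
have [s1 s2] := tc_sin_gt0 T; have [b1 d2 db a0 a12 tpi e1 e2] := T.
have [h0 h12 ah dh apth] := tc_hlift T.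
have Pam : 1 < P am by rewrite e1; exact: tc_multiplier T.
have Pap : 1 < P ap by rewrite e2 mulrC; exact: tc_multiplier T.
have PE : P ap = P am by rewrite e1 e2 mulrC.
pose kap := (1 + P am) / 2.
have kapP : 1 < kap < P am by rewrite /kap; apply/andP; split; lra.
have nbh a : P a = P am -> exists2 e, 0 < e & forall x, `|a - x| < e -> kap < P x.
  move=> Pa; have : \forall x \near a, kap < P x.
    by apply: (cvgr_gt (P a) (continuous_P (x := a))); rewrite Pa; case/andP: kapP.
  by move=> /nbhs_ballP[e /= e0 He]; exists e => // x xe; exact: He.
have [ea ea0 Ha] := nbh am erefl.
have [ep ep0 Hp] := nbh ap PE.
pose e := Num.min (Num.min ea ep) (pi / 2).
have e0 : 0 < e by rewrite !lt_min ea0 ep0/= divr_gt0.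
have eea : e <= ea by rewrite !ge_min lexx.
have eep : e <= ep by rewrite !ge_min lexx orbT.
have epi : e <= pi / 2 by rewrite !ge_min lexx orbT.
have se : 0 < sin (e / 2) by apply: sin_gt0; lra.
exists (sin (e / 2) ^+ 2 / sin ((ap - am) / 2)), kap; split.
- by rewrite divr_gt0// exprn_gt0.
- by case/andP: kapP.
move=> x Wx Wxw.
have [n /andP[y1 y2]] := reduce_mod2pi x am.
rewrite -(hilb_int _ _ _ n) in Wx Wxw; rewrite -(P_int _ n).
set y := x + 2 * pi * n%:~R in y1 y2 Wx Wxw *.
have [ya|ya] := ltP `|am - y| ea; first by rewrite ltW// Ha.
have [yp|yp] := ltP `|ap - y| ep; first by rewrite ltW// Hp.
(* y may also be close to am + 2 pi, the right end of the fundamental interval. *)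
have [yq|yq] := ltP `|am - (y - 2 * pi)| ea.
  rewrite -(P_int y (-1)) ltW// Ha//.
  by have -> : y + 2 * pi * (-1)%:~R = y - 2 * pi by rewrite rmorphN1; ring.
exfalso.
have ya' : e <= y - am.
  by move: ya; rewrite distrC ger0_norm; lra.
have yq' : e <= am + 2 * pi - y.
  by move: yq; rewrite ger0_norm; lra.
have S1 : sin (e / 2) <= sin ((y - am) / 2).
  have [ylo|yhi] := leP ((y - am) / 2) (pi / 2); first by apply: sin_le; lra.
  have -> : (y - am) / 2 = pi - (2 * pi + am - y) / 2 by field.
  by rewrite sinB sinpi cospi mul0r mulN1r opprK add0r; apply: sin_le; lra.
have yap : ap <= y.
  rewrite leNgt; apply/negP => yltap; move: Wx; rewrite leNgt => /negP; apply.
  rewrite /hilb ltr_pdivrMr// mul0r pmulr_rlt0; last by lra.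
  have -> : (y - ap) / 2 = - ((ap - y) / 2) by field.
  by rewrite sinN oppr_lt0; apply: sin_gt0; lra.
have yp' : e <= y - ap.
  by move: yp; rewrite distrC ger0_norm; lra.
have S2 : sin (e / 2) <= sin ((y - ap) / 2).
  have [ylo|yhi] := leP ((y - ap) / 2) (pi / 2); first by apply: sin_le; lra.
  have -> : (y - ap) / 2 = pi - (2 * pi + ap - y) / 2 by field.
  by rewrite sinB sinpi cospi mul0r mulN1r opprK add0r; apply: sin_le; lra.
move: Wxw; rewrite /hilb ltr_pM2r ?invr_gt0// ltNge => /negP; apply.
by rewrite expr2; apply: ler_pM => //; exact: ltW.
Qed.

(* Schwarz's lemma on arcs: the covers contract the Hilbert metric of a short arc. *)
Lemma hilb_natmul_norm (k : nat) (x p q : R) : (0 < k)%N -> p < x -> x < q -> k%:R * (q - p) < 2 * pi ->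
  k%:R * `|hilb x p q| <= `|hilb (k%:R * x) (k%:R * p) (k%:R * q)|.
Proof.
move=> k0 px xq kpq; have hp := @pi_gt0 R.
have kR : 1 <= k%:R :> R by rewrite ler1n.
have le := hilb_natmul_le x k0 (lt_trans px xq) kpq.
have pq2 : q - p < 2 * pi by apply: le_lt_trans kpq; rewrite ler_peMl//; lra.
have neg : hilb x p q <= 0.
  rewrite /hilb; have -> : (x - q) / 2 = - ((q - x) / 2) by field.
  rewrite sinN mulrN mulNr oppr_le0.
  by apply: divr_ge0; [apply: mulr_ge0|]; apply: sin_ge0; lra.
have kneg : k%:R * hilb x p q <= 0 by rewrite mulr_ge0_le0//; lra.
rewrite (ler0_norm neg) (ler0_norm (le_trans le kneg)) mulrN lerN2.
exact: le.
Qed.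

Lemma hilb_hlift_norm x p q : `|hilb (h x) (h p) (h q)| = dhlift b x * `|hilb x p q|.
Proof.
have b1 := tc_b T.
have [s0|s0] := eqVneq (sin ((q - p) / 2)) 0; last first.
  by rewrite hilb_hlift// normrM ger0_norm// ltW// dhlift_gt0.
(* In the degenerate case both sides are 0, by the convention 0^-1 = 0. *)
rewrite /hilb (sin_hlift_sub b1 q p) s0.
by rewrite !(mulr0, mul0r, invr0, normr0).
Qed.

Lemma hilb_refl_norm (t x p q : R) : `|hilb (t - x) (t - p) (t - q)| = `|hilb x p q|.
Proof. by rewrite hilb_swap hilb_refl normrN. Qed.

Lemma flift_hilb k (x p q : R) : (0 < k <= d)%N -> p < x -> x < q ->
  d%:R * ((b + 1) / (b - 1) * (q - p)) < 2 * pi ->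
  dfl k x * `|hilb x p q| <= `|hilb (fl k x) (fl k p) (fl k q)|.
Proof.
move=> /andP[k0 kd] px xq dpq; have b1 := tc_b T.
have kpq : k%:R * (h q - h p) < 2 * pi.
  apply: le_lt_trans dpq; apply: ler_pM => //.
  - by rewrite subr_ge0 hlift_le// ltW// (lt_trans px).
  - by rewrite ler_nat.
  - by apply: hlift_lip => //; rewrite ltW// (lt_trans px).
have main := hilb_natmul_norm k0 (hlift_lt b1 px) (hlift_lt b1 xq) kpq.
rewrite hilb_hlift_norm in main.
rewrite /fl /dfl; case: eqP => [kdE|_].
  by rewrite hilb_refl_norm -mulrA -kdE.
rewrite hilb_refl_norm hilb_hlift_norm hilb_refl_norm.
have -> : k%:R * dhlift b x * dhlift b (th - k%:R * h x) * `|hilb x p q| =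
  dhlift b (th - k%:R * h x) * (k%:R * (dhlift b x * `|hilb x p q|)) by ring.
by rewrite ler_pM2l// dhlift_gt0.
Qed.

Lemma flift_mono k (x y : R) : (0 < k <= d)%N -> x < y ->
  if k == d then fl k y < fl k x else fl k x < fl k y.
Proof.
move=> /andP[k0 kd] xy; have b1 := tc_b T.
have kR : 0 < k%:R :> R by rewrite ltr0n.
have hxy : k%:R * h x < k%:R * h y by rewrite ltr_pM2l// hlift_lt.
rewrite /fl; case: eqP => [kE|_]; first by rewrite -kE; lra.
have : h (th - k%:R * h y) < h (th - k%:R * h x) by apply: hlift_lt => //; lra.
lra.
Qed.

(** Both orders of the endpoints are allowed, since the letter d exchanges them. *)
Definition between (x p q : R) := (p < x < q) || (q < x < p).

Lemma flift_between k (x p q : R) : (0 < k <= d)%N -> between x p q -> between (fl k x) (fl k p) (fl k q).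
Proof.
move=> kd; rewrite /between.
case/orP => /andP[u v]; have := flift_mono kd u; have := flift_mono kd v.
all: by case: eqP => _ -> ->; rewrite ?orbT.
Qed.

Lemma flift_hilb_between k (x p q : R) : (0 < k <= d)%N -> between x p q ->
  d%:R * ((b + 1) / (b - 1) * `|q - p|) < 2 * pi ->
  dfl k x * `|hilb x p q| <= `|hilb (fl k x) (fl k p) (fl k q)|.
Proof.
move=> kd /orP[] /andP[u v] H.
  by apply: flift_hilb => //; rewrite ger0_norm// in H; rewrite subr_ge0 ltW// (lt_trans u).
rewrite hilb_swap normrN [X in _ <= `|X|]hilb_swap normrN.
apply: flift_hilb => //; rewrite distrC ger0_norm// in H.
by rewrite subr_ge0 ltW// (lt_trans u).
Qed.

Lemma dflift_gt0 k (x : R) : (0 < k)%N -> 0 < dfl k x.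
Proof.
move=> k0; have b1 := tc_b T; have kR : 0 < k%:R :> R by rewrite ltr0n.
have dR : 0 < d%:R :> R by rewrite ltr0n; exact: ltnW (tc_d T).
have dh y : 0 < dhlift b y by exact: dhlift_gt0.
rewrite /dflift; case: ifP => _; apply: mulr_gt0 => //; exact: mulr_gt0.
Qed.

(** As long as the images of [p, q] stay short, Schwarz's lemma applies at each letter: the
    derivative times [hilb] at x is at most [hilb] of the image, and inside a short arc that is at
    most 1 in absolute value. *)
Lemma flift_seq_derivative_bound (w : nat -> nat) (x p q eta : R) :
  (forall n, (0 < w n <= d)%N) -> p < x -> x < q ->
  d%:R * ((b + 1) / (b - 1) * eta) < 2 * pi -> eta <= pi / 2 ->
  (forall n, `|flift_seq d b th w n q - flift_seq d b th w n p| <= eta) ->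
  forall n, dflift_seq d b th w n x * `|hilb x p q| <= 1.
Proof.
move=> wd px xq eta1 eta2 small n; have b1 := tc_b T; have hp := @pi_gt0 R.
have bb : 0 < (b + 1) / (b - 1) by apply: divr_gt0; lra.
have dR : 0 < d%:R :> R by rewrite ltr0n; exact: ltnW (tc_d T).
have bet m : between (flift_seq d b th w m x) (flift_seq d b th w m p) (flift_seq d b th w m q).
  elim: m => [|m IH] /=; first by rewrite /between px xq.
  exact: flift_between.
have grow m : dflift_seq d b th w m x * `|hilb x p q| <=
  `|hilb (flift_seq d b th w m x) (flift_seq d b th w m p) (flift_seq d b th w m q)|.
  elim: m => [|m IH] /=; first by rewrite mul1r.
  apply: le_trans (flift_hilb_between (wd m) (bet m) _).
    rewrite -mulrA ler_pM2l//; apply: dflift_gt0; by case/andP: (wd m).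
  by apply: le_lt_trans eta1; rewrite ler_pM2l// ler_pM2l.
apply: le_trans (grow n) _.
have := small n; move: (bet n).
set X := flift_seq _ _ _ _ _ x; set Pn := flift_seq _ _ _ _ _ p; set Q := flift_seq _ _ _ _ _ q.
have gen (u v y : R) : u < y -> y < v -> v - u <= pi / 2 -> `|hilb y u v| <= 1.
  move=> uy yv uv.
  have S : 0 < sin ((v - u) / 2) by apply: sin_gt0; lra.
  rewrite /hilb normrM normfV (gtr0_norm S) ler_pdivrMr// mul1r normrM.
  have A1 : `|sin ((y - u) / 2)| <= sin ((v - u) / 2).
    by rewrite ger0_norm; [apply: sin_le|apply: sin_ge0]; lra.
  apply: le_trans A1; rewrite ler_piMr//; exact: sin_max.
case/orP => /andP[u v] H.
  by apply: gen => //; move: H; rewrite ger0_norm; lra.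
by rewrite hilb_swap normrN; apply: gen => //; move: H; rewrite distrC ger0_norm; lra.
Qed.

Lemma expanding_word x : 0 <= W x -> exists2 w : nat -> nat,
  (forall n, (0 < w n <= d)%N) & forall M, exists n, M < dflift_seq d b th w n x.
Proof.
move=> Wx.
have [s1 s2] := tc_sin_gt0 T; have b1 := tc_b T; have d2 := tc_d T.
have [w1 [k1 [w10 k11 gapP]]] := tc_gap T.
have [w2 [k2 [w20 k21 nearP]]] := tc_near_cycle.
pose w0 := Num.min w1 w2.
have w00 : 0 < w0 by rewrite lt_min w10.
have [k3 k31 expP] := tc_expand T w00.
pose good y k := (0 < k)%N && (k < d)%N && (0 <= W (fl k y)) && (k1 * W (fl k y) <= dfl k y * W y).
(* By [tc_gap] a good letter exists at every point of the orbit where d is refused, so [xget]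
   returns such a letter and not its default 1. *)
pose letter y : nat := if 0 <= W (phi y) then d else xget 1%N [set k | good y k].
pose orb := fix orb n := if n is n'.+1 then fl (letter (orb n')) (orb n') else x.
pose w n := letter (orb n).
have orbE n : flift_seq d b th w n x = orb n by elim: n => //= n ->.
have letterP y : 0 <= W y -> [/\ (0 < letter y <= d)%N, 0 <= W (fl (letter y) y) &
    if letter y == d then is_true (0 <= W (phi y)) else w0 <= W y /\ k1 * W (fl (letter y) y) <= dfl (letter y) y * W y].
  move=> Wy; rewrite /letter; case: ifPn => [Wphi|]; first by rewrite /fl eqxx leqnn (ltnW d2).
  rewrite -ltNge => Wphi; have [wy [k [a1 a2 a3 a4]]] := gapP y Wy Wphi.
  have : good y (xget 1%N [set k | good y k]).
    by apply: (@xgetPex _ 1%N [set k | good y k]); exists k; rewrite /= /good a1 a2 a3 a4.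
  set l := xget _ _ => /andP[/andP[/andP[l0 ld] Wl] kl].
  split => //; first by rewrite l0 ltnW.
  rewrite ltn_eqF//; split => //; apply: le_trans wy; by rewrite ge_min lexx.
have orbW n : 0 <= W (orb n) by elim: n => //= n IH; have [] := letterP _ IH.
have wd n : (0 < w n <= d)%N by have [] := letterP _ (orbW n).
exists w => //.
pose L n := dflift_seq d b th w n x.
have LS n : L n.+1 = dfl (w n) (orb n) * L n by rewrite /L /= orbE.
have L0 n : 0 < L n.
  by elim: n => [|n IH]; [rewrite /L|rewrite LS mulr_gt0// dflift_gt0//; case/andP: (wd n)].
pose kap := Num.min k1 k3.
have kap1 : 1 < kap by rewrite lt_min k11.
have step n : W (orb n.+1) <= dfl (w n) (orb n) * W (orb n) /\
    (w0 <= W (orb n) -> kap * W (orb n.+1) <= dfl (w n) (orb n) * W (orb n)).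
  have [_ Wn] := letterP _ (orbW n); rewrite -/(w n) => H.
  have orbS : orb n.+1 = fl (w n) (orb n) by [].
  have Wn1 := orbW n.+1.
  move: H; case: eqP => [wE|wE] H.
    have fE : orb n.+1 = phi (orb n) by rewrite orbS wE /fl eqxx.
    have dE : dfl (w n) (orb n) = d%:R * dhlift b (orb n) by rewrite wE /dfl eqxx.
    rewrite fE dE; split; first exact: tc_expand_weak T _.
    move=> wn; apply: le_trans (expP _ wn H); rewrite ler_wpM2r// ge_min lexx orbT.
    by [].
  have [_ H2] := H; rewrite -orbS in H2.
  have H3 : kap * W (orb n.+1) <= dfl (w n) (orb n) * W (orb n).
    by apply: le_trans H2; rewrite ler_wpM2r// ge_min lexx.
  split => //; apply: le_trans H3; rewrite ler_peMl//; exact: ltW.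
pose S0 := sin ((ap - am) / 2).
have [inf|fin] := pselect (forall n, exists2 m, (n <= m)%N & w0 <= W (orb m)).
(* The inequality S0 kap^N W <= L is inherited by all later times, and each visit to W >= w0 raises
   N by one. It starts at N = 0 because W <= 1 / S0. Evaluated at a time when W >= w0, it bounds L
   below by S0 kap^N w0. *)
- have mono N n : S0 * kap ^+ N * W (orb n) <= L n ->
      forall m, (n <= m)%N -> S0 * kap ^+ N * W (orb m) <= L m.
    move=> H m /subnKC <-; elim: (m - n)%N => [|j IHj]; first by rewrite addn0.
    have [st _] := step (n + j)%N; rewrite addnS LS.
    have c0 : 0 <= S0 * kap ^+ N by rewrite mulr_ge0 ?(ltW s1)// exprn_ge0//; lra.
    apply: le_trans (ler_wpM2l c0 st) _.
    by rewrite mulrCA ler_pM2l//; apply: dflift_gt0; case/andP: (wd (n + j)%N).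
  have grow N : exists n, forall m, (n <= m)%N -> S0 * kap ^+ N * W (orb m) <= L m.
    elim: N => [|N [n IH]].
      exists 0%N; apply: mono.
      by rewrite expr0 mulr1 /L /= mulrC -ler_pdivlMr// mul1r; exact: tc_W_le T _.
    have [m nm wm] := inf n.
    exists m.+1; apply: mono; rewrite LS exprS.
    have [_ /(_ wm) st] := step m.
    have c0 : 0 <= S0 * kap ^+ N by rewrite mulr_ge0 ?(ltW s1)// exprn_ge0//; lra.
    have -> : S0 * (kap * kap ^+ N) * W (orb m.+1) = S0 * kap ^+ N * (kap * W (orb m.+1)) by ring.
    apply: le_trans (ler_wpM2l c0 st) _.
    rewrite mulrCA ler_pM2l; last by apply: dflift_gt0; case/andP: (wd m).
    exact: IH.
  move=> M.
  have [N] := exprn_unbounded (M / (S0 * w0)) kap1.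
  rewrite ltr_pdivrMr ?mulr_gt0// => HN.
  have [n Hn] := grow N; have [m nm wm] := inf n.
  exists m; apply: lt_le_trans (Hn m nm); apply: lt_le_trans HN _.
  have c0 : 0 <= S0 * kap ^+ N by rewrite mulr_ge0 ?(ltW s1)// exprn_ge0//; lra.
  have := ler_wpM2l c0 wm; lra.
- have [n0 Hn0] : exists n0, forall m, (n0 <= m)%N -> W (orb m) < w0.
    apply: contrapT => H; apply: fin => n; apply: contrapT => H2; apply: H.
    by exists n => m nm; rewrite ltNge; apply/negP => wm; apply: H2; exists m.
  have wE m : (n0 <= m)%N -> w m = d.
    move=> /Hn0 Wm; have [_ _] := letterP _ (orbW m); rewrite -/(w m).
    by case: eqP => // _ [wm _]; move: Wm; rewrite ltNge wm.
  (* Letters below d occur only where W >= w0, so from n0 on the letter is always d, and two steps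
     multiply L by the derivative of the second iterate of f_d. *)
  have L2 m : (n0 <= m)%N -> k2 * L m <= L m.+2.
    move=> nm; rewrite !LS mulrA ler_pM2r//.
    have -> : orb m.+1 = phi (orb m) by rewrite /= -/(w m) wE// /fl eqxx.
    rewrite !wE// ?(leq_trans nm)// /dfl eqxx [leRHS]mulrC; apply: nearP => //.
    by apply: lt_le_trans (Hn0 m nm) _; rewrite ge_min lexx orbT.
  move=> M.
  have [N] := exprn_unbounded (M / L n0) k21.
  rewrite ltr_pdivrMr// => HN.
  exists (n0 + N.*2)%N; apply: lt_le_trans HN _.
  elim: N => [|N IH]; first by rewrite expr0 mul1r addn0.
  rewrite exprS -mulrA doubleS !addnS.
  apply: le_trans (L2 _ (leq_addr _ _)); rewrite ler_wpM2l//; lra.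
Qed.

End Growth.

(** * The parametrisation of the unit circle *)

Section Cis.
Variable R : realType.
Implicit Types (x y t : R) (z w : R[i]).

Local Notation nc := (@ComplexField.Normc.normc R).

Lemma norm_nc z : `|z| = (nc z)%:C.
Proof. by case: z. Qed.

Lemma cisD x y : cis (x + y) = cis x * cis y.
Proof. by rewrite /cis cosD sinD; simpc; congr (_ +i* _); ring. Qed.

Lemma cis0 : cis 0 = 1 :> R[i].
Proof. by rewrite /cis cos0 sin0. Qed.

Lemma cis_neq0 x : cis x != 0.
Proof.
apply/eqP => c0; have := cisD x (- x).
by rewrite c0 mul0r subrr cis0 => /eqP; rewrite oner_eq0.
Qed.

Lemma cisN x : cis (- x) = (cis x)^-1.
Proof.
apply: (mulfI (cis_neq0 x)).
by rewrite -cisD subrr cis0 divff// cis_neq0.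
Qed.

Lemma cisX x (n : nat) : cis (n%:R * x) = cis x ^+ n.
Proof.
elim: n => [|n IH]; first by rewrite mul0r cis0 expr0.
by rewrite -natr1 mulrDl mul1r cisD IH exprSr.
Qed.

Lemma nc_cis x : nc (cis x) = 1.
Proof. by rewrite /cis /= cos2Dsin2 sqrtr1. Qed.

Lemma norm_cis x : `|cis x| = 1 :> R[i].
Proof. by rewrite norm_nc nc_cis. Qed.

Lemma cis_int x (n : int) : cis (x + 2 * pi * n%:~R) = cis x.
Proof. by rewrite /cis cosD2pi_int sinD2pi_int. Qed.

Lemma nc_cis_sub x y : nc (cis x - cis y) = 2 * `|sin ((x - y) / 2)|.
Proof.
rewrite /cis /=.
have -> : (cos x - cos y) ^+ 2 + (sin x - sin y) ^+ 2 = (2 * sin ((x - y) / 2)) ^+ 2.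
  transitivity (2 - 2 * cos (x - y)).
    rewrite cosB; have := cos2Dsin2 x; have := cos2Dsin2 y; lra.
  by rewrite cos_half; ring.
by rewrite sqrtr_sqr normrM ger0_norm.
Qed.

Lemma cis_inj_mod x y : cis x = cis y -> exists n : int, x = y + 2 * pi * n%:~R.
Proof.
move=> xy; have hp := @pi_gt0 R.
have [n /andP[h1 h2]] := reduce_mod2pi (x - y) (- pi).
have [c1 _] : cis (x - y) = 1 by rewrite cisD cisN xy divff// cis_neq0.
set t := x - y + 2 * pi * n%:~R in h1 h2.
have ct : cos t = 1 by rewrite cosD2pi_int.
have t0 : t = 0.
  have [t0|t0] := leP 0 t.
    by apply: (@cos_inj R); rewrite ?in_itv/= ?cos0//; lra.
  apply: oppr_inj; rewrite oppr0.
  by apply: (@cos_inj R); rewrite ?in_itv/= ?cosN ?cos0//; lra.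
by exists (- n); rewrite rmorphN /=; move: t0; rewrite /t; lra.
Qed.

Lemma cis_surj z : `|z| = 1 -> exists x, z = cis x.
Proof.
case: z => a c; rewrite norm_nc => /complexI /= n1.
have ac : a ^+ 2 + c ^+ 2 = 1.
  have s0 : 0 <= a ^+ 2 + c ^+ 2 by rewrite addr_ge0 ?sqr_ge0.
  by rewrite -(sqr_sqrtr s0) n1 expr1n.
have a1 : -1 <= a <= 1 by apply/andP; split; nra.
have ca : cos (acos a) = a by rewrite acosK.
have sa : sin (acos a) = `|c|.
  by rewrite sin_acos// -ac addrAC subrr add0r sqrtr_sqr.
have [c0|c0] := leP 0 c.
  by exists (acos a); rewrite /cis ca sa ger0_norm.
by exists (- acos a); rewrite /cis cosN sinN ca sa ltr0_norm// opprK.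
Qed.

End Cis.

(** * The maps f_k on the circle and their lifts *)

Section CircleMaps.
Variables (R : realType) (b th : R).
Hypothesis b1 : 1 < b.
Local Notation nc := (@ComplexField.Normc.normc R).

Lemma cis_hlift t : cis (hlift b t) * (cis t + b%:C) = b%:C * cis t + 1.
Proof.
have -> : cis (hlift b t) = cis t * cis (- barg b t) * cis (- barg b t).
  by rewrite -!cisD; congr cis; rewrite /hlift; ring.
have N0 := nrm_gt0 b1 t.
have e1 : cis t + b%:C = (nrm b t)%:C * cis (barg b t).
  by rewrite /cis cos_barg// sin_barg//; simpc; congr (_ +i* _); field; rewrite gt_eqF.
have e2 : cis t * cis (- barg b t) * (nrm b t)%:C = b%:C * cis t + 1.
  rewrite /cis cosN sinN cos_barg// sin_barg//; simpc; congr (_ +i* _).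
    transitivity (b * cos t + (cos t ^+ 2 + sin t ^+ 2)); first by field; rewrite gt_eqF.
    by rewrite cos2Dsin2; ring.
  by field; rewrite gt_eqF.
rewrite e1 -e2.
transitivity (cis t * cis (- barg b t) * (nrm b t)%:C * (cis (- barg b t) * cis (barg b t))).
  by ring.
by rewrite -(cisD (- barg b t) (barg b t)) addNr cis0 mulr1.
Qed.

Lemma cisb_neq0 t : cis t + b%:C != 0.
Proof.
apply/eqP; rewrite /cis; simpc => -[c0 _].
by have := bcos_gt0 b1 t; rewrite addrC c0 ltxx.
Qed.

Lemma bcis_neq0 t : b%:C * cis t + 1 != 0.
Proof. by rewrite -cis_hlift mulf_neq0// ?cis_neq0// cisb_neq0. Qed.

Lemma mobius_cis t : (cis t + b%:C) / (b%:C * cis t + 1) = cis (- hlift b t).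
Proof. by rewrite -cis_hlift cisN invfM mulrCA divff ?mulr1// cisb_neq0. Qed.

Lemma fk_cis k t : fk b (cis th) k (Some (cis t)) = Some (cis (th - k%:R * hlift b t)).
Proof.
rewrite /fk (negbTE (bcis_neq0 t)) mobius_cis -cisX -cisD.
by congr (Some (cis _)); ring.
Qed.

Lemma fhat_cis d k t : fhat d b (cis th) k (Some (cis t)) = Some (cis (flift d b th k t)).
Proof.
rewrite /fhat /flift; case: eqP => _; first by rewrite fk_cis.
by rewrite /comp !fk_cis mul1r.
Qed.

Lemma fhat_seq_cis d w n t :
  fhat_seq d b (cis th) w n (Some (cis t)) = Some (cis (flift_seq d b th w n.+1 t)).
Proof.
elim: n => [|n IH]; first exact: fhat_cis.
by rewrite -[LHS]/(fhat d b (cis th) (w n.+1) (fhat_seq d b (cis th) w n (Some (cis t)))) IH fhat_cis.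
Qed.

(* z |-> (z + b) / (b z + 1) exchanges the two sides of the unit circle. *)
Lemma fk_fixed_on_circle d (p : sphere R) : (0 < d)%N -> fk b (cis th) d p = p ->
  exists t, p = Some (cis t).
Proof.
move=> d0; case: p => [z|] //=; case: eqP => [//|/eqP bz0] [] fz.
suff nz : nc z = 1.
  have z1 : `|z| = 1 by rewrite norm_nc nz.
  by have [t ->] := cis_surj z1; exists t.
have key : nc (z + b%:C) ^+ 2 - nc (b%:C * z + 1) ^+ 2 = (b ^+ 2 - 1) * (1 - nc z ^+ 2).
  case: (z) => x y; rewrite /= !sqr_sqrtr ?addr_ge0 ?sqr_ge0//; ring.
have nfz : nc z = (nc (z + b%:C) / nc (b%:C * z + 1)) ^+ d.
  rewrite -[in LHS]fz ComplexField.Normc.normcM nc_cis mul1r.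
  elim: (d) => [|m IH]; first by rewrite !expr0 ComplexField.Normc.normc1.
  by rewrite !exprS !ComplexField.Normc.normcM ComplexField.Normc.normcV IH.
have nc0 (u : R[i]) : 0 <= nc u by case: u => u v; rewrite /= sqrtr_ge0.
have B0 : 0 < nc (b%:C * z + 1).
  by rewrite lt_neqAle nc0 andbT eq_sym; apply: contra bz0 => /eqP /ComplexField.Normc.eq0_normc ->.
have bb : 0 < b ^+ 2 - 1 by have := b1; nra.
have [z1|z1|//] := ltgtP (nc z) 1.
- have : nc (b%:C * z + 1) < nc (z + b%:C).
    have : 0 < 1 - nc z ^+ 2 by rewrite subr_gt0 expr_lt1.
    move=> /(mulr_gt0 bb); rewrite -key subr_gt0 ltr_sqr// nnegrE//.
  move=> H0; have H : 1 < nc (z + b%:C) / nc (b%:C * z + 1) by rewrite ltr_pdivlMr// mul1r.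
  have : 1 < (nc (z + b%:C) / nc (b%:C * z + 1)) ^+ d by rewrite exprn_egt1// -lt0n.
  by rewrite -nfz ltNge ltW.
- have : nc (z + b%:C) < nc (b%:C * z + 1).
    have : 0 < nc z ^+ 2 - 1 by rewrite subr_gt0 exprn_egt1.
    move=> /(mulr_gt0 bb); rewrite -[_ * _]opprK -mulrN opprB -key opprB subr_gt0 ltr_sqr// nnegrE//.
  move=> H0; have H : nc (z + b%:C) / nc (b%:C * z + 1) < 1 by rewrite ltr_pdivrMr// mul1r.
  have q0 : 0 <= nc (z + b%:C) / nc (b%:C * z + 1) by rewrite divr_ge0.
  have : (nc (z + b%:C) / nc (b%:C * z + 1)) ^+ d < 1 by rewrite exprn_ilt1// -lt0n.
  by rewrite -nfz ltNge ltW.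
Qed.

End CircleMaps.

(** * Complex derivatives and multipliers at points of the circle *)

Section Multiplier.
Variables (R : realType) (b : R).
Hypothesis b1 : 1 < b.
Local Notation C := (R[i]^o).

Lemma is_derive_mobius (z : C) : b%:C * z + 1 != 0 ->
  is_derive z (1 : C) (fun w : C => (w + b%:C) / (b%:C * w + 1) : C)
    ((1 - b%:C ^+ 2) / (b%:C * z + 1) ^+ 2).
Proof.
move=> bz.
have dN : is_derive z (1 : C) (fun w : C => w + b%:C : C) 1.
  have H := is_deriveD (is_derive_id z (1 : C)) (is_derive_cst (b%:C : C) z (1 : C)).
  by apply: is_derive_eq H _; rewrite addr0.
have dD : is_derive z (1 : C) (fun w : C => b%:C * w + 1 : C) b%:C.
  have H := is_deriveD (is_deriveZ b%:C (is_derive_id z (1 : C))) (is_derive_cst (1 : C) z (1 : C)).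
  by apply: is_derive_eq H _; rewrite addr0 /GRing.scale /= mulr1.
have dI := is_derive_inv bz dD.
have H := is_deriveM dN dI.
apply: is_derive_eq H _; rewrite /GRing.scale /=.
by field.
Qed.

Lemma is_derive_fk (l : R[i]) d (z : C) : b%:C * z + 1 != 0 ->
  is_derive z (1 : C) (affine_coord (fk b l d))
   (l * (d%:R * ((z + b%:C) / (b%:C * z + 1)) ^+ d.-1 * ((1 - b%:C ^+ 2) / (b%:C * z + 1) ^+ 2))).
Proof.
move=> bz.
have HX := is_deriveX d (is_derive_mobius bz); rewrite exprfctE in HX.
have H := is_deriveZ l HX.
have H2 : is_derive z (1 : C) (fun w : C => l * ((w + b%:C) / (b%:C * w + 1)) ^+ d : C)
   (l * (d%:R * ((z + b%:C) / (b%:C * z + 1)) ^+ d.-1 * ((1 - b%:C ^+ 2) / (b%:C * z + 1) ^+ 2))).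
  by apply: is_derive_eq H _; rewrite /GRing.scale /=.
apply: near_eq_is_derive H2.
have cD : {for z, continuous (fun w : C => b%:C * w + 1 : C)}.
  have dD : is_derive z (1 : C) (fun w : C => b%:C * w + 1 : C) b%:C.
    have HD := is_deriveD (is_deriveZ b%:C (is_derive_id z (1 : C))) (is_derive_cst (1 : C) z (1 : C)).
    by apply: is_derive_eq HD _; rewrite addr0 /GRing.scale /= mulr1.
  by case: dD => [dD _]; apply/differentiable_continuous/derivable1_diffP.
have : \forall w \near z, b%:C * w + 1 != 0 :> C by exact: cvgr_neq0 cD bz.
apply: filterS => w bw; by rewrite /affine_coord /fk (negbTE bw).
Qed.

Lemma has_multiplier_circle (th u : R) d (m : R[i]) : (0 < d)%N ->
  has_multiplier (fk b (cis th) d) (Some (cis u)) m -> `|m| = (d%:R * dhlift b u)%:C.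
Proof.
move=> d0 H.
have H2 := is_derive_fk (cis th) d (bcis_neq0 b1 u).
have -> : m = 'D_1 (affine_coord (fk b (cis th) d)) (cis u) by rewrite (@derive_val _ _ _ _ _ _ _ H).
rewrite (@derive_val _ _ _ _ _ _ _ H2).
rewrite !normrM norm_cis mul1r normrX mobius_cis// norm_cis expr1n mulr1.
rewrite normr_nat rmorphM /= rmorph_nat; congr (_ * _).
rewrite normfV normrX -cis_hlift// normrM norm_cis mul1r.
have -> : `|cis u + b%:C| = (nrm b u)%:C.
  rewrite norm_nc /cis; simpc; rewrite /= /nrm nrm2E; congr (Num.sqrt (_ + _))%:C; congr (_ ^+ 2).
  by rewrite addrC.
have -> : `|1 - b%:C ^+ 2| = (b ^+ 2 - 1)%:C.
  rewrite distrC ger0_norm; first by rewrite rmorphB rmorphXn rmorph1.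
  by rewrite -rmorphXn -(rmorph1 (real_complex R)) -rmorphB ler0c subr_ge0; have := b1; nra.
by rewrite /dhlift -nrm_sq// fmorph_div rmorphXn.
Qed.

End Multiplier.

(** * Extraction of subsequences *)

Section Subsequences.

Lemma subsequence_exists (P : nat -> nat -> Prop) :
  (forall n j, exists2 i, (j <= i)%N & P n i) ->
  exists2 phi : nat -> nat, {homo phi : m n / (m < n)%N} & forall n, P n (phi n).
Proof.
move=> H.
have /choice[f fP] (nj : nat * nat) : exists i, (nj.2 <= i)%N /\ P nj.1 i.
  by have [i ? ?] := H nj.1 nj.2; exists i.
pose phi := fix phi n := if n is n'.+1 then f (n, (phi n').+1) else f (0%N, 0%N).
exists phi; last by case=> [|n]; [exact: (fP (0%N, 0%N)).2|exact: (fP (n.+1, (phi n).+1)).2].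
apply: homo_ltn => [|n]; first exact: ltn_trans.
exact: (fP (n.+1, (phi n).+1)).1.
Qed.

(** The pigeonhole principle, by induction on the bound: either the largest allowed value recurs, or
    it is eventually absent and the bound drops. *)
Lemma bounded_recurrent (k : nat -> nat) M :
  (exists j0, forall i, (j0 <= i)%N -> (k i < M)%N) ->
  exists K, forall j, exists2 i, (j <= i)%N & k i = K.
Proof.
elim: M => [[j0 /(_ j0 (leqnn _))]//|M IH [j0 Hj0]].
have [rec|nrec] := pselect (forall j, exists2 i, (j <= i)%N & k i = M); first by exists M.
apply: IH; apply: contrapT => H; apply: nrec => j.
apply: contrapT => H2; apply: H; exists (maxn j0 j) => i.
rewrite geq_max => /andP[ji0 ji]; have := Hj0 i ji0; rewrite ltnS leq_eqVlt => /orP[/eqP kM|//].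
by exfalso; apply: H2; exists i.
Qed.

End Subsequences.

(** * The chordal metric, and equicontinuity from normality *)

Section Sphere.
Variable R : realType.
Local Notation C := (R[i]^o).
Local Notation nc := (@ComplexField.Normc.normc R).
Implicit Types (z w : R[i]) (u t x : R).

Lemma nc_ge0 z : 0 <= nc z.
Proof. by case: z => x y /=; rewrite sqrtr_ge0. Qed.

Lemma ncN z : nc (- z) = nc z.
Proof. by apply: complexI; rewrite -!norm_nc normrN. Qed.

Lemma ncB z w : nc (z - w) = nc (w - z).
Proof. by rewrite -opprB ncN. Qed.

Lemma nc_triangle z1 z2 z3 : nc (z1 - z3) <= nc (z1 - z2) + nc (z2 - z3).
Proof.
rewrite -lecR rmorphD /= -!norm_nc.
have -> : z1 - z3 = (z1 - z2) + (z2 - z3) by ring.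
exact: ler_normD.
Qed.

Lemma nbhs_nc (z : C) (U : set C) : nbhs z U ->
  exists2 r, 0 < r & forall w : C, nc (w - z) < r -> U w.
Proof.
move=> /nbhs_ballP[[r s] /=]; rewrite ltcE /= => /andP[/eqP -> r0] He.
exists r => // w wz; apply: He; rewrite /ball /= norm_nc ncB.
by rewrite ltcE /= eqxx.
Qed.

Lemma nc_nbhs (z : C) (U : set C) r : 0 < r -> (forall w : C, nc (w - z) < r -> U w) -> nbhs z U.
Proof.
move=> r0 H; apply/nbhs_ballP; exists r%:C => /=; first by rewrite ltcR.
by move=> w; rewrite /ball /= norm_nc ltcR ncB; exact: H.
Qed.

Lemma open_nc_ball z r : open [set w : C | nc (w - z) < r].
Proof.
rewrite openE => w /= wr.
apply: (@nc_nbhs _ _ (r - nc (w - z))); first by rewrite subr_gt0.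
move=> v /= vr; have := nc_triangle v w z; lra.
Qed.

Lemma norm_sin_le x : `|sin x| <= `|x|.
Proof.
wlog x0 : x / 0 <= x => [H|].
  have [|x0] := leP 0 x; first exact: H.
  by rewrite -normrN -sinN -[leRHS]normrN; apply: H; rewrite oppr_ge0 ltW.
have [z _] := mvt (@is_derive_sin R) x0.
rewrite sin0 !subr0 => ->; rewrite normrM ler_piMl//; exact: cos_max.
Qed.

Lemma nc_cis_sub_le x u : nc (cis x - cis u) <= `|x - u|.
Proof.
rewrite nc_cis_sub; have := norm_sin_le ((x - u) / 2).
rewrite normrM [ `|2^-1| ]ger0_norm//; lra.
Qed.

Lemma continuous_cis : continuous (fun u => cis u : C).
Proof.
move=> t U /nbhs_nc[r r0 Hr].
apply/nbhs_ballP; exists r => //= u; rewrite /ball /= => tu.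
by apply: Hr; apply: le_lt_trans (nc_cis_sub_le _ _) _; rewrite distrC.
Qed.

Lemma continuous_some_cis : continuous (fun u => Some (cis u) : sphere R).
Proof.
move=> t; apply: (@continuous_comp _ _ _ (fun u => cis u : C) (Some : C -> sphere R)).
  exact: continuous_cis.
exact: one_point_compactification_some_continuous.
Qed.

(** A triangle inequality through a point v that may be infinite. If |v| <= 3, each chordal distance
    is at least a third of the Euclidean one. Otherwise each is at least 2 / 3, and the diameter 2
    of the circle is covered. *)
Lemma chordal_circle z w (v : sphere R) : nc z = 1 -> nc w = 1 ->
  nc (z - w) <= 4 * (chordal (Some z) v + chordal (Some w) v).
Proof.
move=> z1 w1.
have s2 : 0 < Num.sqrt 2 :> R by rewrite sqrtr_gt0.
have s2sq : Num.sqrt 2 ^+ 2 = 2 :> R by rewrite sqr_sqrtr.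
have s2le : Num.sqrt 2 <= 3 / 2 :> R by nra.
have zw : nc (z - w) <= 2.
  have := nc_triangle z 0 w; rewrite subr0 sub0r ncN z1 w1; lra.
have e2 : (1 + 1 ^+ 2) = 2 :> R by rewrite expr1n.
rewrite /chordal z1 w1 e2; case: v => [v|]; last first.
  have : 1 <= 2 / Num.sqrt 2 :> R by rewrite ler_pdivlMr//; lra.
  lra.
have n0 := nc_ge0 v.
set q := Num.sqrt (1 + nc v ^+ 2).
have qle : q <= 1 + nc v.
  rewrite /q -[leRHS]ger0_norm; last by lra.
  rewrite -sqrtr_sqr ler_sqrt ?sqr_ge0//; nra.
have q0 : 0 < q by rewrite sqrtr_gt0; have := sqr_ge0 (nc v); lra.
have low y : 0 <= y -> 4 / 3 * y / (1 + nc v) <= 2 * y / (Num.sqrt 2 * q).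
  move=> y0; rewrite ler_pdivlMr ?mulr_gt0// mulrAC ler_pdivrMr; last by lra.
  have : Num.sqrt 2 * q <= 3 / 2 * (1 + nc v) by apply: ler_pM => //; exact: ltW.
  move=> /(ler_wpM2l y0); lra.
have L1 := low _ (nc_ge0 (z - v)); have L2 := low _ (nc_ge0 (w - v)).
have [v3|v3] := leP (nc v) 3.
  have T := nc_triangle z v w; rewrite (ncB v w) in T.
  have low3 y : 0 <= y -> 1 / 3 * y <= 4 / 3 * y / (1 + nc v).
    by move=> y0; rewrite ler_pdivlMr; [nra|lra].
  have := low3 _ (nc_ge0 (z - v)); have := low3 _ (nc_ge0 (w - v)).
  have := nc_ge0 (z - v); have := nc_ge0 (w - v); lra.
have far y : nc y = 1 -> 2 / 3 <= 4 / 3 * nc (y - v) / (1 + nc v).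
  move=> y1; rewrite ler_pdivlMr; last by lra.
  have := nc_triangle v y 0; rewrite !subr0 (ncB v y) y1; lra.
have := far _ z1; have := far _ w1; lra.
Qed.

(** If equicontinuity failed at t, maps and points violating it at scales tending to 0 could be
    chosen. A subsequence of these maps converges uniformly near t; being uniformly close to one of
    its members, which is continuous, it cannot violate the estimate. *)
Lemma fatou_equicontinuous (F : nat -> sphere R -> sphere R) (G : nat -> R -> R) t e :
  (forall n u, F n (Some (cis u)) = Some (cis (G n u))) ->
  (forall n, continuous (G n)) -> fatou_set F (Some (cis t)) -> 0 < e ->
  exists2 r, 0 < r & forall n u, `|u - t| <= r -> nc (cis (G n u) - cis (G n t)) < e.
Proof.
move=> FG Gc [U [oU Ut] normU] e0; apply: contrapT => H.
have bad r : 0 < r -> exists nu : nat * R, `|nu.2 - t| <= r /\ e <= nc (cis (G nu.1 nu.2) - cis (G nu.1 t)).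
  move=> r0; apply: contrapT => H2; apply: H; exists r => // n u utr.
  by rewrite ltNge; apply/negP => le; apply: H2; exists (n, u).
have [r0 r00 Hr0] : exists2 r0, 0 < r0 & forall u, `|u - t| <= r0 -> U (Some (cis u)).
  have /continuous_some_cis/nbhs_ballP[r /= r0 Hr] : nbhs (Some (cis t) : sphere R) U by exact: open_nbhs_nbhs.
  exists (r / 2); first by rewrite divr_gt0.
  by move=> u ut; apply: Hr; rewrite /ball /= distrC; lra.
pose rho N : R := Num.min r0 (N.+1%:R^-1).
have rho0 N : 0 < rho N by rewrite lt_min r00 invr_gt0 ltr0n.
have /choice[nu nuP] N := bad _ (rho0 N).
have [phi [g [phimono conv]]] := normU (fun N => F (nu N).1) (fun N => ex_intro2 _ _ _ I erefl).
pose K : set (sphere R) := (fun u => Some (cis u) : sphere R) @` `[t - r0, t + r0].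
have inK u : `|u - t| <= r0 -> K (Some (cis u)).
  by rewrite ler_distl => ut; exists u.
have cK : compact K.
  apply: continuous_compact; last exact: segment_compact.
  by apply: continuous_subspaceT => x; exact: continuous_some_cis.
have KU : K `<=` U.
  by move=> _ [u /= ut <-]; apply: Hr0; rewrite ler_distl.
have e20 : 0 < e / 20 by rewrite divr_gt0.
have [N0 _ HN0] := conv K cK KU _ e20.
(* The limit g is not known to be continuous or to preserve the circle, so the maps are compared
   with the fixed member [A N0] instead. *)
pose A N u := cis (G (nu (phi N)).1 u).
have near N u : (N0 <= N)%N -> `|u - t| <= r0 -> nc (A N u - A N0 u) < 2 / 5 * e.
  move=> NN0 ut.
  have h1 := HN0 N NN0 _ (inK u ut); have h2 := HN0 N0 (leqnn _) _ (inK u ut).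
  rewrite /= FG in h1; rewrite /= FG in h2.
  have := chordal_circle (g (Some (cis u))) (nc_cis (G (nu (phi N)).1 u)) (nc_cis (G (nu (phi N0)).1 u)).
  rewrite /A; lra.
have [s s0 Hs] : exists2 s, 0 < s & forall u, `|u - t| < s -> nc (A N0 u - A N0 t) < 1 / 5 * e.
  have e5 : 0 < 1 / 5 * e by lra.
  have /nbhs_ballP[s /= s0 Hs] := Gc (nu (phi N0)).1 t _ (nbhsx_ballx _ _ e5).
  exists s => // u us; rewrite distrC in us; have := Hs u us.
  rewrite /ball /= distrC; exact: le_lt_trans (nc_cis_sub_le _ _).
have [N1 HN1] : exists N1, (N1.+1%:R)^-1 < s.
  have := Num.Theory.archi_boundP (ltW (_ : 0 < s^-1)); rewrite invr_gt0 => /(_ s0) Hb.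
  exists (Num.bound s^-1); rewrite -[ltRHS]invrK ltf_pV2 ?posrE ?ltr0n ?invr_gt0//.
  by apply: lt_trans Hb _; rewrite ltr_nat.
pose N := maxn N0 N1.
have NN0 : (N0 <= N)%N by exact: leq_maxl.
have phiN : (N <= phi N)%N.
  by elim: (N) => // m IH; apply: leq_ltn_trans IH _; exact: phimono.
have [nu1 nu2] := nuP (phi N).
set x := (nu (phi N)).2 in nu1 nu2.
have xr0 : `|x - t| <= r0 by apply: le_trans nu1 _; rewrite ge_min lexx.
have xs : `|x - t| < s.
  apply: le_lt_trans nu1 _; rewrite gt_min; apply/orP; right; apply: le_lt_trans HN1.
  by rewrite lef_pV2 ?posrE ?ltr0n// ler_nat ltnS (leq_trans _ phiN)// leq_maxr.
have tr0 : `|t - t| <= r0 by rewrite subrr normr0 ltW.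
have h1 := near N x NN0 xr0; have h2 := near N t NN0 tr0; have h3 := Hs x xs.
have T1 := nc_triangle (A N x) (A N0 x) (A N t).
have T2 := nc_triangle (A N0 x) (A N0 t) (A N t).
rewrite (ncB (A N0 t)) in T2.
rewrite -/(A N x) -/(A N t) in nu2.
lra.
Qed.

End Sphere.

(** * Unbounded derivatives exclude normality *)

Section JuliaPoint.
Variables (R : realType) (d : nat) (b th am ap : R).
Hypothesis T : two_cycle d b th am ap.
Local Notation nc := (@ComplexField.Normc.normc R).

(** Closeness on the circle determines the lifts only modulo 2 pi. By continuity, a lift that moved
    by eta or more would at some point have moved by exactly eta, where the chord is 2 sin (eta /
    2). *)
Lemma lift_small (g : R -> R) t r eta : continuous g -> 0 < eta -> eta <= pi ->
  (forall u, `|u - t| <= r -> nc (cis (g u) - cis (g t)) < 2 * sin (eta / 2)) ->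
  forall u, `|u - t| <= r -> `|g u - g t| < eta.
Proof.
move=> gc eta0 etapi H u ur; rewrite ltNge; apply/negP => big.
have fc : continuous (fun v => `|g v - g t|).
  move=> v; apply: (@continuous_comp _ _ _ (fun v => g v - g t) (fun x => `|x|)).
    by apply: cvgB; [exact: gc|exact: cvg_cst].
  exact: norm_continuous.
have [v [vu ve]] : exists v, `|v - t| <= r /\ `|g v - g t| = eta.
  have ft : `|g t - g t| = 0 by rewrite subrr normr0.
  have [tu|ut] := leP t u.
    have [|v] := @IVT R (fun v => `|g v - g t|) t u eta tu (continuous_subspaceT fc).
      by rewrite ft ge_min le_max ltW//= big orbT.
    rewrite in_itv /= => /andP[v1 v2] ve; exists v; split => //.
    by apply: le_trans ur; rewrite !ger0_norm ?subr_ge0// lerD2r.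
  have [|v] := @IVT R (fun v => `|g v - g t|) u t eta (ltW ut) (continuous_subspaceT fc).
    by rewrite ft ge_min le_max (ltW eta0) big/= orbT.
  rewrite in_itv /= => /andP[v1 v2] ve; exists v; split => //.
  apply: le_trans ur; rewrite distrC [leRHS]distrC !ger0_norm ?subr_ge0//; last exact: ltW.
  by rewrite lerD2l lerN2.
have := H v vu; rewrite nc_cis_sub.
have se : 0 <= sin (eta / 2) by apply: sin_ge0; lra.
have [g0|g0] := leP 0 (g v - g t).
  by rewrite ger0_norm// in ve; rewrite ve ger0_norm// ltxx.
rewrite ltr0_norm// in ve.
have -> : (g v - g t) / 2 = - (eta / 2) by rewrite -ve; field.
by rewrite sinN normrN ger0_norm// ltxx.
Qed.

Lemma continuous_flift k : continuous (flift d b th k).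
Proof.
have b1 := tc_b T; rewrite /flift; case: eqP => _; first exact: continuous_sub_hlift.
move=> x; apply: cvgB; first exact: cvg_cst.
apply: (@continuous_comp _ _ _ (fun x => th - k%:R * hlift b x) (hlift b)).
  exact: continuous_sub_hlift.
exact: continuous_hlift.
Qed.

Lemma continuous_flift_seq w n : continuous (flift_seq d b th w n).
Proof.
elim: n => [|n IH] x; first exact: cvg_id.
by apply: (@continuous_comp _ _ _ (flift_seq d b th w n) (flift d b th (w n)));
  [exact: IH|exact: continuous_flift].
Qed.

Lemma julia_of_expansion w t : (forall n, (0 < w n <= d)%N) ->
  (forall M, exists n, M < dflift_seq d b th w n t) ->
  julia_set (fhat_seq d b (cis th) w) (Some (cis t)).
Proof.
move=> wd unb fat; have b1 := tc_b T; have hp := @pi_gt0 R.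
have dR : 2 <= d%:R :> R by rewrite ler_nat; exact: tc_d T.
have B0 : 0 < (b + 1) / (b - 1) by apply: divr_gt0; lra.
have dB0 : 0 < d%:R * ((b + 1) / (b - 1)) by rewrite mulr_gt0//; lra.
(* The images of t - s and t + s will be within 2 eta of each other; both bounds make 2 eta
   admissible in [flift_seq_derivative_bound]. *)
pose eta := Num.min (pi / 4) (pi / 2 / (d%:R * ((b + 1) / (b - 1)))).
have eta0 : 0 < eta by rewrite lt_min !divr_gt0.
have eta1 : eta <= pi / 4 by rewrite ge_min lexx.
have eta2 : d%:R * ((b + 1) / (b - 1)) * eta <= pi / 2.
  by rewrite mulrC -ler_pdivlMr// ge_min lexx orbT.
clearbody eta.
have se : 0 < 2 * sin (eta / 2) by rewrite mulr_gt0//; apply: sin_gt0; lra.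
have [r r0 Hr] := fatou_equicontinuous (G := fun n => flift_seq d b th w n.+1)
  (fun n u => fhat_seq_cis th b1 d w n u) (fun n => @continuous_flift_seq w n.+1) fat se.
(* The bound 1 keeps s below pi, so that [hilb] at t does not vanish; the bound eta covers the index
   n = 0, the identity. *)
pose s := Num.min r (Num.min 1 eta).
have s0 : 0 < s by rewrite /s lt_min r0 lt_min ltr01 eta0.
have sr : s <= r by rewrite ge_min lexx.
have s1 : s <= 1 by rewrite !ge_min lexx orbT.
have seta : s <= eta by rewrite !ge_min lexx !orbT.
have pi2 := @pi_ge2 R.
have small n u : `|u - t| <= s -> `|flift_seq d b th w n u - flift_seq d b th w n t| <= eta.
  move=> us; case: n => [|n]; first exact: le_trans seta.
  apply: ltW; apply: (@lift_small _ t r) => //.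
  - exact: (@continuous_flift_seq w n.+1).
  - lra.
  - by move=> v; exact: Hr.
  - exact: le_trans sr.
have small2 n : `|flift_seq d b th w n (t + s) - flift_seq d b th w n (t - s)| <= 2 * eta.
  have h1 : `|flift_seq d b th w n (t + s) - flift_seq d b th w n t| <= eta.
    by apply: small; rewrite addrAC subrr add0r ger0_norm// ltW.
  have h2 : `|flift_seq d b th w n (t - s) - flift_seq d b th w n t| <= eta.
    by apply: small; rewrite addrAC subrr add0r normrN ger0_norm// ltW.
  rewrite -(subrKA (flift_seq d b th w n t)).
  apply: le_trans (ler_normD _ _) _.
  by rewrite [X in _ + X]distrC; lra.
have pt : t - s < t by rewrite ltrBlDr ltrDl.
have tq : t < t + s by rewrite ltrDl.
have c1 : d%:R * ((b + 1) / (b - 1) * (2 * eta)) < 2 * pi.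
  have -> : d%:R * ((b + 1) / (b - 1) * (2 * eta)) = 2 * (d%:R * ((b + 1) / (b - 1)) * eta) by ring.
  lra.
have c2 : 2 * eta <= pi / 2 by lra.
have bound := flift_seq_derivative_bound T wd pt tq c1 c2 small2.
have V0 : 0 < `|hilb t (t - s) (t + s)|.
  rewrite normr_gt0 /hilb.
  have -> : (t - (t - s)) / 2 = s / 2 by field.
  have -> : (t - (t + s)) / 2 = - (s / 2) by field.
  have -> : (t + s - (t - s)) / 2 = s by field.
  have S1 : sin (s / 2) != 0 by rewrite gt_eqF//; apply: sin_gt0; lra.
  have S2 : sin s != 0 by rewrite gt_eqF//; apply: sin_gt0; lra.
  by rewrite sinN mulrN mulNr oppr_eq0 !mulf_neq0// invr_neq0.
have [n] := unb (1 / `|hilb t (t - s) (t + s)|).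
by rewrite ltr_pdivrMr// ltNge bound.
Qed.

End JuliaPoint.

Section Chordal.
Variable R : realType.
Local Notation nc := (@ComplexField.Normc.normc R).

Lemma chordalxx (x : sphere R) : chordal x x = 0.
Proof. by case: x => [z|] //=; rewrite subrr ComplexField.Normc.normc0 mulr0 mul0r. Qed.

Lemma chordal_le (z w : R[i]) : chordal (Some z) (Some w) <= 2 * nc (z - w).
Proof.
have one v : 1 <= Num.sqrt (1 + nc v ^+ 2).
  by rewrite -[leLHS]sqrtr1 ler_wsqrtr// lerDl sqr_ge0.
rewrite /chordal ler_pdivrMr; last by apply: mulr_gt0; exact: lt_le_trans (one _).
rewrite ler_peMr//; first by rewrite mulr_ge0// nc_ge0.
by apply: mulr_ege1.
Qed.

End Chordal.

(** * The basin of the attracting fixed point lies in the Fatou set *)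

Section Basin.
Variables (R : realType) (d : nat) (b th : R).
Hypothesis b1 : 1 < b.
Local Notation C := (R[i]^o).
Local Notation nc := (@ComplexField.Normc.normc R).
Local Notation f := (fk b (cis th) d).
Local Notation phi := (fun x => th - d%:R * hlift b x).

Lemma fk_continuous_cis u e : 0 < e -> exists2 r, 0 < r & forall w : R[i], nc (w - cis u) < r ->
  exists2 w', f (Some w) = Some w' & nc (w' - cis (phi u)) < e.
Proof.
move=> e0.
have D := is_derive_fk (cis th) d (bcis_neq0 b1 u).
have cf : {for (cis u : C), continuous (affine_coord f : C -> C)}.
  by case: D => [D _]; apply/differentiable_continuous/derivable1_diffP.
have fu : affine_coord f (cis u) = cis (phi u) by rewrite /affine_coord fk_cis.
have n1 : \forall w \near (cis u : C), nc (affine_coord f w - cis (phi u)) < e.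
  apply: (cf [set v : C | nc (v - cis (phi u)) < e]); apply: (nc_nbhs e0) => v /=.
  by rewrite fu.
have cD : {for (cis u : C), continuous (fun w : C => b%:C * w + 1 : C)}.
  have dD : is_derive (cis u : C) (1 : C) (fun w : C => b%:C * w + 1 : C) b%:C.
    have HD := is_deriveD (is_deriveZ b%:C (is_derive_id (cis u : C) (1 : C))) (is_derive_cst (1 : C) (cis u : C) (1 : C)).
    by apply: is_derive_eq HD _; rewrite addr0 /GRing.scale /= mulr1.
  by case: dD => [dD _]; apply/differentiable_continuous/derivable1_diffP.
have n2 : \forall w \near (cis u : C), b%:C * w + 1 != 0 :> C by exact: cvgr_neq0 cD (bcis_neq0 b1 u).
have /nbhs_nc[r r0 Hr] : \forall w \near (cis u : C), nc (affine_coord f w - cis (phi u)) < e /\ b%:C * w + 1 != 0.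
  by near=> w; split; near: w.
exists r => // w /Hr[]; rewrite /affine_coord /fk => + bw; rewrite (negbTE bw) => h.
by eexists.
Unshelve. all: by end_near. Qed.

Lemma iter_fk_continuous_cis u n e : 0 < e -> exists2 r, 0 < r & forall w : R[i], nc (w - cis u) < r ->
  exists2 w', iter n f (Some w) = Some w' & nc (w' - cis (iter n phi u)) < e.
Proof.
elim: n e => [|n IH] e e0; first by exists e => // w wu; exists w.
have [s s0 Hs] := fk_continuous_cis (iter n phi u) e0.
have [r r0 Hr] := IH s s0.
exists r => // w /Hr[w' w'E] /Hs[w'' w''E close].
by exists w'' => //; rewrite iterS w'E.
Qed.

Lemma attracting_contraction t0 (m : R[i]) : phi t0 = t0 ->
  has_multiplier f (Some (cis t0)) m -> `|m| < 1 ->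
  exists r nu : R, [/\ 0 < r, 0 < nu, nu < 1 & forall w : R[i], nc (w - cis t0) < r ->
    exists2 w', f (Some w) = Some w' & nc (w' - cis t0) <= nu * nc (w - cis t0)].
Proof.
move=> fix0 D m1.
have nm1 : nc m < 1 by rewrite norm_nc -[1]/(1%:C) ltcR in m1.
have nm0 := nc_ge0 m.
pose nu := (1 + nc m) / 2.
have fu : affine_coord f (cis t0) = cis t0 by rewrite /affine_coord fk_cis// fix0.
have lim : (fun h : C => h^-1 *: ((affine_coord f : C -> C) (h *: (1 : C) + cis t0) - affine_coord f (cis t0))) @ 0^' --> (m : C).
  by case: D => dv <-; exact: dv.
have n1 : \forall h \near (0 : C)^', nc (h^-1 *: ((affine_coord f : C -> C) (h *: (1 : C) + cis t0) - affine_coord f (cis t0)) - m) < nu - nc m.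
  apply: (lim [set v : C | nc (v - m) < nu - nc m]).
  apply: (@nc_nbhs _ _ _ (nu - nc m)) => //; rewrite /nu; lra.
move: n1 => /nbhs_nc[r1 r10 Hr1].
have [r2 r20 Hr2] := fk_continuous_cis t0 ltr01.
exists (Num.min r1 r2), nu; split; [by rewrite lt_min r10|rewrite /nu; lra|rewrite /nu; lra|].
move=> w; rewrite lt_min => /andP[w1 w2].
have [w' fw _] := Hr2 _ w2.
exists w' => //.
have [wE|wt] := eqVneq w (cis t0).
  move: fw; rewrite wE fk_cis// fix0 => -[<-]; rewrite subrr ComplexField.Normc.normc0 mulr0.
  by [].
have h0 : w - cis t0 != 0 by rewrite subr_eq0.
have := Hr1 (w - cis t0) _ h0; rewrite subr0 => /(_ w1).
have -> : (w - cis t0) *: (1 : C) + cis t0 = w by rewrite /GRing.scale /= mulr1 subrK.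
rewrite fu {1}/affine_coord fw /GRing.scale /= => H.
have nw0 : 0 < nc (w - cis t0).
  rewrite lt_neqAle nc_ge0 andbT eq_sym; apply: contra h0 => /eqP h.
  by apply/eqP; exact: ComplexField.Normc.eq0_normc h.
have T := nc_triangle ((w - cis t0)^-1 * (w' - cis t0)) m 0.
rewrite !subr0 in T.
have : nc ((w - cis t0)^-1 * (w' - cis t0)) <= nu by lra.
rewrite ComplexField.Normc.normcM ComplexField.Normc.normcV mulrC ler_pdivrMr//.
Qed.

(** Near the point a fixed iterate enters the contracted disc, after which convergence to the fixed
    point is uniform. A sequence of iterates with bounded indices has a constant subsequence;
    otherwise a subsequence has indices tending to infinity. *)
Lemma basin_in_fatou t0 (m : R[i]) t : phi t0 = t0 ->
  has_multiplier f (Some (cis t0)) m -> `|m| < 1 ->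
  (forall e : R, 0 < e -> exists n, `|iter n phi t - t0| < e) ->
  fatou_set (iterates f) (Some (cis t)).
Proof.
move=> fix0 D m1 conv.
have [r [nu [r0 nu0 nu1 contr]]] := attracting_contraction fix0 D m1.
have r2 : 0 < r / 2 by lra.
have [n0 Hn0] := conv _ r2.
have [s s0 Hs] := iter_fk_continuous_cis t n0 r2.
pose B := [set w : C | nc (w - cis t) < s].
exists ((Some : C -> sphere R) @` B).
  split; first by apply: one_point_compactification_open_some; exact: open_nc_ball.
  exists (cis t) => //; change (nc (cis t - cis t) < s); by rewrite subrr ComplexField.Normc.normc0.
have decay w j : B w -> exists2 w', iter (n0 + j)%N f (Some w) = Some w' & nc (w' - cis t0) < nu ^+ j * r.
  move=> Bw; elim: j => [|j [w' w'E w'r]].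
    have [w' w'E close] := Hs w Bw; exists w'; first by rewrite addn0.
    rewrite expr0 mul1r.
    have T := nc_triangle w' (cis (iter n0 phi t)) (cis t0).
    have := nc_cis_sub_le (iter n0 phi t) t0; lra.
  have nuj : nu ^+ j <= 1 by apply: exprn_ile1; exact: ltW.
  have [|w'' w''E w''r] := contr w'.
    by apply: lt_le_trans w'r _; rewrite ler_piMl// ltW.
  exists w''; first by rewrite addnS iterS w'E.
  by apply: le_lt_trans w''r _; rewrite exprS -mulrA ltr_pM2l.
move=> F FP.
have /choice[k kP] : forall i, exists k, F i = iterates f k.
  by move=> i; have [k _ <-] := FP i; exists k.
have [[M [j0 HM]]|unb] := pselect (exists M, exists j0, forall i, (j0 <= i)%N -> (k i < M)%N).
  have [K HK] : exists K, forall j, exists2 i, (j <= i)%N & k i = K.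
    by apply: (@bounded_recurrent k M); exists j0.
  have [psi psimono psiK] := @subsequence_exists (fun _ i => k i = K) (fun _ j => HK j).
  exists psi, (iterates f K); split => // S _ _ e e0.
  by apply: nearW => n x _ /=; rewrite kP psiK chordalxx.
have rec n j : exists2 i, (j <= i)%N & (n <= k i)%N.
  apply: contrapT => H; apply: unb; exists n, j => i ji.
  by rewrite ltnNge; apply/negP => nk; apply: H; exists i.
have [psi psimono psiK] := @subsequence_exists (fun n i => n <= k i)%N rec.
exists psi, (fun=> Some (cis t0)); split => // S _ SB e e0.
have nuV : 1 < nu^-1 by rewrite invf_gt1.
have [N HN] := exprn_unbounded (2 * r / e) nuV.
exists (n0 + N)%N => // n /= nN x /SB[w Bw <-].
rewrite kP /iterates.
have [j kj Nj] : exists2 j, (k (psi n)).+1 = (n0 + j)%N & (N <= j)%N.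
  have kn := leq_trans nN (psiK n).
  exists ((k (psi n)).+1 - n0)%N; first by rewrite subnKC// leqW// (leq_trans _ kn)// leq_addr.
  by rewrite leq_subRL ?leqW// (leq_trans _ kn)// leq_addr.
have [w' w'E w'r] := decay w j Bw.
rewrite kj w'E; apply: le_lt_trans (chordal_le _ _) _.
have : nu ^+ j <= nu ^+ N by apply: ler_wiXn2l => //; exact: ltW.
move: HN; rewrite exprVn ltr_pdivrMr// [_^-1 * e]mulrC ltr_pdivlMr ?exprn_gt0// => HN H.
have : nu ^+ j * r <= nu ^+ N * r by rewrite ler_pM2r.
lra.
Qed.

End Basin.

Lemma int_period_eq0 (R : realType) (k : int) :
  - (2 * pi) < 2 * pi * k%:~R :> R -> 2 * pi * k%:~R < 2 * pi :> R -> k = 0.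
Proof.
have pi0 := @pi_gt0 R.
have [kp|kn|//] := ltgtP k 0.
  have : k%:~R <= -1 :> R by rewrite (_ : -1 = (-1)%:~R) ?ler_int// -ltzD1 addNr.
  by move=> /(ler_wpM2l (ltW pi0)) *; exfalso; lra.
have : 1 <= k%:~R :> R by rewrite (_ : 1 = 1%:~R) ?ler_int.
by move=> /(ler_wpM2l (ltW pi0)) *; exfalso; lra.
Qed.

(** * Angles of lambda_0, of lambda_1 and of the fixed points *)

Section FixedPoints.
Variables (R : realType) (d : nat) (b : R).
Hypotheses (b1 : 1 < b) (d2 : (2 <= d)%N) (db : d%:R * (b - 1) < b + 1).
Local Notation h := (hlift b).
Local Notation dh := (dhlift b).

Lemma dhlift_norm x : dh `|x| = dh x.
Proof. by case: (ger0P x) => _; rewrite ?dhliftN. Qed.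

Lemma natmul_dhlift0 : d%:R * dh 0 < 1.
Proof.
have hb := b1; have hdb := db.
rewrite /dhlift /nrm2 cos0.
have -> : b ^+ 2 + 2 * b * 1 + 1 = (b + 1) ^+ 2 by ring.
have b10 : 0 < b + 1 by lra.
rewrite mulrA ltr_pdivrMr ?exprn_gt0//.
by have := ltr_pM2r b10 (d%:R * (b - 1)) (b + 1); rewrite hdb => H; lra.
Qed.

Lemma natmul_hlift_lt ts x : 0 < x -> x <= ts -> ts <= pi -> d%:R * dh ts = 1 -> d%:R * h x < x.
Proof.
move=> x0 xts tspi E; have d0 : 0 < d%:R :> R by rewrite ltr0n; case: d d2.
(* The inequality d h' < 1 is strict only before ts, so [0, x] is halved and the first half gives
   strictness even when x = ts. *)
have x2 : 0 <= x / 2 by lra.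
have [u /andP[u0 u1] eu] := mvt (is_derive_hlift b1) x2.
have x2x : x / 2 <= x by lra.
have [v /andP[v0 v1] ev] := mvt (is_derive_hlift b1) x2x.
move: eu; rewrite hlift0// !subr0 => eu.
have Hu : d%:R * dh u < 1 by rewrite -[ltRHS]E ltr_pM2l//; apply: dhlift_strict => //; lra.
have Hv : d%:R * dh v <= 1 by rewrite -[leRHS]E ler_pM2l//; apply: dhlift_mono => //; lra.
have -> : h x = dh u * (x / 2) + dh v * (x - x / 2) by rewrite -eu -ev; ring.
nra.
Qed.

Lemma natmul_sin_gt (x : R) : 0 < x -> d%:R * x < pi -> sin (d%:R * x) < d%:R * sin x.
Proof.
move=> x0 dx; have d2' : 2 <= d%:R :> R by rewrite ler_nat.
have x2 : 2 * x < pi by nra.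
have hx0 : 0 < sin (x / 2) by apply: sin_gt0; lra.
have c1 : cos x < 1 by rewrite cos_half; have := exprn_gt0 2 hx0; lra.
have s0 : 0 < sin x by apply: sin_gt0; lra.
have := @sin_concave _ (2 * x) (d%:R * x) _ _ (ltW dx).
rewrite (sin_half (2 * x)); have -> : 2 * x / 2 = x by field.
move=> /(_ _ _) H; have {}H : 2 * x * sin (d%:R * x) <= d%:R * x * (2 * sin x * cos x).
  by apply: H; nra.
rewrite -(ltr_pM2l (_ : 0 < 2 * x)); last by lra.
apply: le_lt_trans H _.
have -> : d%:R * x * (2 * sin x * cos x) = (2 * x * (d%:R * sin x)) * cos x by ring.
have P : 0 < 2 * x * (d%:R * sin x) by apply: mulr_gt0; [lra|apply: mulr_gt0 => //; lra].
by rewrite gtr_pMr.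
Qed.

(** Otherwise x = (pi - ts) / d is at most h(ts). But h'(ts) sin ts = sin h(ts) and d h'(ts) = 1
    give d sin h(ts) = sin ts = sin (d x) < d sin x, a contradiction. *)
Lemma parabolic_angle_lt_pi (ts : R) : 0 < ts -> ts < pi -> d%:R * dh ts = 1 -> ts + d%:R * h ts < pi.
Proof.
move=> ts0 tspi E; rewrite ltNge; apply/negP => ge.
have d2' : 2 <= d%:R :> R by rewrite ler_nat.
have H := natmul_hlift_lt ts0 (lexx _) (ltW tspi) E.
have hts0 : 0 <= h ts by apply: hlift_ge0; [|exact: ltW].
pose x := (pi - ts) / d%:R.
have dx : d%:R * x = pi - ts by rewrite /x; field; rewrite gt_eqF//; lra.
have x0 : 0 < x by rewrite divr_gt0//; lra.
have xh : x <= h ts by rewrite ler_pdivrMr; lra.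
have S := natmul_sin_gt x0; rewrite dx in S.
have sin_ts : d%:R * sin (h ts) = sin ts by rewrite -dhlift_sin// mulrA E mul1r.
have : sin x <= sin (h ts) by apply: sin_le => //; nra.
have {}S : sin (pi - ts) < d%:R * sin x by apply: S; lra.
move=> le; have E2 : sin (pi - ts) = sin ts by rewrite (sinD pi) sinpi cospi sinN mul0r add0r mulrNN mul1r.
have := ler_wpM2l (ler0n R d) le; rewrite E2 in S; lra.
Qed.

(** The fixed point is on the circle, at an angle u with d h'(u) = 1. The angle u + d h(u) agrees
    with t1 modulo 2 pi; both have modulus below pi, so they are equal, and t1 > 0 selects |u|. *)
Lemma parabolic_angle (t1 : R) : 0 < t1 -> t1 < pi ->
  (exists p, parabolic_fixed_point (fk b (cis t1) d) p) ->
  exists ts, [/\ 0 < ts, ts < pi, d%:R * dh ts = 1 & t1 = ts + d%:R * h ts].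
Proof.
move=> t10 t1pi [p [fp [m D [n n0 mn]]]].
have d0 : (0 < d)%N by case: d d2.
have d0R : 0 < d%:R :> R by rewrite ltr0n.
have [u pu] := fk_fixed_on_circle b1 d0 fp.
have pi0 := @pi_gt0 R.
have [k /andP[k1 k2]] := reduce_mod2pi u (- pi); have kpi : u + 2 * pi * k%:~R < pi by lra.
have {}pu : p = Some (cis (u + 2 * pi * k%:~R)) by rewrite cis_int.
move: (u + _) pu k1 kpi => {k k2}{}u pu u1 u2.
rewrite pu in fp D.
have dhu : d%:R * dh u = 1.
  have m1 : `|m| = 1.
    by apply: (pexpIrn n0); rewrite ?nnegrE// -normrX mn normr1 expr1n.
  have := has_multiplier_circle b1 d0 D; rewrite m1 -[1]/(1%:C) => /complexI; exact: esym.
have u0 : 0 < `|u|.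
  rewrite normr_gt0; apply/eqP => u0; have := natmul_dhlift0; rewrite -u0 dhu; lra.
have upi : `|u| < pi.
  rewrite lt_neqAle; apply/andP; split; last by rewrite ler_norml; lra.
  apply/eqP => upi; have := natmul_hlift_lt (@pi_gt0 R) (lexx _) (lexx _).
  rewrite -upi dhlift_norm upi hliftpi// => /(_ dhu).
  have : 2 <= d%:R :> R by rewrite ler_nat.
  nra.
have E : d%:R * dh `|u| = 1 by rewrite dhlift_norm.
have lt := parabolic_angle_lt_pi u0 upi E.
have hu0 : 0 <= h `|u| by apply: hlift_ge0 => //; exact: ltW.
exists `|u|; split => //.
move: fp; rewrite fk_cis// => /Some_inj/cis_inj_mod[k tk].
have {}tk : t1 = u + d%:R * h u + 2 * pi * k%:~R by lra.
have nu : `|u + d%:R * h u| = `|u| + d%:R * h `|u|.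
  have dhu0 : 0 <= d%:R * h `|u| by rewrite mulr_ge0// ltW.
  move: dhu0; have [up|un] := leP 0 u; first by rewrite (ger0_norm up) => ?; rewrite ger0_norm// addr_ge0.
  rewrite (ltr0_norm un) hliftN// mulrN => ?; rewrite ler0_norm; [ring|lra].
have bnd : `|u + d%:R * h u| < pi by rewrite nu.
have k0 : k = 0.
  move: bnd; rewrite ltr_norml => /andP[B1 B2].
  by apply: (@int_period_eq0 R); lra.
move: tk; rewrite k0 mulr0 addr0 => tk.
by rewrite -nu -tk gtr0_norm.
Qed.

(* The minimal angle satisfies t = d h t only modulo 2 pi; below the first zero
   of t - d h t this function lies in [0, pi), so the congruence is an equality. *)
Lemma lambda0_angle ts l0 : 0 < ts -> ts < pi -> d%:R * dh ts = 1 -> is_lambda0 d b l0 ->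
  exists t0, [/\ 0 < t0, t0 < pi, d%:R * h t0 = t0 & l0 = cis t0].
Proof.
move=> ts0 tspi E [t0 [-> [t00 good] minim]]; have d2' : 2 <= d%:R :> R by rewrite ler_nat.
have pi0 := @pi_gt0 R.
pose D t : R := t - d%:R * h t.
have [s [s0 spi Ds]] : exists s, [/\ 0 < s, s < pi & D s = 0].
  have Dts : 0 < D ts by rewrite subr_gt0; apply: natmul_hlift_lt (lexx _) (ltW tspi) E.
  have Dpi : D pi < 0 by rewrite /D hliftpi//; nra.
  have cD : continuous D.
    move=> x; apply: cvgB; first exact: cvg_id.
    by apply: cvgM; [exact: cvg_cst|exact: continuous_hlift].
  have [|s] := @IVT R D ts pi 0 (ltW tspi) (continuous_subspaceT cD).
    by rewrite ge_min le_max (ltW Dts) (ltW Dpi) orbT.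
  rewrite in_itv /= => /andP[s1 s2] Ds; exists s; split => //; first exact: lt_le_trans s1.
  by rewrite lt_neqAle s2 andbT; apply: contraTN Dpi => /eqP <-; rewrite Ds ltxx.
have t0s : t0 <= s.
  by apply: minim; split => //; rewrite fk_cis// (_ : s - d%:R * h s = 0) ?cis0.
have D0 : 0 <= D t0.
  have := hlift_star b1 (ltW t00) t0s (ltW spi).
  have hs : d%:R * h s = s by move: Ds; rewrite /D; lra.
  move=> /(ler_wpM2l (ler0n R d)).
  have -> : d%:R * (t0 * h s) = s * t0 by rewrite -[in RHS]hs; ring.
  have -> : d%:R * (s * h t0) = s * (d%:R * h t0) by ring.
  by rewrite ler_pM2l// subr_ge0.
exists t0; split => //; first exact: le_lt_trans spi.
have ht0 : 0 <= d%:R * h t0 by rewrite mulr_ge0// hlift_ge0// ltW.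
move: good; rewrite fk_cis// -/(D t0) -(cis0 R) => /Some_inj/cis_inj_mod[n].
rewrite add0r => Dn.
have n0 : n = 0 by rewrite /D in Dn D0; apply: (@int_period_eq0 R); lra.
by move: Dn; rewrite n0 mulr0 /D; lra.
Qed.

(** Convexity of h. This is how the position of lambda after lambda_0 is used: it shows th - d h(th)
    <= 0, where th is the image of the angle 0. *)
Lemma angle_le_natmul_hlift t0 t : 0 < t0 -> d%:R * h t0 = t0 -> t0 <= t -> t <= pi ->
  t <= d%:R * h t.
Proof.
move=> t00 E t0t tpi.
have := hlift_star b1 (ltW t00) t0t tpi.
move=> /(ler_wpM2l (ler0n R d)).
have -> : d%:R * (t * h t0) = t0 * t by rewrite -[in RHS]E; ring.
have -> : d%:R * (t0 * h t) = t0 * (d%:R * h t) by ring.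
by rewrite ler_pM2l.
Qed.

(* At the parameter t0 the arc [0, t0] is mapped into itself, so Schwarz's lemma
   (in the form [hilb_natmul_le]) bounds the multiplier of its fixed point by 1. *)
Lemma lambda0_le_lambda1 ts t0 : 0 < ts -> ts < pi -> d%:R * dh ts = 1 ->
  0 < t0 -> t0 < pi -> d%:R * h t0 = t0 -> t0 <= ts + d%:R * h ts.
Proof.
move=> ts0 tspi E t00 t0pi E0; have d0 : (0 < d)%N by case: d d2.
have d0R : 0 < d%:R :> R by rewrite ltr0n.
have pi0 := @pi_gt0 R.
pose G t : R := t + d%:R * h t.
have cG : continuous G.
  move=> x; apply: cvgD; first exact: cvg_id.
  by apply: cvgM; [exact: cvg_cst|exact: continuous_hlift].
have G0 : G 0 = 0 by rewrite /G hlift0// mulr0 addr0.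
have Gt0 : G t0 = 2 * t0 by rewrite /G E0; ring.
have [|u] := @IVT R G 0 t0 t0 (ltW t00) (continuous_subspaceT cG).
  by rewrite G0 Gt0 ge_min le_max; apply/andP; split; apply/orP; [left|right]; lra.
rewrite in_itv /= => /andP[u0 ut0] Gu.
have {}u0 : 0 < u by rewrite lt_neqAle u0 andbT; apply/eqP => u00; rewrite -u00 G0 in Gu; lra.
have {}ut0 : u < t0 by rewrite lt_neqAle ut0 andbT; apply/eqP => ut; rewrite ut Gt0 in Gu; lra.
have s0 : sin ((t0 - 0) / 2) != 0 by rewrite gt_eqF//; apply: sin_gt0; lra.
have ht0 : 0 < h t0 by rewrite -(hlift0 b); exact: hlift_lt.
have H : hilb (d%:R * h u) (d%:R * 0) (d%:R * h t0) <= d%:R * hilb (h u) 0 (h t0).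
  by apply: hilb_natmul_le => //; rewrite subr0; lra.
have hil : hilb (h u) 0 (h t0) = dh u * hilb u 0 t0.
  by rewrite -[X in hilb _ X](hlift0 b) hilb_hlift.
rewrite hil mulr0 E0 -(hilb_refl t0) subr0 subrr in H.
have uE : t0 - d%:R * h u = u by rewrite -[X in X - _]Gu /G; ring.
rewrite uE mulrA in H.
have neg : hilb u 0 t0 < 0.
  rewrite /hilb pmulr_llt0 ?invr_gt0; last by apply: sin_gt0; lra.
  have -> : (u - t0) / 2 = - ((t0 - u) / 2) by field.
  by rewrite sinN mulrN oppr_lt0 mulr_gt0//; apply: sin_gt0; lra.
have dhu : d%:R * dh u <= 1 by rewrite leNgt; apply/negP => ?; nra.
have uts : u <= ts.
  rewrite leNgt; apply/negP => tsu; have := dhlift_strict b1 (ltW ts0) tsu (ltW (lt_trans ut0 t0pi)).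
  rewrite -(ltr_pM2l d0R) E; lra.
have := hlift_le b1 uts; rewrite -(ler_pM2l d0R) -/(G ts) => ?.
by rewrite -[leLHS]Gu /G; lra.
Qed.

(** A multiplier below 1 forces |u| < ts by monotonicity of h'; then |u + d h(u)| < pi, so the fixed
    point equation modulo 2 pi is an equality, and th > 0 makes u positive. *)
Lemma attracting_fixed_angle ts th p : 0 < ts -> ts < pi -> d%:R * dh ts = 1 ->
  0 < th -> th < ts + d%:R * h ts -> attracting_fixed_point (fk b (cis th) d) p ->
  exists t0, [/\ p = Some (cis t0), 0 < t0, t0 < ts & th - d%:R * h t0 = t0].
Proof.
move=> ts0 tspi E th0 thlt [fp [m D m1]].
have d0 : (0 < d)%N by case: d d2.
have d0R : 0 < d%:R :> R by rewrite ltr0n.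
have thpi := lt_trans thlt (parabolic_angle_lt_pi ts0 tspi E).
have [u pu] := fk_fixed_on_circle b1 d0 fp.
have pi0 := @pi_gt0 R.
have [k /andP[k1 k2]] := reduce_mod2pi u (- pi); have kpi : u + 2 * pi * k%:~R < pi by lra.
have {}pu : p = Some (cis (u + 2 * pi * k%:~R)) by rewrite cis_int.
move: (u + _) pu k1 kpi => {k k2}{}u pu u1 u2.
rewrite pu in fp D.
have dhu : d%:R * dh u < 1.
  by move: m1; rewrite (has_multiplier_circle b1 d0 D) -[ltRHS]/(1%:C) ltcR.
have upi : `|u| <= pi by rewrite ler_norml u1 ltW.
have uts : `|u| < ts.
  rewrite ltNge; apply/negP => tsu; have := dhlift_mono b1 (ltW ts0) tsu upi.
  rewrite -(ler_pM2l d0R) E dhlift_norm; lra.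
have bnd : `|d%:R * h u| <= d%:R * h ts.
  rewrite normrM ger0_norm ?ler0n// ler_pM2l//.
  move: uts; rewrite ltr_norml ler_norml => /andP[/ltW/(hlift_le b1) + /ltW/(hlift_le b1)].
  by rewrite hliftN// => -> ->.
move: bnd uts; rewrite ltr_norml ler_norml => /andP[B1 B2] /andP[B3 B4].
have tspi2 := parabolic_angle_lt_pi ts0 tspi E.
move: fp; rewrite fk_cis// => /Some_inj/cis_inj_mod[n tn].
have n0 : n = 0 by apply: (@int_period_eq0 R); lra.
rewrite n0 mulr0 addr0 in tn.
exists u; split => //.
rewrite ltNge; apply/negP => u0; have := hlift_le b1 u0; rewrite hlift0// => hu.
have := ler_wpM2l (ltW d0R) hu; rewrite mulr0; lra.
Qed.

End FixedPoints.

(** If the increasing orbit stayed below c - e, continuity at its supremum, which g moves strictly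
    up, would carry it past that supremum. *)
Lemma iter_reaches (R : realType) (g : R -> R) a c e : continuous g ->
  (forall t, a <= t -> t < c -> t < g t <= c) -> 0 < e -> a <= c ->
  exists n, c - e < iter n g a <= c.
Proof.
move=> gc inc e0 ac; apply: contrapT => H.
have low n : a <= iter n g a <= c - e.
  elim: n => [|n /andP[IH1 IH2]].
    by rewrite lexx /= leNgt; apply/negP => ?; apply: H; exists 0%N; rewrite /= ac andbT.
  have /andP[i1 i2] : iter n g a < g (iter n g a) <= c by apply: inc => //; lra.
  rewrite iterS; apply/andP; split; first exact: le_trans IH1 (ltW i1).
  rewrite leNgt; apply/negP => ?; apply: H; exists n.+1; rewrite iterS i2 andbT//.
pose S := range (fun n => iter n g a).
have hS : has_sup S.
  by split; [exists a, 0%N|exists (c - e) => _ [n _ <-]; case/andP: (low n)].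
have ub n : iter n g a <= sup S by apply: ub_le_sup; [exact: hS.2|exists n].
have Lc : sup S <= c - e by apply: ge_sup; [exact: hS.1|move=> _ [n _ <-]; case/andP: (low n)].
have /andP[gL _] : sup S < g (sup S) <= c.
  by apply: inc; [exact: ub 0%N|lra].
have r0 : 0 < g (sup S) - sup S by rewrite subr_gt0.
have /nbhs_ballP[s /= s0 Hs] := gc (sup S) _ (nbhsx_ballx _ _ r0).
have [_ [n _ <-] near_sup] := sup_adherent s0 hS.
have := Hs (iter n g a); rewrite /ball /= ger0_norm ?subr_ge0// => /(_ _).
have := ub n.+1; rewrite iterS => le H2.
have := H2 ltac:(lra); rewrite ltr_norml; lra.
Qed.

(** * Existence of the 2-cycle and the basin between its points *)

Section TwoCycleExists.
Variables (R : realType) (d : nat) (b th t0 : R).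
Hypotheses (b1 : 1 < b) (d2 : (2 <= d)%N) (db : d%:R * (b - 1) < b + 1).
Local Notation h := (hlift b).
Local Notation dh := (dhlift b).
Local Notation phi x := (th - d%:R * h x).

Lemma natmul_hlift_anti x y : x <= y -> phi y <= phi x.
Proof. by move=> xy; rewrite lerD2l lerN2 ler_wpM2l// hlift_le. Qed.

Lemma natmul_hlift_anti_lt x y : x < y -> phi y < phi x.
Proof.
by move=> xy; rewrite ltrD2l ltrN2 ltr_pM2l ?hlift_lt// ltr0n; case: d d2.
Qed.

Lemma continuous_phi2 : continuous (fun x => phi (phi x)).
Proof.
move=> x; apply: (@continuous_comp _ _ _ (fun x => phi x) (fun x => phi x));
  exact: (@continuous_sub_hlift _ _ b1 th d).
Qed.

Lemma phi2_gt_near : phi t0 = t0 -> d%:R * dh t0 < 1 ->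
  exists2 r, 0 < r & forall t, t0 - r < t -> t < t0 -> t < phi (phi t).
Proof.
move=> fix0 dh0.
have cdh : continuous (fun x => d%:R * dh x).
  by move=> x; apply: cvgM; [exact: cvg_cst|exact: continuous_dhlift].
have r0 : 0 < 1 - d%:R * dh t0 by rewrite subr_gt0.
have /nbhs_ballP[s /= s0 Hs] := cdh t0 _ (nbhsx_ballx _ _ r0).
have lt1 x : `|x - t0| < s -> d%:R * dh x < 1.
  rewrite distrC => xs; have := Hs x xs; rewrite /ball /= ltr_norml; lra.
exists s => // t ts tt0.
have [u /andP[u1 u2] eu] := mvt (is_derive_hlift b1) (ltW tt0).
have du : d%:R * dh u < 1 by apply: lt1; rewrite ltr_norml; apply/andP; split; lra.
have e1 : phi t = t0 + d%:R * dh u * (t0 - t).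
  by rewrite -mulrA -eu -[X in _ = X + _]fix0; ring.
have du0 : 0 <= d%:R * dh u by rewrite mulr_ge0// ltW// dhlift_gt0.
have p0 : 0 <= phi t - t0 by rewrite e1 addrC addKr mulr_ge0//; lra.
have p1 : phi t - t0 < t0 - t by rewrite e1 addrC addKr gtr_pMl// subr_gt0.
have le : t0 <= phi t by lra.
have [v /andP[v1 v2] ev] := mvt (is_derive_hlift b1) le.
have dv : d%:R * dh v < 1 by apply: lt1; rewrite ltr_norml; apply/andP; split; lra.
have e2 : phi (phi t) = t0 - d%:R * dh v * (phi t - t0).
  by rewrite -mulrA -ev -[X in _ = X - _]fix0; ring.
rewrite e2; have := ler_wpM2r p0 (ltW dv); rewrite mul1r; lra.
Qed.

(** am is the supremum of the t in [0, t0) that the second iterate does not move up. The angle 0 is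
    one of them, since 0 goes to th and th to an angle <= 0. The supremum is below t0 because t0
    attracts, and it is fixed by continuity. Its image is ap, and beyond am the second iterate moves
    every point of (am, t0) up. *)
Lemma two_cycle_exists : 0 < t0 -> t0 < th -> th < pi -> phi t0 = t0 -> d%:R * dh t0 < 1 ->
  th <= d%:R * h th ->
  exists am ap, [/\ two_cycle d b th am ap, am < t0, t0 < ap &
    forall t, am < t -> t < t0 -> t < phi (phi t) <= t0].
Proof.
move=> t00 t0th thpi fix0 dh0 thle.
have [r r0 near0] := phi2_gt_near fix0 dh0.
pose S := [set t | 0 <= t < t0 /\ phi (phi t) <= t].
have S0 : S 0.
  by split; [rewrite lexx|rewrite hlift0 mulr0 subr0 subr_le0].
have Sr t : S t -> t <= t0 - r.
  move=> [/andP[_ tt0] le]; rewrite leNgt; apply/negP => tr.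
  by have := near0 t tr tt0; rewrite ltNge le.
have hS : has_sup S by split; [exists 0|exists (t0 - r) => t /Sr].
pose am := sup S.
have am0 : 0 <= am by apply: ub_le_sup => //; exact: hS.2.
have amr : am <= t0 - r by apply: ge_sup; [exact: hS.1|move=> t /Sr].
have cg : continuous (fun x => phi (phi x) - x).
  by move=> x; apply: cvgB; [exact: continuous_phi2|exact: cvg_id].
have am_le : phi (phi am) <= am.
  rewrite leNgt; apply/negP => gt.
  have e0 : 0 < phi (phi am) - am by rewrite subr_gt0.
  have /nbhs_ballP[s /= s0 Hs] := cg am _ (nbhsx_ballx _ _ e0).
  have [t St tam] := sup_adherent s0 hS.
  have tle : t <= am by apply: ub_le_sup => //; exact: hS.2.
  have ball_t : `|am - t| < s by rewrite -/am in tam; rewrite ger0_norm; lra.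
  have := Hs t ball_t; rewrite /ball /= ltr_norml => H.
  by case: St => _; lra.
pose c := t0 - r / 2.
have c_gt : c < phi (phi c) by apply: near0; rewrite /c; lra.
have amc : am <= c by rewrite /c; lra.
have am_fix : phi (phi am) = am.
  have [|e] := @IVT R (fun x => phi (phi x) - x) am c 0 amc (continuous_subspaceT cg).
    by rewrite ge_min le_max; apply/andP; split; apply/orP; [left|right]; lra.
  rewrite in_itv /= => /andP[e1 e2] /eqP; rewrite subr_eq0 => /eqP ee.
  have eam : e <= am.
    apply: ub_le_sup; first exact: hS.2.
    split; last by rewrite ee.
    by apply/andP; split; [lra|rewrite /c in e2; lra].
  by have -> : am = e by lra.
have amt0 : am < t0 by lra.
have t0ap : t0 < phi am by rewrite -[ltLHS]fix0; exact: natmul_hlift_anti_lt.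
exists am, (phi am); split => //; first by split => //; lra.
move=> t amt tt0; apply/andP; split.
  rewrite ltNge; apply/negP => le.
  suff : t <= am by lra.
  by apply: ub_le_sup; [exact: hS.2|split => //; apply/andP; split; lra].
rewrite -[leRHS]fix0 -[in leRHS]fix0.
exact/natmul_hlift_anti/natmul_hlift_anti/ltW.
Qed.

(** To the left of t0 the second iterate increases towards t0; a point to the right of t0 is sent to
    the left by one application of the decreasing map. *)
Lemma two_cycle_basin am ap t : two_cycle d b th am ap -> phi t0 = t0 ->
  (forall t, am < t -> t < t0 -> t < phi (phi t) <= t0) -> am < t -> t < ap ->
  forall e : R, 0 < e -> exists n, `|iter n (fun x => phi x) t - t0| < e.
Proof.
move=> T fix0 inc amt tap e e0.
have iter2 n x : iter n (fun x => phi (phi x)) x = iter n.*2 (fun x => phi x) x.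
  by elim: n => //= n ->.
have left_half x : am < x -> x <= t0 -> exists n, `|iter n (fun x => phi x) x - t0| < e.
  move=> amx xt0.
  have [n /andP[n1 n2]] : exists n, t0 - e < iter n (fun x => phi (phi x)) x <= t0.
    apply: iter_reaches => //; first exact: continuous_phi2.
    by move=> y xy; apply: inc; exact: lt_le_trans xy.
  by exists n.*2; rewrite -iter2 ler0_norm; lra.
have [tt0|t0t] := leP t t0; first exact: left_half.
have [n Hn] : exists n, `|iter n (fun x => phi x) (phi t) - t0| < e.
  apply: left_half; last by rewrite -[leRHS]fix0; exact/natmul_hlift_anti/ltW.
  by rewrite -[ltLHS](tc_2 T); exact: natmul_hlift_anti_lt.
by exists n.+1; rewrite iterSr.
Qed.

End TwoCycleExists.

(** * From the complement of I to the complement of the arc, and conclusion *)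

Lemma hilb_ge0_outside (R : realType) (t p q : R) : p < q -> q < p + 2 * pi ->
  (forall n : int, ~ (p < t + 2 * pi * n%:~R < q)) -> 0 <= hilb t p q.
Proof.
move=> pq qp out; have pi0 := @pi_gt0 R.
have [n /andP[n1 n2]] := reduce_mod2pi t p.
rewrite -(hilb_int t p q n).
have := out n; move: (t + _) n1 n2 => x px xp.
have [->|xnp] := eqVneq x p; first by rewrite /hilb subrr mul0r sin0 mul0r mul0r.
rewrite lt_neqAle eq_sym xnp px /= => /negP; rewrite -leNgt => qx.
rewrite /hilb; apply: divr_ge0; first apply: mulr_ge0; apply: sin_ge0; lra.
Qed.

Lemma arc_in_attracting_arc (R : realType) (d : nat) (b th am ap t0 t : R) :
  am < t0 -> t0 < ap -> am < t -> t < ap ->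
  (forall u, am < u -> u < ap -> fatou_set (iterates (fk b (cis th) d)) (Some (cis u))) ->
  attracting_arc d b (cis th) (Some (cis t0)) (Some (cis t)).
Proof.
move=> amt0 t0ap amt tap fat.
pose B : set (sphere R) := (fun u => Some (cis u) : sphere R) @` `]am, ap[.
have inB u : am < u -> u < ap -> B (Some (cis u)).
  by move=> amu uap; exists u => //=; rewrite in_itv /= amu.
apply: (@connected_component_max _ (fatou_set (iterates (fk b (cis th) d)) `&` @unit_circle R)
  B (Some (cis t0))); last exact: inB.
- exact: inB.
- move=> _ [u /= + <-]; rewrite in_itv /= => /andP[amu uap]; split; first exact: fat.
  by exists (cis u) => //=; exact: norm_cis.
- apply: connected_continuous_connected; first exact/connected_intervalP/interval_is_interval.
  by apply: continuous_subspaceT => u; exact: continuous_some_cis.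
Qed.

Theorem proposition5p15 (R : realType) (d : nat) (b : R)
    (l0 l1 l : R[i]) (p : sphere R)
    (hd : (2 <= d)%N)
    (hb : 1 < b < (d%:R + 1) / (d%:R - 1))
    (hl0 : is_lambda0 d b l0)
    (hl1 : is_lambda1 d b l1)
    (hl : arc_co l0 l1 l)
    (hp : attracting_fixed_point (fk b l d) p) :
  forall z : sphere R, (@unit_circle R `\` attracting_arc d b l p) z ->
    exists2 w : nat -> nat, Omega d w & julia_set (fhat_seq d b l w) z.
Proof.
have pi0 := @pi_gt0 R.
move: hb => /andP[b1 hb].
have dR : 2 <= d%:R :> R by rewrite ler_nat.
have db : d%:R * (b - 1) < b + 1.
  by move: hb; rewrite ltr_pdivlMr; lra.
have [[t1 /andP[t10 t1pi] l1E] par] := hl1.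
rewrite l1E in par.
have [ts [ts0 tspi E t1E]] := parabolic_angle b1 hd db t10 t1pi par.
have [a0 [a00 a0pi E0 l0E]] := lambda0_angle b1 hd ts0 tspi E hl0.
have a0t1 : a0 <= t1 by rewrite t1E; exact: lambda0_le_lambda1 E _ _ E0.
have [th [lE a0th tht1]] : exists th, [/\ l = cis th, a0 <= th & th < t1].
  have [r [s [t [+ + -> sr /andP[rt ts']]]]] := hl.
  rewrite l0E l1E => /esym/cis_inj_mod[n rn] /esym/cis_inj_mod[m sm].
  have mnE : 2 * pi * (m - n)%:~R = 2 * pi * m%:~R - 2 * pi * n%:~R :> R.
    by rewrite rmorphB /= mulrBr.
  (* The ends of the arc must be shifted by the same multiple of 2 pi: r < s < r + 2 pi leaves only
     m = n or m = n + 1, and a0 <= t1 excludes the latter. *)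
  have nm : m - n = 0 by apply: (@int_period_eq0 R); rewrite mnE; lra.
  have {}nm : m = n by apply/eqP; rewrite -subr_eq0 nm.
  exists (t + 2 * pi * (- n)%:~R); rewrite cis_int; split => //.
    by rewrite rmorphN /=; lra.
  by rewrite rmorphN /= -nm in rn sm *; lra.
rewrite lE in hp *.
have th0 : 0 < th by lra.
have thpi : th < pi by lra.
rewrite t1E in tht1.
have [t0 [pE t00 t0ts fix0]] := attracting_fixed_angle b1 hd ts0 tspi E th0 tht1 hp.
have thle : th <= d%:R * hlift b th by apply: angle_le_natmul_hlift E0 a0th (ltW thpi).
have dh0 : d%:R * dhlift b t0 < 1.
  by rewrite -[ltRHS]E ltr_pM2l; [apply: dhlift_strict => //; lra|lra].
have t0th : t0 < th.
  have : 0 < hlift b t0 by rewrite -(hlift0 b); exact: hlift_lt.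
  nra.
have [am [ap [T amt0 t0ap inc]]] := two_cycle_exists b1 hd db t00 t0th thpi fix0 dh0 thle.
rewrite pE => z [[w w1 <-] nz].
have [t wt] := cis_surj w1; rewrite wt in nz *.
have [m D m1] : exists2 m : R[i], has_multiplier (fk b (cis th) d) p m & `|m| < 1 by exact: hp.2.
rewrite pE in D.
have fat u : am < u -> u < ap -> fatou_set (iterates (fk b (cis th) d)) (Some (cis u)).
  move=> amu uap; apply: (basin_in_fatou b1 fix0 D m1).
  exact: (two_cycle_basin b1 hd T fix0 inc amu uap).
have Ht : 0 <= hilb t am ap.
  apply: hilb_ge0_outside; [exact: tc_lt T| |].
    by have := tc_am T; have [_ _ _ _ ?] := tc_hlift T; lra.
  move=> n /andP[n1 n2]; apply: nz; rewrite -(cis_int t n).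
  exact: (arc_in_attracting_arc amt0 t0ap n1 n2 fat).
have [w' w'd unb] := expanding_word T Ht.
by exists w' => //; exact: (julia_of_expansion T w'd unb).
Qed.
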